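(* All leafless quantum graphs isospectral (for the standard Laplacian $\Delta_0$) to a given quantum graph have the same shortest edge length. (The multiplicity of that edge length may vary.)
   Context: Combinatorial graphs are finite; loops and multiple edges are allowed, and a loop contributes $2$ to the degree of its vertex. All graphs are assumed connected, without isolated vertices and without vertices of degree $2$. A graph is leafless if it has no vertex of degree $1$. A quantum graph $G$ is a combinatorial graph with vertex set $V$ and edge set $E$ together with a length function $L:E\to\mathbb{R}_{>0}$; each edge $e$ is identified with $[0,L(e)]$. Convention: a loop of length $l$ is counted as two edges of length $l/2$; the shortest edge length is taken with this convention. The standard Laplacian $\Delta_0$ acts on each edge as $f\mapsto -f''$; its domain consists of all functions $f$ that are continuous on $G$, lie in the Sobolev space $W_2$ (two derivatives in $L^2$) on each edge, and satisfy the Kirchhoff condition $\sum_{e\sim v}\nu_{v,e}(f|_e)=0$ at every vertex $v$, where $\nu_{v,e}$ is the outward unit normal of the edge $e$ at $v$ (a loop at $v$ contributes at both of its ends). Two quantum graphs are isospectral if their operators $\Delta_0$ have the same eigenvalues including multiplicities. *)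

(* Defs.v *)
From mathcomp Require Import all_boot all_order all_algebra.
From mathcomp Require Import all_classical all_reals all_analysis.

Set Implicit Arguments.
Unset Strict Implicit.
Unset Printing Implicit Defensive.

Import Order.TTheory GRing.Theory Num.Theory.
Import numFieldNormedType.Exports.

Local Open Scope classical_set_scope.
Local Open Scope ring_scope.

(* Finite multigraphs. The orientation given by [gsrc] and [gtgt] is arbitrary:
   it only records which end of an edge is the parameter 0. *)
Record multigraph := Multigraph {
  vert : finType;
  edge : finType;
  gsrc : edge -> vert;
  gtgt : edge -> vert }.

Definition is_loop (G : multigraph) (e : edge G) : bool := gsrc e == gtgt e.

(* A loop is counted once in each summand, hence contributes 2. *)
Definition degree (G : multigraph) (v : vert G) : nat :=
  (#|[set e : edge G | gsrc e == v]%SET| +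
   #|[set e : edge G | gtgt e == v]%SET|)%N.

Definition adjacent (G : multigraph) : rel (vert G) := fun u v =>
  [exists e : edge G,
     ((gsrc e == u) && (gtgt e == v)) || ((gsrc e == v) && (gtgt e == u))].

Definition graph_connected (G : multigraph) : Prop :=
  (0 < #|vert G|)%N /\ forall u v : vert G, connect (@adjacent G) u v.

Definition leafless (G : multigraph) : Prop :=
  forall v : vert G, degree v <> 1%N.

Record quantum_graph (R : realType) := QuantumGraph {
  qgraph :> multigraph;
  qlen : edge qgraph -> R;
  qlen_gt0 : forall e, 0 < qlen e;
  qgraph_connected : graph_connected qgraph;
  qgraph_no_isolated : forall v : vert qgraph, degree v <> 0%N;
  qgraph_no_deg2 : forall v : vert qgraph, degree v <> 2%N }.

(* A loop of length l counts as two edges of length l / 2. *)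
Definition edge_length (R : realType) (G : quantum_graph R) (e : edge G) : R :=
  if is_loop e then qlen e / 2 else qlen e.

Definition shortest_edge_length (R : realType) (G : quantum_graph R) : R :=
  inf (range (@edge_length R G)).

Lemma shortest_edge_lengthP (R : realType) (G : quantum_graph R) :
  (exists e : edge G, shortest_edge_length G = edge_length e) /\
  (forall e : edge G, shortest_edge_length G <= edge_length e).
Proof.
have [[/card_gt0P[v _] _] dv] := (qgraph_connected G, @qgraph_no_isolated _ G).
have [e0 _] : exists e : edge G, true.
  have /eqP := dv v; rewrite /degree addn_eq0 negb_and -!lt0n.
  by case/orP => /card_gt0P[e _]; exists e.
pose e1 := [arg min_(e < e0) edge_length e]%O.
have He1 (e : edge G) : edge_length e1 <= edge_length e.
  by rewrite /e1; case: Order.TotalTheory.arg_minP => // i _; apply.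
suff -> : shortest_edge_length G = edge_length e1 by split => //; exists e1.
apply/eqP; rewrite eq_le; apply/andP; split.
  by apply: ge_inf; [exists (edge_length e1) => _ [e _ <-]|exists e1].
by apply: lb_le_inf; [exists (edge_length e0), e0|move=> _ [e _ <-]].
Qed.

Definition L2 (R : realType) (l : R) (g : R -> R) : Prop :=
  g \_ `[0, l] \in Lfun (@lebesgue_measure R) 2%:E.

(* [g] is the weak derivative on [0, l] of the continuous representative [f];
   in dimension one this means that [f] is a primitive of [g]. *)
Definition weak_deriv (R : realType) (l : R) (f g : R -> R) : Prop :=
  (@lebesgue_measure R).-integrable `[0, l] (EFin \o g) /\
  forall x, x \in `[0, l] ->
    f x = f 0 + (\int[@lebesgue_measure R]_(t in `[0, x]) g t)%R.

(* [f] lies in W_2 of [0, l], with first and second derivatives [f1], [f2].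
   [f1] is the continuous representative, so its values at 0 and l are those of
   the one-sided derivatives of [f], whereas [f2] is only relevant a.e. *)
Definition sobolev2 (R : realType) (l : R) (f f1 f2 : R -> R) : Prop :=
  [/\ L2 l f, L2 l f1, L2 l f2, weak_deriv l f f1 & weak_deriv l f1 f2].

(* A function on G is a family of functions of a real variable indexed by the
   edges; only the values on [0, qlen e] are meaningful. *)
Definition qfun (R : realType) (G : quantum_graph R) : Type :=
  edge G -> R -> R.

Definition continuous_on_graph (R : realType) (G : quantum_graph R)
    (f : qfun G) : Prop :=
  (forall e, {within `[0, qlen e], continuous (f e)}) /\
  exists c : vert G -> R,
    forall e, f e 0 = c (gsrc e) /\ f e (qlen e) = c (gtgt e).

(* Sum of the outward normal derivatives at [v] of a function with edgewise
   derivative [f1]: the outward direction is decreasing at the end 0 and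
   increasing at the end [qlen e]. *)
Definition normal_sum (R : realType) (G : quantum_graph R)
    (f1 : qfun G) (v : vert G) : R :=
  \sum_(e : edge G | gsrc e == v) - f1 e 0 +
  \sum_(e : edge G | gtgt e == v) f1 e (qlen e).

(* [f] belongs to the domain of the standard Laplacian and its image is [h] (as
   an element of L^2). *)
Definition standard_laplacian (R : realType) (G : quantum_graph R)
    (f h : qfun G) : Prop :=
  exists f1 f2 : qfun G,
    [/\ forall e, sobolev2 (qlen e) (f e) (f1 e) (f2 e),
        continuous_on_graph f,
        forall v : vert G, normal_sum f1 v = 0 &
        forall e, {ae @lebesgue_measure R,
                    forall x, x \in `[0, qlen e] -> h e x = - f2 e x}].

Definition in_eigenspace (R : realType) (G : quantum_graph R) (lambda : R)
    (f : qfun G) : Prop :=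
  standard_laplacian f (fun e x => lambda * f e x).

Definition eq_on_graph (R : realType) (G : quantum_graph R) (f g : qfun G)
    : Prop :=
  forall e x, x \in `[0, qlen e] -> f e x = g e x.

Definition lincomb (R : realType) (G : quantum_graph R) (n : nat)
    (a : 'I_n -> R) (f : 'I_n -> qfun G) : qfun G :=
  fun e x => \sum_(i < n) a i * f i e x.

(* The eigenspace of [lambda] has dimension [n]: it has a basis of [n] elements.
   The real number [lambda] is an eigenvalue exactly when [n] is positive. *)
Definition has_multiplicity (R : realType) (G : quantum_graph R) (lambda : R)
    (n : nat) : Prop :=
  exists f : 'I_n -> qfun G,
    [/\ forall i, in_eigenspace lambda (f i),
        forall a : 'I_n -> R,
          eq_on_graph (lincomb a f) (fun _ _ => 0) -> forall i, a i = 0 &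
        forall g : qfun G, in_eigenspace lambda g ->
          exists a : 'I_n -> R, eq_on_graph g (lincomb a f)].

Definition isospectral (R : realType) (G H : quantum_graph R) : Prop :=
  forall (lambda : R) (n : nat),
    has_multiplicity G lambda n <-> has_multiplicity H lambda n.

(* Main.v *)
Require Import Defs.
From HB Require Import structures.
From mathcomp Require Import all_boot all_order all_algebra.
From mathcomp Require Import all_classical all_reals all_analysis.
From mathcomp Require Import measurable_realfun perm complex ring lra.

(** A wave of frequency [k] on a quantum graph is given by its outgoing
    amplitude on each bond, that is, on each edge with a direction. The
    amplitudes travel along the bonds, which multiplies them by [e^{i k l}], and
    are scattered at the vertices by a real orthogonal matrix [S]. Hence the
    eigenvalue [k^2 <> 0] has multiplicity [dim ker (1 - U(k))], where
    [U(k) = S diag (e^{i k l})] ([kernel_dim_vertex_conditions],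
    [has_multiplicity_kernel]).

    The secular determinant [F(k) = det (1 - U(k))] is an entire function. Off
    the real axis [U(k)] is a strict contraction or expansion, up to the
    orthogonal factor, so that all zeros of [F] are real ([secular_neq0]). The
    order of [F] at a real [p] is exactly [dim ker (1 - U(p))]: the derivative of
    [U] pairs this kernel with itself through the matrix of the lengths, which is
    positive ([secular_factor]). So isospectral graphs have secular determinants
    with the same zeros and orders, except perhaps at [0].

    Such a determinant is determined, up to a unimodular factor, by its nonzero
    zeros ([spectral_function_unique]). Let [L1], [L2] be the types of two of
    them, and [w1], [w2] their orders at [0]. After multiplication by exponentials
    and powers of [k], their quotient [Q] is an entire function without zeros,
    and far from the real axis [|Q|] is about
    [e^{(L1 - L2) |Im k|} |k|^{w2 - w1}]. Inside a horizontal strip, [Q] is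
    controlled by its values on the two boundary lines: almost periods of the
    [e^{i k l}] give vertical segments, arbitrarily far away, on which the
    denominator is bounded below ([secular_sides]), and a Phragmen-Lindelof
    argument removes them ([strip_principle]). Widening the strip shows that
    [Q] would vanish if [L1 < L2], or if [L1 = L2] and [w2 < w1]; by symmetry
    [L1 = L2] and [w1 = w2], and then [|Q| <= 1] in both directions.

    It remains to read the shortest edge length [s] off [F]. Along the imaginary
    axis, [1 - F(i y)] is a sum over closed walks on the bonds, and those of at
    most two bonds give its leading term [c e^{-2 s y}]: loops run once, edges run
    back and forth, and pairs of parallel edges ([damped_det_expansion]). Their
    weights are products of scattering amplitudes. Transmission has the positive
    amplitude [2 / d] and backscattering the amplitude [2 / d - 1], which is
    negative when the degree [d] is at least [3]. A walk back and forth has two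
    backscatterings, so all these weights are nonnegative for a leafless graph,
    nothing cancels, and [c > 0] ([scattering_pair_ge0], [shortest_attained]).
    Therefore [F], and with it the spectrum, determines [s]. *)

Set Implicit Arguments.
Unset Strict Implicit.
Unset Printing Implicit Defensive.

Import Order.TTheory GRing.Theory Num.Theory.
Import numFieldNormedType.Exports.

Local Open Scope classical_set_scope.
Local Open Scope ring_scope.
Local Notation Re := complex.Re.
Local Notation Im := complex.Im.

(** * Modulus and germs of complex functions *)
Section Modulus.
Variable R : realType.
Local Notation C := (R[i]).
Implicit Types (x y : R) (z w : C).

(** The modulus with values in [R] rather than in [R[i]], so that it is totally
    ordered. *)
Definition cabs z : R := Normc.normc z.
Definition rc x : C := Complex x 0.
Definition ci : C := Complex 0 1.

HB.instance Definition _ := GRing.RMorphism.copy rc (real_complex R).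

Lemma cabsE z : cabs z = Num.sqrt (Re z ^+ 2 + Im z ^+ 2).
Proof. by case: z. Qed.

Lemma sqr_cabs z : cabs z ^+ 2 = Re z ^+ 2 + Im z ^+ 2.
Proof. by rewrite cabsE sqr_sqrtr // addr_ge0 ?sqr_ge0. Qed.

Lemma cabs_ge0 z : 0 <= cabs z.
Proof. by rewrite cabsE sqrtr_ge0. Qed.

Lemma cabs0 : cabs 0 = 0. Proof. exact: Normc.normc0. Qed.
Lemma cabs1 : cabs 1 = 1. Proof. exact: Normc.normc1. Qed.

Lemma cabsM z w : cabs (z * w) = cabs z * cabs w.
Proof. exact: Normc.normcM. Qed.

Lemma cabsV z : cabs z^-1 = (cabs z)^-1.
Proof. exact: Normc.normcV. Qed.

Lemma cabsN z : cabs (- z) = cabs z.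
Proof. exact: normcN. Qed.

Lemma ler_cabsD z w : cabs (z + w) <= cabs z + cabs w.
Proof. exact: le_normcD. Qed.

Lemma ler_cabsD_le z w x y : cabs z <= x -> cabs w <= y -> cabs (z + w) <= x + y.
Proof. by move=> zx wy; rewrite (le_trans (ler_cabsD _ _)) // lerD. Qed.

Lemma cabs_eq0 z : (cabs z == 0) = (z == 0).
Proof.
apply/eqP/eqP => [|->]; last exact: cabs0.
exact: Normc.eq0_normc.
Qed.

Lemma cabs_gt0 z : (0 < cabs z) = (z != 0).
Proof. by rewrite lt_neqAle cabs_ge0 andbT eq_sym cabs_eq0. Qed.

Lemma cabsX z n : cabs (z ^+ n) = cabs z ^+ n.
Proof. by elim: n => [|n IH]; rewrite ?expr0 ?cabs1 // !exprS cabsM IH. Qed.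

Lemma cabsB z w : cabs (z - w) = cabs (w - z).
Proof. by rewrite -cabsN opprB. Qed.

Lemma ler_cabsB z w : cabs z - cabs w <= cabs (z - w).
Proof. by rewrite lerBlDr (le_trans _ (ler_cabsD _ _)) // subrK. Qed.

Lemma cabs_close z w x :
  x <= cabs z -> cabs (z - w) <= x / 2 -> x / 2 <= cabs w.
Proof. by have := ler_cabsB z (z - w); rewrite subKr; lra. Qed.

Lemma ler_cabs_sum (I : Type) (r : seq I) (P : pred I) (F : I -> C) :
  cabs (\sum_(i <- r | P i) F i) <= \sum_(i <- r | P i) cabs (F i).
Proof.
elim/big_rec2: _ => [|i x z _ le_zx]; first by rewrite cabs0.
by rewrite (le_trans (ler_cabsD _ _)) // lerD2l.
Qed.

Lemma cabs_prod (I : Type) (r : seq I) (P : pred I) (F : I -> C) :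
  cabs (\prod_(i <- r | P i) F i) = \prod_(i <- r | P i) cabs (F i).
Proof. exact: (big_morph _ cabsM cabs1). Qed.

Lemma cabs_rc x : cabs (rc x) = `|x|.
Proof. by rewrite cabsE /= expr0n addr0 sqrtr_sqr. Qed.

Lemma cabs_ci : cabs ci = 1.
Proof. by rewrite cabsE /= expr0n add0r expr1n sqrtr1. Qed.

Lemma normr_Re_le z : `|Re z| <= cabs z.
Proof.
rewrite -(ler_pXn2r (ltn0Sn 1)) ?nnegrE ?cabs_ge0 // sqr_cabs.
by rewrite real_normK ?num_real // lerDl sqr_ge0.
Qed.

Lemma normr_Im_le z : `|Im z| <= cabs z.
Proof.
rewrite -(ler_pXn2r (ltn0Sn 1)) ?nnegrE ?cabs_ge0 // sqr_cabs.
by rewrite real_normK ?num_real // lerDr sqr_ge0.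
Qed.

Lemma cabs_le_ReIm z : cabs z <= `|Re z| + `|Im z|.
Proof.
rewrite -(ler_pXn2r (ltn0Sn 1)) ?nnegrE ?cabs_ge0 ?addr_ge0 // sqr_cabs.
rewrite sqrrD !real_normK ?num_real //.
have := mulr_ge0 (normr_ge0 (Re z)) (normr_ge0 (Im z)); lra.
Qed.

Lemma complex_eqP z w : Re z = Re w -> Im z = Im w -> z = w.
Proof. by case: z w => [a b] [c d] /= -> ->. Qed.

Lemma ReD z w : Re (z + w) = Re z + Re w. Proof. by case: z w => ? ? []. Qed.
Lemma ImD z w : Im (z + w) = Im z + Im w. Proof. by case: z w => ? ? []. Qed.
Lemma ReN z : Re (- z) = - Re z. Proof. by case: z. Qed.
Lemma ImN z : Im (- z) = - Im z. Proof. by case: z. Qed.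
Lemma ReM z w : Re (z * w) = Re z * Re w - Im z * Im w.
Proof. by case: z w => ? ? []. Qed.
Lemma ImM z w : Im (z * w) = Re z * Im w + Im z * Re w.
Proof. by case: z w => ? ? []. Qed.
Lemma Re_sum (I : Type) (r : seq I) (P : pred I) (F : I -> C) :
  Re (\sum_(i <- r | P i) F i) = \sum_(i <- r | P i) Re (F i).
Proof. exact: (big_morph _ ReD (erefl _)). Qed.
Lemma rcM x y : rc (x * y) = rc x * rc y.
Proof. by rewrite rmorphM. Qed.
Lemma rcD x y : rc (x + y) = rc x + rc y.
Proof. by rewrite rmorphD. Qed.

Lemma rcN x : rc (- x) = - rc x.
Proof. by rewrite rmorphN. Qed.
Lemma rc1 : rc 1 = 1. Proof. by []. Qed.
Lemma rc0 : rc 0 = 0. Proof. by []. Qed.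

End Modulus.
Arguments cabs : simpl never.
Arguments ci {R}.
Definition ReImE := (ReD, ImD, ReN, ImN, ReM, ImM).

Section Jets.
Variable R : realType.
Local Notation C := (R[i]).
Implicit Types (f g : C -> C) (z w p : C).

Definition near0 (P : C -> Prop) : Prop :=
  exists2 r : R, 0 < r & forall z, cabs z < r -> P z.

Lemma near0_and (P Q : C -> Prop) :
  near0 P -> near0 Q -> near0 (fun z => P z /\ Q z).
Proof.
move=> [r r0 HP] [s s0 HQ]; exists (Num.min r s); first by rewrite lt_min r0.
by move=> z; rewrite lt_min => /andP[/HP ? /HQ ?].
Qed.

Lemma near0_imp (P Q : C -> Prop) :
  near0 P -> (forall z, P z -> Q z) -> near0 Q.
Proof. by move=> [r r0 HP] PQ; exists r => // z /HP/PQ. Qed.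

Lemma near0T (P : C -> Prop) : (forall z, P z) -> near0 P.
Proof. by exists 1. Qed.

(** Taylor expansions at [0] without derivatives: [germ n f] says that [f] is a
    polynomial of degree less than [n] up to a remainder [O(z^n)]. Unlike
    differentiability, this passes to sums, products, quotients and composites by
    algebra alone, and it is all that the maximum principle needs. *)
Fixpoint germ n f : Prop :=
  if n is n'.+1 then
    exists c g, germ n' g /\ near0 (fun z => f z = c + z * g z)
  else exists K : R, near0 (fun z => cabs (f z) <= K).

Lemma germ_near n f g : near0 (fun z => f z = g z) -> germ n f -> germ n g.
Proof.
case: n => [|n] fg /=.
  move=> [K fK]; exists K.
  by apply: near0_imp (near0_and fg fK) _ => z [<-].
move=> [c [h [hn fh]]]; exists c, h; split=> //.
by apply: near0_imp (near0_and fg fh) _ => z [<-].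
Qed.

Lemma germ_cst n c : germ n (fun=> c).
Proof.
elim: n c => [|n IH] c /=; first by exists (cabs c); apply: near0T.
by exists c, (fun=> 0); split=> //; apply: near0T => z; rewrite mulr0 addr0.
Qed.

Lemma germD n f g : germ n f -> germ n g -> germ n (fun z => f z + g z).
Proof.
elim: n f g => [|n IH] f g /=.
  move=> [K fK] [L gL]; exists (K + L).
  apply: near0_imp (near0_and fK gL) _ => z [? ?].
  by rewrite (le_trans (ler_cabsD _ _)) // lerD.
move=> [c [h [hn fh]]] [d [k [kn gk]]].
exists (c + d), (fun z => h z + k z); split; first exact: IH.
by apply: near0_imp (near0_and fh gk) _ => z [-> ->]; ring.
Qed.

Lemma germS n f : germ n.+1 f -> germ n f.
Proof.
elim: n f => [|n IH] f.
  move=> [c [g [[K gK] fg]]]; exists (cabs c + K).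
  have K1 : near0 (fun z => cabs z < 1) by exists 1.
  apply: near0_imp (near0_and fg (near0_and gK K1)) _ => z [-> [gz z1]].
  rewrite (le_trans (ler_cabsD _ _)) // lerD2l cabsM.
  by rewrite (le_trans _ gz) // ler_piMl ?cabs_ge0 // ltW.
move=> [c [g [gn fg]]]; exists c, g; split=> //; exact: IH.
Qed.

Lemma germM n f g : germ n f -> germ n g -> germ n (fun z => f z * g z).
Proof.
elim: n f g => [|n IH] f g.
  move=> [K fK] [L gL]; exists (K * L).
  apply: near0_imp (near0_and fK gL) _ => z [? ?].
  by rewrite cabsM ler_pM ?cabs_ge0.
move=> fn gn; have gn' := germS gn; move: fn gn.
move=> [c [h [hn fh]]] [d [k [kn gk]]].
exists (c * d), (fun z => c * k z + h z * g z); split.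
  by apply: germD; apply: IH => //; exact: germ_cst.
by apply: near0_imp (near0_and fh gk) _ => z [-> ->]; ring.
Qed.

Lemma germ_id n : germ n id.
Proof.
case: n => [|n] /=; first by exists 1, 1 => // z /ltW.
exists 0, (fun=> 1); split; first exact: germ_cst.
by apply: near0T => z; rewrite add0r mulr1.
Qed.

Lemma germ_expand n f : germ n.+1 f ->
  exists g, germ n g /\ near0 (fun z => f z = f 0 + z * g z).
Proof.
move=> [c [g [gn [r r0 fg]]]]; exists g; split=> //; exists r => // z zr.
have := fg 0; rewrite cabs0 mul0r addr0 => /(_ r0) ->; exact: fg.
Qed.

Lemma germ_neq0 n f : germ n.+1 f -> f 0 != 0 ->
  near0 (fun z => cabs (f 0) / 2 <= cabs (f z)).
Proof.
move=> fn f0; have {fn} : germ 1 f by elim: n fn => // n IH /germS.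
move=> /germ_expand [g [[K gK] fg]].
have c0 : 0 < cabs (f 0) by rewrite cabs_gt0.
have : near0 (fun z => cabs z < cabs (f 0) / 2 / (`|K| + 1)).
  by exists (cabs (f 0) / 2 / (`|K| + 1)) => //; rewrite !divr_gt0 // ltr_wpDl.
move=> nr; apply: near0_imp (near0_and (near0_and gK fg) nr) _ => z [[gz ->] zr].
have zg : cabs (z * g z) <= cabs (f 0) / 2.
  have K1 : 0 < `|K| + 1 by rewrite ltr_wpDl.
  rewrite cabsM (@le_trans _ _ (cabs z * (`|K| + 1))) //.
    by rewrite ler_wpM2l ?cabs_ge0 // (le_trans gz) // (le_trans (ler_norm _)) // lerDl.
  by rewrite -ler_pdivlMr // ltW.
have := ler_cabsB (f 0) (- (z * g z)); rewrite opprK cabsN; lra.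
Qed.

(** From [f z = f 0 + z * g z], the quotient by [z] of the variation of [1 / f] is
    [- (g z / f z) / f 0], which gains one order at each step. *)
Lemma germV n f : germ n.+1 f -> f 0 != 0 -> germ n.+1 (fun z => (f z)^-1).
Proof.
move=> fn f0.
have nf : near0 (fun z => f z != 0).
  apply: near0_imp (germ_neq0 fn f0) _ => z; rewrite -!cabs_gt0.
  by apply: lt_le_trans; rewrite divr_gt0 ?cabs_gt0.
have g0 : germ 0 (fun z => (f z)^-1).
  exists (cabs (f 0) / 2)^-1; apply: near0_imp (germ_neq0 fn f0) _ => z fz.
  have h0 : 0 < cabs (f 0) / 2 by rewrite divr_gt0 ?cabs_gt0.
  by rewrite cabsV lef_pV2 // posrE // (lt_le_trans h0).
have step m : germ m (fun z => (f z)^-1) -> germ m.+1 f ->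
    germ m.+1 (fun z => (f z)^-1).
  move=> fVm /germ_expand [g [gm fg]].
  exists (f 0)^-1, (fun z => - (f 0)^-1 * (g z * (f z)^-1)); split.
    by apply: germM; [exact: germ_cst|exact: germM].
  apply: near0_imp (near0_and nf fg) _ => z [fz0 fz].
  have zg : z * g z = f z - f 0 by rewrite fz addrC addKr.
  transitivity ((f 0)^-1 - (f 0)^-1 * (z * g z) * (f z)^-1); last by ring.
  by rewrite zg; field; rewrite fz0 f0.
have down k : (k <= n)%N -> germ k.+1 f.
  move=> kn; rewrite -(subnKC kn) addnC in fn.
  by elim: (n - k)%N fn => // j IH /germS.
suff: forall k, (k <= n)%N -> germ k.+1 (fun z => (f z)^-1) by apply.
elim=> [|k IH] kn; first exact: (step 0 g0 (down 0 kn)).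
by apply: step; [exact: IH (ltnW kn)|exact: down].
Qed.

(** Order [3] is what averaging over four points requires: the linear and
    quadratic terms average to zero, and the remainder is smaller than [|z|^2]. *)
Definition jet f p : Prop := germ 3 (fun z => f (p + z)).

Lemma jet_cst c p : jet (fun=> c) p. Proof. exact: germ_cst. Qed.

Lemma jetD f g p : jet f p -> jet g p -> jet (fun z => f z + g z) p.
Proof. exact: germD. Qed.

Lemma jetM f g p : jet f p -> jet g p -> jet (fun z => f z * g z) p.
Proof. exact: germM. Qed.

Lemma jetX f n p : jet f p -> jet (fun z => f z ^+ n) p.
Proof.
move=> fp; elim: n => [|n IH].
  by rewrite (_ : (fun z => _) = fun=> 1) //; exact: jet_cst.
rewrite (_ : (fun z => _) = fun z => f z * f z ^+ n); first exact: jetM.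
by apply: boolp.funext => z; rewrite exprS.
Qed.

Lemma jet_id p : jet id p.
Proof. exact: (germD (germ_cst _ p) (germ_id _)). Qed.

Lemma jetV f p : jet f p -> f p != 0 -> jet (fun z => (f z)^-1) p.
Proof. by move=> fp fp0; apply: (@germV 2 (fun z => f (p + z))) => //=; rewrite addr0. Qed.

Lemma jet_near f g p : near0 (fun z => f (p + z) = g (p + z)) ->
  jet f p -> jet g p.
Proof. exact: germ_near. Qed.

Lemma jet_sum (I : Type) (r : seq I) (P : pred I) (F : I -> C -> C) p :
  (forall i, jet (F i) p) -> jet (fun z => \sum_(i <- r | P i) F i z) p.
Proof.
move=> Fp; elim: r => [|i r IH].
  by under eq_fun do rewrite big_nil; exact: jet_cst.
under eq_fun do rewrite big_cons; case: (P i) => //; exact: jetD.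
Qed.

Lemma jet_prod (I : Type) (r : seq I) (P : pred I) (F : I -> C -> C) p :
  (forall i, jet (F i) p) -> jet (fun z => \prod_(i <- r | P i) F i z) p.
Proof.
move=> Fp; elim: r => [|i r IH].
  by under eq_fun do rewrite big_nil; exact: jet_cst.
under eq_fun do rewrite big_cons; case: (P i) => //; exact: jetM.
Qed.

Lemma jet_det n (A : C -> 'M[C]_n) p :
  (forall i j, jet (fun z => A z i j) p) -> jet (fun z => \det (A z)) p.
Proof.
move=> Ap; apply: jet_sum => s; apply: jetM; first exact: jet_cst.
by apply: jet_prod => i; exact: Ap.
Qed.

End Jets.

(** * The complex exponential *)
Section Exponential.
Variable R : realType.
Local Notation C := (R[i]).
Implicit Types (x y : R) (z w p c : C).

Definition cexp z : C :=
  Complex (expR (Re z) * cos (Im z)) (expR (Re z) * sin (Im z)).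

Lemma cexp0 : cexp 0 = 1.
Proof. by apply: complex_eqP; rewrite /= expR0 mul1r ?cos0 ?sin0. Qed.

Lemma cexpD z w : cexp (z + w) = cexp z * cexp w.
Proof.
by apply: complex_eqP; rewrite !ReImE /= !ReImE /= expRD ?cosD ?sinD; ring.
Qed.

Lemma cexp_neq0 z : cexp z != 0.
Proof.
apply/eqP => z0; have := cexpD z (- z).
by rewrite z0 subrr cexp0 mul0r => /eqP; rewrite oner_eq0.
Qed.

Lemma cabs_cexp z : cabs (cexp z) = expR (Re z).
Proof.
apply/eqP; rewrite -(eqrXn2 (ltn0Sn 1)) ?cabs_ge0 ?expR_ge0 // sqr_cabs /=.
by rewrite !exprMn -mulrDr cos2Dsin2 mulr1.
Qed.

Lemma cexp_ci x : cexp (ci * rc x) = Complex (cos x) (sin x).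
Proof.
by rewrite /cexp !ReImE /= !mul0r !mul1r subrr expR0 !mul1r add0r.
Qed.

Lemma cabs_cexp_ci x : cabs (cexp (ci * rc x)) = 1.
Proof. by rewrite cabs_cexp !ReImE /= !mul0r mul1r subrr expR0. Qed.

(** The mean value theorem integrates a bound on the derivative; iterating it
    gives the remainders of the Taylor polynomials below. *)
Lemma taylor_step (f df : R -> R) n K :
  f 0 = 0 -> (forall x, is_derive x 1 f (df x)) ->
  (forall x, `|x| <= 1 -> `|df x| <= K * `|x| ^+ n) ->
  forall x, `|x| <= 1 -> `|f x| <= K * `|x| ^+ n.+1.
Proof.
move=> f0 fd dfK x x1.
have cf : continuous f.
  move=> t; have [? _] := fd t.
  by apply: differentiable_continuous; exact/derivable1_diffP.
have K0 : 0 <= K.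
  by have := dfK 1; rewrite normr1 expr1n mulr1 lexx => /(_ isT); apply: le_trans.
have [c cx ->] : exists2 c, `|c| <= `|x| & f x = df c * x.
  have [x0|x0] := leP 0 x.
    have [c] := @MVT_segment _ f df 0 x x0 (fun t _ => fd t)
      (continuous_subspaceT cf).
    rewrite in_itv /= f0 !subr0 => /andP[c0 cx] ->; exists c => //.
    by rewrite !ger0_norm.
  have [c] := @MVT_segment _ f df x 0 (ltW x0) (fun t _ => fd t)
    (continuous_subspaceT cf).
  rewrite in_itv /= f0 !sub0r mulrN => /andP[cx c0] /oppr_inj ->; exists c => //.
  by rewrite !ler0_norm ?lerN2 // ltW.
rewrite normrM exprSr mulrA ler_wpM2r // (le_trans (dfK _ (le_trans cx x1))) //.
by rewrite ler_wpM2l // lerXn2r ?nnegrE.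
Qed.

Lemma expR_taylor3 x : `|x| <= 1 ->
  `|expR x - (1 + x + x ^+ 2 / 2 + x ^+ 3 / 6)| <= expR 1 * `|x| ^+ 4.
Proof.
move: x; apply: (@taylor_step (fun x => expR x - (1 + x + x ^+ 2 / 2 + x ^+ 3 / 6))
  (fun x => expR x - (1 + x + x ^+ 2 / 2)) 3).
- by rewrite expR0; ring.
- by move=> x; apply: is_derive_eq; rewrite /GRing.scale /=; field.
apply: (@taylor_step (fun x => expR x - (1 + x + x ^+ 2 / 2)) (fun x => expR x - (1 + x)) 2).
- by rewrite expR0; ring.
- by move=> x; apply: is_derive_eq; rewrite /GRing.scale /=; field.
apply: (@taylor_step (fun x => expR x - (1 + x)) (fun x => expR x - 1) 1).
- by rewrite expR0; ring.
- by move=> x; apply: is_derive_eq; rewrite /GRing.scale /=; ring.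
apply: (@taylor_step (fun x => expR x - 1) (@expR R) 0).
- by rewrite expR0; ring.
- by move=> x; apply: is_derive_eq; rewrite /GRing.scale /=; ring.
move=> x x1; rewrite expr0 mulr1 ger0_norm ?expR_ge0 // ler_expR.
exact: le_trans (ler_norm _) x1.
Qed.

Lemma cos_sin_taylor3 y : `|y| <= 1 ->
  `|cos y - (1 - y ^+ 2 / 2)| <= `|y| ^+ 4 /\
  `|sin y - (y - y ^+ 3 / 6)| <= `|y| ^+ 4.
Proof.
move=> y1.
have s1 : forall x, `|x| <= 1 -> `|sin x| <= 1 * `|x| ^+ 1.
  apply: (@taylor_step (@sin R) (@cos R) 0); first exact: sin0.
  by move=> x _; rewrite expr0 mulr1 ler_norml cos_geN1 cos_le1.
have c2 : forall x, `|x| <= 1 -> `|cos x - 1| <= 1 * `|x| ^+ 2.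
  apply: (@taylor_step (fun x => cos x - 1) (fun x => - sin x) 1); first by rewrite cos0 subrr.
  - by move=> x; apply: is_derive_eq; rewrite subr0.
  by move=> x x1; rewrite normrN; exact: s1.
have s3 : forall x, `|x| <= 1 -> `|sin x - x| <= 1 * `|x| ^+ 3.
  apply: (@taylor_step (fun x => sin x - x) (fun x => cos x - 1) 2); first by rewrite sin0 subrr.
  exact: c2.
have c4 : forall x, `|x| <= 1 -> `|cos x - (1 - x ^+ 2 / 2)| <= 1 * `|x| ^+ 4.
  apply: (@taylor_step (fun x => cos x - (1 - x ^+ 2 / 2)) (fun x => - (sin x - x)) 3).
  - by rewrite cos0; ring.
  - by move=> x; apply: is_derive_eq; rewrite /GRing.scale /=; field.
  by move=> x x1; rewrite normrN; exact: s3.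
have s5 : forall x, `|x| <= 1 -> `|sin x - (x - x ^+ 3 / 6)| <= 1 * `|x| ^+ 5.
  apply: (@taylor_step (fun x => sin x - (x - x ^+ 3 / 6)) (fun x => cos x - (1 - x ^+ 2 / 2)) 4).
  - by rewrite sin0; ring.
  - by move=> x; apply: is_derive_eq; rewrite /GRing.scale /=; field.
  exact: c4.
split; first by have := c4 _ y1; rewrite mul1r.
apply: le_trans (s5 _ y1) _; rewrite mul1r exprS.
by rewrite ler_piMl // exprn_ge0.
Qed.

(** The product of the Taylor polynomials of [e^x] and of [cos y + i sin y]
    differs from that of [e^{x + i y}] by six monomials of degree at least [4]. *)
Lemma cexp_taylor3 : exists K, forall z, cabs z <= 1 ->
  cabs (cexp z - (1 + z + z ^+ 2 / 2 + z ^+ 3 / 6)) <= K * cabs z ^+ 4.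
Proof.
exists (20 * expR 1 + 100); move=> z z1; set r := cabs z.
have r0 : 0 <= r := cabs_ge0 z.
pose X : C := rc (Re z); pose Y : C := ci * rc (Im z).
have zE : z = X + Y by apply: complex_eqP; rewrite !ReImE /=; ring.
have xr : `|Re z| <= r := normr_Re_le z.
have yr : `|Im z| <= r := normr_Im_le z.
pose P (w : C) := 1 + w + w ^+ 2 / 2 + w ^+ 3 / 6.
pose a : C := rc (expR (Re z)) - P X.
pose b : C := Complex (cos (Im z)) (sin (Im z)) - P Y.
have r4 x : `|x| <= r -> `|x| ^+ 4 <= r ^+ 4 by move=> ?; rewrite lerXn2r ?nnegrE.
have inv2E : (2 : C)^-1 = rc 2^-1.
  apply: (@mulfI _ 2); first by rewrite pnatr_eq0.
  by rewrite divff ?pnatr_eq0 //; apply: complex_eqP; rewrite !ReImE /=; field.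
have inv6E : (6 : C)^-1 = rc 6^-1.
  apply: (@mulfI _ 6); first by rewrite pnatr_eq0.
  by rewrite divff ?pnatr_eq0 //; apply: complex_eqP; rewrite !ReImE /=; field.
have a4 : cabs a <= expR 1 * r ^+ 4.
  have -> : a = rc (expR (Re z) - (1 + Re z + Re z ^+ 2 / 2 + Re z ^+ 3 / 6)).
    rewrite /a /P /X inv2E inv6E.
    by apply: complex_eqP; rewrite !ReImE /=; ring.
  rewrite cabs_rc (le_trans (expR_taylor3 (le_trans xr z1))) //.
  by rewrite ler_wpM2l ?expR_ge0 // r4.
have PY : P Y = Complex (1 - Im z ^+ 2 / 2) (Im z - Im z ^+ 3 / 6).
  have Y2 : Y ^+ 2 = - rc (Im z ^+ 2).
    by rewrite rmorphXn exprMn; apply: complex_eqP; rewrite !expr2 !ReImE /=; ring.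
  have Y3 : Y ^+ 3 = - (ci * rc (Im z ^+ 3)).
    by rewrite exprSr Y2 /Y [in RHS]exprSr rcM; ring.
  rewrite /P Y2 Y3 inv2E inv6E /Y; move: (Im z ^+ 2) (Im z ^+ 3) (Im z) => u2 u3 u.
  by apply: complex_eqP; rewrite !ReImE /=; ring.
have b4 : cabs b <= 2 * r ^+ 4.
  have [cy sy] := cos_sin_taylor3 (le_trans yr z1).
  have y4 := r4 _ yr.
  apply: le_trans (cabs_le_ReIm _) _.
  by rewrite /b PY !ReImE /=; lra.
have cX : cabs X <= r by rewrite cabs_rc.
have cY : cabs Y <= r by rewrite cabsM cabs_ci mul1r cabs_rc.
have cPX : cabs (P X) <= 4.
  have X1 := le_trans cX z1.
  have Xn n : cabs (X ^+ n) <= 1 by rewrite cabsX exprn_ile1 ?cabs_ge0.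
  have h2 : cabs (2 : C)^-1 <= 1.
    by rewrite inv2E cabs_rc ger0_norm; lra.
  have h6 : cabs (6 : C)^-1 <= 1.
    by rewrite inv6E cabs_rc ger0_norm; lra.
  have t2 : cabs (X ^+ 2 / 2) <= 1 by rewrite cabsM mulr_ile1 ?cabs_ge0.
  have t3 : cabs (X ^+ 3 / 6) <= 1 by rewrite cabsM mulr_ile1 ?cabs_ge0.
  rewrite /P; have := ler_cabsD (1 + X + X ^+ 2 / 2) (X ^+ 3 / 6).
  have := ler_cabsD (1 + X) (X ^+ 2 / 2); have := ler_cabsD 1 X.
  rewrite cabs1; lra.
have cE : cabs (Complex (cos (Im z)) (sin (Im z))) <= 2.
  apply: le_trans (cabs_le_ReIm _) _ => /=.
  have : `|cos (Im z)| <= 1 by rewrite ler_norml cos_geN1 cos_le1.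
  have : `|sin (Im z)| <= 1 by rewrite ler_norml sin_geN1 sin_le1.
  lra.
(* The terms of degree at least [4] in [P X * P Y]. *)
pose q := X ^+ 3 * Y / 6 + X * Y ^+ 3 / 6 + X ^+ 2 * Y ^+ 2 / 4
  + X ^+ 2 * Y ^+ 3 / 12 + X ^+ 3 * Y ^+ 2 / 12 + X ^+ 3 * Y ^+ 3 / 36.
have E : cexp z - P z = q + (a * Complex (cos (Im z)) (sin (Im z)) + P X * b).
  have -> : cexp z = rc (expR (Re z)) * Complex (cos (Im z)) (sin (Im z)).
    by apply: complex_eqP; rewrite !ReImE /=; ring.
  have -> : P z = P (X + Y) by rewrite -zE.
  by rewrite /a /b /P /q; field.
rewrite -/(P z) E.
have mono m n (c : C) : (4 <= m + n)%N -> cabs c <= 1 ->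
    cabs (X ^+ m * Y ^+ n * c) <= r ^+ 4.
  move=> mn c1; rewrite cabsM.
  apply: (@le_trans _ _ (r ^+ (m + n) * 1)).
    apply: ler_pM; rewrite ?cabs_ge0 // cabsM !cabsX exprD.
    by apply: ler_pM; rewrite ?exprn_ge0 ?cabs_ge0 // lerXn2r ?nnegrE ?cabs_ge0.
  by rewrite mulr1 ler_wiXn2l.
have nle n : (0 < n)%N -> cabs (n%:R : C)^-1 <= 1.
  move=> n0; rewrite cabsV.
  have -> : cabs (n%:R : C) = n%:R.
    have -> : (n%:R : C) = rc n%:R.
      elim: n {n0} => [|n IH] //; rewrite !mulrS IH.
      by apply: complex_eqP; rewrite !ReImE /=; ring.
    by rewrite cabs_rc normr_nat.
  by rewrite invf_le1 ?ltr0n // ler1n.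
have q4 : cabs q <= 6 * r ^+ 4.
  have t1 := mono 3%N 1%N _ isT (nle 6%N isT).
  have t2 := mono 1%N 3%N _ isT (nle 6%N isT).
  have t3 := mono 2%N 2%N _ isT (nle 4%N isT).
  have t4 := mono 2%N 3%N _ isT (nle 12%N isT).
  have t5 := mono 3%N 2%N _ isT (nle 12%N isT).
  have t6 := mono 3%N 3%N _ isT (nle 36%N isT).
  rewrite expr1 in t1; rewrite expr1 in t2.
  have -> : 6 * r ^+ 4 = r ^+ 4 + r ^+ 4 + r ^+ 4 + r ^+ 4 + r ^+ 4 + r ^+ 4.
    by ring.
  by do 5!(apply: ler_cabsD_le => //).
have ab1 : cabs (a * Complex (cos (Im z)) (sin (Im z))) <= expR 1 * r ^+ 4 * 2.
  by rewrite cabsM; apply: ler_pM; rewrite ?cabs_ge0.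
have ab2 : cabs (P X * b) <= 4 * (2 * r ^+ 4).
  by rewrite cabsM; apply: ler_pM; rewrite ?cabs_ge0.
apply: le_trans (ler_cabsD _ _) _; apply: le_trans (lerD q4 (ler_cabsD _ _)) _.
apply: le_trans (lerD (lexx _) (lerD ab1 ab2)) _.
have := exprn_ge0 4 r0; have := expR_ge0 (1 : R).
set e := expR 1; set s := r ^+ 4 => e0 s0.
have := mulr_ge0 e0 s0; lra.
Qed.

Let cexp1 z : C := if z == 0 then 1 else (cexp z - 1) / z.

Let cexp1E z : cexp z = 1 + z * cexp1 z.
Proof.
rewrite /cexp1; have [->|z0] := eqVneq z 0; last by field.
by rewrite cexp0 mul0r addr0.
Qed.

Let germ_cexp1 : germ 3 cexp1.
Proof.
have [K HK] := cexp_taylor3.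
exists 1, (fun z => 2^-1 + z * (6^-1 +
  z * ((cexp z - (1 + z + z ^+ 2 / 2 + z ^+ 3 / 6)) / z ^+ 4))).
split; last first.
  apply: near0T => z; rewrite /cexp1; have [->|z0] := eqVneq z 0; last by field.
  by rewrite mul0r addr0.
do 2!(match goal with |- germ _ (fun z => ?c + z * @?g z) =>
  exists c, g; split; last exact: near0T end).
exists K, 1 => // z /ltW z1; have [->|z0] := eqVneq z 0.
  rewrite [0 ^+ 4]expr0n invr0 mulr0 cabs0.
  have := HK 1; rewrite cabs1 (expr1n R 4) mulr1 lexx => /(_ isT).
  exact: le_trans (cabs_ge0 _).
rewrite cabsM cabsV cabsX ler_pdivrMr ?exprn_gt0 ?cabs_gt0 //.
exact: HK.
Qed.

Let germ_cexp : germ 4 cexp.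
Proof.
by exists 1, cexp1; split; [exact: germ_cexp1|apply: near0T; exact: cexp1E].
Qed.

Lemma germ_comp n (f u : C -> C) :
  germ n f -> germ n u -> germ n (fun z => f (z * u z)).
Proof.
have comp m P v : germ m v -> near0 P -> near0 (fun z => P (z * v z)).
  move=> vm [r r0 HP].
  have [K vK] : germ 0 v by elim: m vm => // m IH /germS.
  have K0 : 0 < `|K| + 1 by rewrite ltr_wpDl.
  have nr : near0 (fun z : C => cabs z < r / (`|K| + 1)).
    by exists (r / (`|K| + 1)) => //; rewrite divr_gt0.
  apply: near0_imp (near0_and vK nr) _ => z [vz]; rewrite ltr_pdivlMr // => zr.
  apply: HP; apply: le_lt_trans zr; rewrite cabsM ler_wpM2l ?cabs_ge0 //.
  by rewrite (le_trans vz) // (le_trans (ler_norm _)) // lerDl.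
elim: n f => [|n IH] f /= fn un.
  by case: fn => K fK; exists K; exact: (comp 0%N (fun z => cabs (f z) <= K)).
have [d [g [gn fg]]] := fn; exists d, (fun z => u z * g (z * u z)); split.
  by apply: germM; [exact: germS|apply: IH => //; exact: germS].
by apply: near0_imp (comp n.+1 _ _ un fg) _ => z ->; ring.
Qed.

Lemma germ_scale n (f : C -> C) c : germ n f -> germ n (fun z => f (c * z)).
Proof.
move=> fn; have := germ_comp fn (germ_cst n c).
by under [X in germ n X]eq_fun do rewrite mulrC.
Qed.

Lemma germ_cexpM c : germ 4 (fun z => cexp (c * z)).
Proof. exact: germ_scale germ_cexp. Qed.

Lemma jet_cexpM c p : jet (fun z => cexp (c * z)) p.
Proof.
have := germM (germ_cst 3 (cexp (c * p))) (germS (germ_cexpM c)).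
by rewrite /jet; under eq_fun do rewrite -cexpD -mulrDr.
Qed.

(** [c * (p + z)^2 - c * p^2] is divisible by [z], which brings [germ_comp] into
    play. *)
Lemma jet_gauss c p : jet (fun z => cexp (c * z ^+ 2)) p.
Proof.
rewrite /jet.
have -> : (fun z => cexp (c * (p + z) ^+ 2)) =
    fun z => cexp (c * p ^+ 2) * cexp (z * (2 * c * p + c * z)).
  by apply: boolp.funext => z; rewrite -cexpD; congr cexp; ring.
apply: germM; first exact: germ_cst.
apply: germ_comp; first exact: germS germ_cexp.
apply: germD; first exact: germ_cst.
by apply: germM; [exact: germ_cst|exact: germ_id].
Qed.

(** The entire function [(e^{c z} - 1) / z], with the value [c] at [0]. *)
Definition cexp_quot c z : C := c * cexp1 (c * z).

Lemma cexp_quotE c z : cexp (c * z) = 1 + z * cexp_quot c z.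
Proof. by rewrite cexp1E /cexp_quot; ring. Qed.

Lemma cexp_quot0 c : cexp_quot c 0 = c.
Proof. by rewrite /cexp_quot mulr0 /cexp1 eqxx mulr1. Qed.

Lemma germ_cexp_quot n c : (n <= 3)%N -> germ n (cexp_quot c).
Proof.
move=> n3; apply: germM; first exact: germ_cst.
apply: germ_scale; have := germ_cexp1.
by case: n n3 => [|[|[|[|//]]]] _; do ?[exact|move/germS].
Qed.

Lemma jet_cexp_quot c p : jet (cexp_quot c) p.
Proof.
have [->|p0] := eqVneq p 0.
  by rewrite /jet; under eq_fun do rewrite add0r; exact: germ_cexp_quot.
have jq : jet (fun z => (cexp (c * z) + -1) * z^-1) p.
  apply: jetM; last by apply: jetV => //; exact: jet_id.
  by apply: jetD; [exact: jet_cexpM|exact: jet_cst].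
apply: jet_near jq; exists (cabs p) => [|z zp]; first by rewrite cabs_gt0.
have pz0 : p + z != 0.
  apply/eqP => /eqP; rewrite addrC addr_eq0 => /eqP zE.
  by rewrite zE cabsN ltxx in zp.
by rewrite cexp_quotE addrAC subrr add0r mulrAC divff // mul1r.
Qed.

End Exponential.

(** * Maximum principles *)
Section MaximumPrinciple.
Variable R : realType.
Local Notation C := (R[i]).
Implicit Types (f H : C -> C) (z w p k : C).

Lemma jet_expand f p : jet f p -> exists a b (K : R),
  near0 (fun z => exists2 g, cabs g <= K &
    f (p + z) = f p + a * z + b * z ^+ 2 + z ^+ 3 * g).
Proof.
move=> jf; have [g1 [g12 Ef]] := germ_expand (jf : germ 3 _).
have [a [g2 [[b [g3 [[K g3K] Eg2]]] Eg1]]] := g12.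
exists a, b, K.
apply: near0_imp (near0_and (near0_and g3K Eg2) (near0_and Eg1 Ef)) _.
move=> z [[g3z Eg2z] [Eg1z ->]]; exists (g3 z) => //.
by rewrite Eg1z Eg2z addr0; ring.
Qed.

Lemma jet_continuous f p : jet f p -> forall e : R, 0 < e ->
  near0 (fun z => cabs (f (p + z) - f p) < e).
Proof.
move=> jf e e0; have [g [[K gK] Ef]] := germ_expand (germS (germS (jf : germ 3 _))).
have K0 : 0 < `|K| + 1 by rewrite ltr_wpDl.
have nr : near0 (fun z : C => cabs z < e / (`|K| + 1)).
  by exists (e / (`|K| + 1)) => //; rewrite divr_gt0.
apply: near0_imp (near0_and (near0_and gK Ef) nr) _ => z [[gz ->] zr].
rewrite addr0 addrAC subrr add0r cabsM.
apply: (@le_lt_trans _ _ (cabs z * (`|K| + 1))).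
  rewrite ler_wpM2l ?cabs_ge0 // (le_trans gz) // (le_trans (ler_norm _)) //.
  by rewrite lerDl.
by rewrite -ltr_pdivlMr.
Qed.

Lemma jet_cabs_continuous f (x y : R) : jet f (Complex x y) ->
  {for (x, y), continuous (fun q : R * R => cabs (f (Complex q.1 q.2)))}.
Proof.
move=> fp; apply/cvgrPdist_lt => e e0; have [r r0 fr] := jet_continuous fp e0.
have r2 : 0 < r / 2 by rewrite divr_gt0.
have nx : \forall q \near (x, y), `|x - q.1| < r / 2.
  exact: (@cvgrPdist_lt _ _ _ _ _ _ _).1 cvg_fst _ r2.
have ny : \forall q \near (x, y), `|y - q.2| < r / 2.
  exact: (@cvgrPdist_lt _ _ _ _ _ _ _).1 cvg_snd _ r2.
near=> q; have -> : Complex q.1 q.2 = Complex x y + Complex (q.1 - x) (q.2 - y).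
  by apply: complex_eqP => /=; ring.
have : cabs (Complex (q.1 - x) (q.2 - y)) < r.
  apply: le_lt_trans (cabs_le_ReIm _) _ => /=; rewrite (splitr r).
  by rewrite [`|q.1 - _|]distrC [`|q.2 - _|]distrC; apply: ltrD; near: q.
move=> /fr; apply: le_lt_trans; rewrite /=.
set u := f _; set v := f _; rewrite ler_norml.
by have := ler_cabsB u v; have := ler_cabsB v u; rewrite (cabsB v u); lra.
Unshelve. all: by end_near. Qed.

Lemma parallelogram (u v : C) :
  cabs (u + v) ^+ 2 + cabs (u - v) ^+ 2 = 2 * cabs u ^+ 2 + 2 * cabs v ^+ 2.
Proof. by rewrite !sqr_cabs !ReImE; ring. Qed.

(** The four points [+-r, +-ir] are the simplest substitute for a circle: [z] and
    [z^2] both have average zero on them, so a quadratic polynomial satisfies the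
    mean value inequality. *)
Lemma four_point_average (c a b : C) (r : R)
    (v := fun z => cabs (c + a * z + b * z ^+ 2) ^+ 2) :
  4 * cabs c ^+ 2 <= v (rc r) + v (- rc r) + v (ci * rc r) + v (- (ci * rc r)).
Proof.
have w2 : rc r ^+ 2 * -1 = (ci * rc r) ^+ 2 :> C.
  by apply: complex_eqP; rewrite !expr2 !ReImE /=; ring.
have vE w : v w + v (- w) = 2 * cabs (c + b * w ^+ 2) ^+ 2 + 2 * cabs (a * w) ^+ 2.
  by rewrite -parallelogram /v sqrrN mulrN -!addrA ![b * _ + _]addrC.
rewrite -addrA vE vE -w2 mulrN1 mulrN addrACA -mulrDr parallelogram.
have := sqr_ge0 (cabs (b * rc r ^+ 2)); have := sqr_ge0 (cabs (a * rc r)).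
have := sqr_ge0 (cabs (a * (ci * rc r))); lra.
Qed.

(** The perturbation [d |k|^2] makes [|H|^2 + d |k|^2] strictly subharmonic,
    so that it has no interior maximum. *)
Lemma jet_no_local_max H p (d r0 : R) : jet H p -> 0 < d -> 0 < r0 ->
  exists2 z, cabs z < r0 &
    cabs (H p) ^+ 2 + d * cabs p ^+ 2 <
    cabs (H (p + z)) ^+ 2 + d * cabs (p + z) ^+ 2.
Proof.
move=> /jet_expand [a [b [K [r1 r1_gt0 HE]]]] d0 r00.
pose W := cabs (H p) + cabs a + cabs b.
have W0 : 0 <= W by rewrite !addr_ge0 ?cabs_ge0.
pose B := 2 * W * `|K|.
have B0 : 0 <= B by rewrite !mulr_ge0.
pose r := Num.min (Num.min 1 (d / (B + 1))) (Num.min r0 r1) / 2.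
have r_gt0 : 0 < r by rewrite divr_gt0 // !lt_min ltr01 r00 r1_gt0 divr_gt0 ?ltr_wpDl.
have : r < Num.min (Num.min 1 (d / (B + 1))) (Num.min r0 r1).
  by rewrite /r ltr_pdivrMr // ltr_pMr ?ltr1n // -(pmulr_lgt0 _ (_ : 0 < 2^-1)) // invr_gt0.
rewrite !lt_min => /andP[/andP[r1' rd] /andP[rr0 rr1]].
apply: contrapT => noz.
pose Psi z := cabs (H (p + z)) ^+ 2 + d * cabs (p + z) ^+ 2.
have le_Psi z : cabs z = r -> Psi z <= cabs (H p) ^+ 2 + d * cabs p ^+ 2.
  by move=> zr; rewrite leNgt; apply/negP => ?; apply: noz; exists z; rewrite ?zr.
pose v z := cabs (H p + a * z + b * z ^+ 2) ^+ 2.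
have lb z : cabs z = r -> v z - B * r ^+ 3 <= cabs (H (p + z)) ^+ 2.
  move=> zr; have [|g gK ->] := HE z; first by rewrite zr.
  rewrite /v; set w := _ + _ * z ^+ 2; set rho := z ^+ 3 * g.
  have w_le : cabs w <= W.
    have r2 : r ^+ 2 <= 1 by rewrite exprn_ile1 // ltW.
    apply: ler_cabsD_le; first apply: ler_cabsD_le => //.
    - by rewrite cabsM zr ler_piMr ?cabs_ge0 // ltW.
    - by rewrite cabsM cabsX zr ler_piMr ?cabs_ge0.
  have rho_le : cabs rho <= r ^+ 3 * `|K|.
    rewrite cabsM cabsX zr ler_wpM2l ?exprn_ge0 ?(ltW r_gt0) //.
    exact: le_trans gK (ler_norm _).
  have tri : cabs w - cabs rho <= cabs (w + rho).
    by have := ler_cabsB w (- rho); rewrite cabsN opprK.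
  have key : 2 * cabs w * cabs rho <= B * r ^+ 3.
    rewrite (_ : B * _ = 2 * W * (r ^+ 3 * `|K|)); last by rewrite /B; ring.
    by apply: ler_pM; rewrite ?mulr_ge0 ?cabs_ge0 // ler_wpM2l.
  apply: le_trans (lerB (lexx _) key) _.
  have := cabs_ge0 w; have := cabs_ge0 rho; have := cabs_ge0 (w + rho).
  move: tri; set x := cabs w; set y := cabs rho; set t := cabs (w + rho).
  move=> tri t0 y0 x0; have [xy|yx] := leP x y; first by nra.
  by nra.
have c1 : cabs (rc r) = r by rewrite cabs_rc gtr0_norm.
have c2 : cabs (- rc r) = r by rewrite cabsN.
have c3 : cabs (ci * rc r) = r by rewrite cabsM cabs_ci mul1r.
have c4 : cabs (- (ci * rc r)) = r by rewrite cabsN.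
have sq : cabs (p + rc r) ^+ 2 + cabs (p + - rc r) ^+ 2 +
    cabs (p + ci * rc r) ^+ 2 + cabs (p + - (ci * rc r)) ^+ 2 =
    4 * cabs p ^+ 2 + 4 * r ^+ 2.
  by rewrite parallelogram -addrA parallelogram c1 c3; ring.
have Br : B * r ^+ 3 < d * r ^+ 2.
  rewrite exprSr mulrCA mulrC ltr_pM2r ?exprn_gt0 //.
  apply: (@le_lt_trans _ _ ((B + 1) * r)); last by rewrite mulrC -ltr_pdivlMr ?ltr_wpDl.
  by rewrite ler_wpM2r ?(ltW r_gt0) // lerDl.
have fp : 4 * cabs (H p) ^+ 2 <=
    v (rc r) + v (- rc r) + v (ci * rc r) + v (- (ci * rc r)).
  exact: four_point_average.
have := le_Psi _ c1; have := le_Psi _ c2; have := le_Psi _ c3; have := le_Psi _ c4.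
have := lb _ c1; have := lb _ c2; have := lb _ c3; have := lb _ c4.
rewrite /Psi => l4 l3 l2 l1 p4 p3 p2 p1.
move: sq l1 l2 l3 l4 p1 p2 p3 p4 fp Br.
set s1 := cabs (p + rc r) ^+ 2; set s2 := cabs (p + - rc r) ^+ 2.
set s3 := cabs (p + ci * rc r) ^+ 2; set s4 := cabs (p + - (ci * rc r)) ^+ 2.
move=> sq l1 l2 l3 l4 p1 p2 p3 p4 fp Br.
have : d * s1 + d * s2 + d * s3 + d * s4 = 4 * (d * cabs p ^+ 2) + 4 * (d * r ^+ 2).
  by rewrite -!mulrDr sq; ring.
lra.
Qed.

(** If the bound failed inside, a small multiple of [|k|^2] could be added to
    [|H|^2] without moving its maximum to the boundary. *)
Lemma max_modulus_rect H (a b c d M : R) : 0 <= M ->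
  (forall k, a <= Re k <= b -> c <= Im k <= d -> jet H k) ->
  (forall k, a <= Re k <= b -> c <= Im k <= d ->
     [|| Re k == a, Re k == b, Im k == c | Im k == d] -> cabs (H k) <= M) ->
  forall k, a <= Re k <= b -> c <= Im k <= d -> cabs (H k) <= M.
Proof.
move=> M0 jH bH k kab kcd; rewrite leNgt; apply/negP => Mk.
pose D := a ^+ 2 + b ^+ 2 + (c ^+ 2 + d ^+ 2).
have D0 : 0 <= D by rewrite !addr_ge0 ?sqr_ge0.
have sqD z : a <= Re z <= b -> c <= Im z <= d -> cabs z ^+ 2 <= D.
  move=> /andP[? ?] /andP[? ?]; rewrite sqr_cabs; apply: lerD.
  - by have [?|?] := leP 0 (Re z); nra.
  - by have [?|?] := leP 0 (Im z); nra.
have MM : M ^+ 2 < cabs (H k) ^+ 2 by rewrite ltr_pXn2r ?nnegrE ?cabs_ge0.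
(* Small enough that on the boundary [e * |k|^2] cannot make up for the gap. *)
pose e := (cabs (H k) ^+ 2 - M ^+ 2) / (D + 1).
have e0 : 0 < e by rewrite divr_gt0 ?subr_gt0 // ltr_wpDl.
have eD : M ^+ 2 + e * D < cabs (H k) ^+ 2.
  have : e * (D + 1) = cabs (H k) ^+ 2 - M ^+ 2 by rewrite divfK // gt_eqF // ltr_wpDl.
  by rewrite mulrDr mulr1; lra.
pose Psi (q : R * R) := cabs (H (Complex q.1 q.2)) ^+ 2 + e * (q.1 ^+ 2 + q.2 ^+ 2).
pose K : set (R * R) := `[a, b] `*` `[c, d].
have [|||q qK qmax] := @compact_EVT_max _ R Psi K.
- by exists (Re k, Im k); split; rewrite /= in_itv.
- by apply: compact_setX; exact: segment_compact.
- apply: continuous_in_subspaceT => q; rewrite inE => -[/=]; rewrite !in_itv /= => qa qc.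
  have jq : jet H (Complex q.1 q.2) by exact: jH.
  apply: cvgD.
    have := @jet_cabs_continuous H q.1 q.2 jq; rewrite -surjective_pairing => cq.
    by rewrite /continuous_at expr2; under eq_fun do rewrite expr2; exact: cvgM.
  apply: cvgM; first exact: cvg_cst.
  rewrite !expr2; under eq_fun do rewrite !expr2.
  by apply: cvgD; apply: cvgM; (exact: cvg_fst || exact: cvg_snd).
move: qK; rewrite inE => -[/=]; rewrite !in_itv /= => qa qc.
pose p := Complex q.1 q.2.
have PsiE z : Psi (Re z, Im z) = cabs (H z) ^+ 2 + e * cabs z ^+ 2.
  by case: z => u w; rewrite /Psi [cabs (Complex u w) ^+ 2]sqr_cabs.
have inK z : a <= Re z <= b -> c <= Im z <= d ->
    cabs (H z) ^+ 2 + e * cabs z ^+ 2 <= cabs (H p) ^+ 2 + e * cabs p ^+ 2.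
  move=> za zc; rewrite -!PsiE -surjective_pairing; apply: qmax.
  by rewrite inE; split; rewrite /= in_itv.
have Mp : M < cabs (H p).
  rewrite -(ltr_pXn2r (ltn0Sn 1)) ?nnegrE ?cabs_ge0 //.
  have := inK k kab kcd; have := sqD p qa qc.
  have := mulr_ge0 (ltW e0) (sqr_ge0 (cabs k)) => ? ?; have := ler_wpM2l (ltW e0) _.
  move=> /(_ _ _ (sqD p qa qc)); lra.
have /norP[pa /norP[pb /norP[pc pd]]] :
    ~~ [|| Re p == a, Re p == b, Im p == c | Im p == d].
  by apply: contraL Mp => pbd; rewrite -leNgt bH.
move: (qa) (qc) => /andP[aq qb] /andP[cq qd].
have {}aq : a < Re p by rewrite lt_neqAle eq_sym pa.
have {}qb : Re p < b by rewrite lt_neqAle pb.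
have {}cq : c < Im p by rewrite lt_neqAle eq_sym pc.
have {}qd : Im p < d by rewrite lt_neqAle pd.
pose r := Num.min (Num.min (Re p - a) (b - Re p)) (Num.min (Im p - c) (d - Im p)).
have r0 : 0 < r by rewrite !lt_min !subr_gt0 aq qb cq qd.
have [z] := jet_no_local_max (jH p qa qc) e0 r0.
rewrite !lt_min => /andP[/andP[z1 z2] /andP[z3 z4]]; rewrite ltNge => /negP; apply.
have := normr_Re_le z; have := normr_Im_le z; rewrite !ler_norml.
move=> /andP[? ?] /andP[? ?]; apply: inK; rewrite !ReImE; apply/andP; split; lra.
Qed.

(** Phragmen-Lindelof for a horizontal strip: the factor [e^{-d k^2}] makes the
    vertical sides negligible. *)
Lemma strip_principle H (Y M B : R) : 0 <= Y -> 0 <= M ->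
  (forall k, `|Im k| <= Y -> jet H k) ->
  (forall k, `|Im k| = Y -> cabs (H k) <= M) ->
  (forall T : R, exists X1 X2, [/\ T <= X1, T <= X2,
     forall k, `|Im k| <= Y -> Re k = X1 -> cabs (H k) <= B &
     forall k, `|Im k| <= Y -> Re k = - X2 -> cabs (H k) <= B]) ->
  forall k, `|Im k| <= Y -> cabs (H k) <= M.
Proof.
move=> Y0 M0 jH topH sideH k kY; apply/ler_addgt0Pr => e e0.
pose g d z : C := H z * cexp (- rc d * z ^+ 2).
have cg d z : cabs (g d z) = cabs (H z) * expR (d * (Im z ^+ 2 - Re z ^+ 2)).
  by rewrite cabsM cabs_cexp !ReImE /=; congr (_ * expR _); ring.
have M'0 : 0 < M + e / 2 by rewrite ltr_wpDl // divr_gt0.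
have gM d : 0 < d -> cabs (g d k) <= (M + e / 2) * expR (d * Y ^+ 2).
  move=> d0.
  pose T := `|Re k| + (`|B| / (M + e / 2) / d + 1).
  have [X1 [X2 [TX1 TX2 s1 s2]]] := sideH T.
  have BT : `|B| / (M + e / 2) / d + 1 <= T by rewrite lerDr.
  have B0 : 0 <= `|B| / (M + e / 2) / d by rewrite !divr_ge0 // ltW.
  have side (x : R) z : T <= x -> Re z ^+ 2 = x ^+ 2 -> `|Im z| <= Y -> cabs (H z) <= B ->
      cabs (g d z) <= (M + e / 2) * expR (d * Y ^+ 2).
    move=> Tx zx zY zB; rewrite cg mulrBr expRD mulrCA mulrC.
    have Yz : Im z ^+ 2 <= Y ^+ 2 by rewrite -(ler_sqr) ?nnegrE // real_normK ?num_real in zY *.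
    apply: ler_pM; rewrite ?mulr_ge0 ?cabs_ge0 ?expR_ge0 //; last first.
      by rewrite ler_expR ler_wpM2l ?(ltW d0).
    rewrite expRN zx ler_pdivrMr ?expR_gt0 //.
    have x1 : 1 <= x by lra.
    have dx : `|B| / (M + e / 2) <= d * x ^+ 2.
      rewrite -ler_pdivrMl // mulrC; apply: (@le_trans _ _ x); first by lra.
      by rewrite expr2 ler_peMr // (le_trans ler01).
    rewrite (le_trans zB) // (le_trans (ler_norm _)) // mulrC -ler_pdivrMr //.
    by rewrite (le_trans dx) // (le_trans _ (expR_ge1Dx _)) // lerDr.
  apply: (@max_modulus_rect (g d) (- X2) X1 (- Y) Y).
  - by rewrite mulr_ge0 ?expR_ge0 // ltW.
  - move=> z _; rewrite -ler_norml => zY.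
    by apply: jetM; [exact: jH|exact: jet_gauss].
  - move=> z zx; rewrite -ler_norml => zY /or4P[] /eqP zE.
    + by apply: (side X2); rewrite ?zE ?sqrrN //; exact: s2.
    + by apply: (side X1); rewrite ?zE //; exact: s1.
    + have zY' : `|Im z| = Y by rewrite zE normrN ger0_norm.
      rewrite cg; apply: ler_pM; rewrite ?cabs_ge0 ?expR_ge0 //.
        by rewrite (le_trans (topH _ zY')) // lerDl divr_ge0 // ltW.
      by rewrite ler_expR ler_wpM2l ?(ltW d0) // zE sqrrN lerBlDr lerDl sqr_ge0.
    + have zY' : `|Im z| = Y by rewrite zE ger0_norm.
      rewrite cg; apply: ler_pM; rewrite ?cabs_ge0 ?expR_ge0 //.
        by rewrite (le_trans (topH _ zY')) // lerDl divr_ge0 // ltW.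
      by rewrite ler_expR ler_wpM2l ?(ltW d0) // zE lerBlDr lerDl sqr_ge0.
  - have := ler_norm (Re k); have := ler_norm (- Re k); rewrite normrN.
    by move=> ? ?; apply/andP; split; move: TX1 TX2; rewrite /T; lra.
  - by rewrite -ler_norml.
(* Now [d] tends to [0]: this choice makes the loss at [k] at most [e / 2]. *)
pose L := Y ^+ 2 + Re k ^+ 2 + 1.
have L0 : 0 < L by rewrite ltr_wpDl // addr_ge0 ?sqr_ge0.
pose q := (M + e) / (M + e / 2).
have q1 : 1 < q by rewrite ltr_pdivlMr // mul1r ltrD2l ltr_pdivrMr // ltr_pMr ?ltr1n.
have lnq : 0 < ln q by rewrite ln_gt0.
have d0 : 0 < ln q / L by rewrite divr_gt0.
have := gM _ d0; rewrite cg => h.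
rewrite -(ler_pM2r (expR_gt0 (ln q / L * (Im k ^+ 2 - Re k ^+ 2)))).
apply: le_trans h _.
have -> : M + e = (M + e / 2) * q by rewrite mulrC divfK // gt_eqF.
have qE : expR (ln q) = q by rewrite lnK // posrE (lt_trans ltr01).
rewrite -[leRHS]mulrA ler_pM2l // -[X in _ <= X * _]qE.
rewrite -expRD ler_expR.
have qL : ln q / L * L = ln q by rewrite divfK // gt_eqF.
rewrite -{2}qL -mulrDr ler_wpM2l ?(ltW d0) // /L.
have := sqr_ge0 (Im k); lra.
Qed.

End MaximumPrinciple.

(** * Perturbation of determinants, and recurrence on a torus *)
Section DeterminantEstimates.
Variable R : realType.
Local Notation C := (R[i]).

Lemma prod_lipschitz (I : Type) (s : seq I) (a b : I -> C) (K d : R) : 1 <= K ->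
  (forall i, cabs (a i) <= K) -> (forall i, cabs (b i) <= K) ->
  (forall i, cabs (a i - b i) <= d) ->
  cabs (\prod_(i <- s) a i - \prod_(i <- s) b i) <= (size s)%:R * K ^+ size s * d.
Proof.
move=> K1 aK bK abd.
have K0 : 0 <= K := le_trans ler01 K1.
elim: s => [|i s IH]; first by rewrite !big_nil subrr cabs0 !mul0r.
have d0 : 0 <= d := le_trans (cabs_ge0 _) (abd i).
have prodK : cabs (\prod_(j <- s) a j) <= K ^+ size s.
  rewrite cabs_prod; elim: s {IH} => [|j s IH]; first by rewrite big_nil.
  rewrite big_cons exprS; apply: ler_pM => //; rewrite ?cabs_ge0 //.
  by apply: prodr_ge0 => k _; exact: cabs_ge0.
rewrite !big_cons.
have -> : a i * \prod_(j <- s) a j - b i * \prod_(j <- s) b j =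
    (a i - b i) * \prod_(j <- s) a j +
    b i * (\prod_(j <- s) a j - \prod_(j <- s) b j) by ring.
have -> : (size (i :: s))%:R * K ^+ size (i :: s) * d =
    d * K ^+ (size s).+1 + K * ((size s)%:R * K ^+ size s * d).
  by rewrite /= -natr1 exprS; ring.
apply: ler_cabsD_le; rewrite cabsM; last by apply: ler_pM; rewrite ?cabs_ge0.
apply: ler_pM; rewrite ?cabs_ge0 // (le_trans prodK) //.
by rewrite exprS ler_peMl // exprn_ge0.
Qed.

Lemma det_lipschitz n (K : R) : 1 <= K -> exists2 L : R, 0 <= L &
  forall (A B : 'M[C]_n) (d : R),
    (forall i j, cabs (A i j) <= K) -> (forall i j, cabs (B i j) <= K) ->
    (forall i j, cabs (A i j - B i j) <= d) ->
    cabs (\det A - \det B) <= L * d.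
Proof.
move=> K1; have K0 : 0 <= K := le_trans ler01 K1.
pose e := index_enum 'I_n.
exists (\sum_(s : 'S_n) (size e)%:R * K ^+ size e).
  by apply: sumr_ge0 => s _; rewrite mulr_ge0 ?exprn_ge0.
move=> A B d AK BK ABd; rewrite /determinant -sumrB mulr_suml.
apply: le_trans (ler_cabs_sum _ _ _) _; apply: ler_sum => s _.
rewrite -mulrBr cabsM cabsX cabsN cabs1 expr1n mul1r.
exact: prod_lipschitz.
Qed.

End DeterminantEstimates.

Section Recurrence.
Variable R : realType.

Lemma truncn_close (N : nat) (x y : R) : (0 < N)%N -> -1 <= x -> -1 <= y ->
  Num.truncn (N%:R * (x + 1)) = Num.truncn (N%:R * (y + 1)) ->
  `|x - y| <= N%:R^-1.
Proof.
move=> N0 x1 y1 xy.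
have N0' : 0 < N%:R :> R by rewrite ltr0n.
have /truncn_itv/andP[a1 a2] : 0 <= N%:R * (x + 1) by rewrite mulr_ge0 //; lra.
have /truncn_itv/andP[b1 b2] : 0 <= N%:R * (y + 1) by rewrite mulr_ge0 //; lra.
rewrite xy in a1 a2; rewrite -(ler_pM2l N0') divff ?gt_eqF //.
rewrite -[X in X * _]gtr0_norm // -normrM ler_norml.
move: a2 b2; rewrite -natr1; set t := (Num.truncn _)%:R in a1 b1 *.
by move=> a2 b2; apply/andP; split; lra.
Qed.

(** Pigeonhole: among sufficiently many multiples of [T], two have almost the
    same image in the torus. *)
Lemma almost_period n (l : 'I_n -> R) (T e : R) : 0 < T -> 0 < e ->
  exists2 t, T <= t & forall i, cabs (cexp (ci * rc (l i) * rc t) - 1) <= e.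
Proof.
move=> T0 e0.
pose N := (Num.truncn (2 / e)).+1.
have N0 : 0 < N%:R :> R by rewrite ltr0n.
have Ne : 2 / N%:R <= e.
  by rewrite ler_pdivrMr // mulrC -ler_pdivrMr // ltW // truncnS_gt.
pose box (x : R) : 'I_(N + N).+1 := inord (Num.truncn (N%:R * (x + 1))).
have boxE x : -1 <= x -> x <= 1 -> box x = Num.truncn (N%:R * (x + 1)) :> nat.
  move=> x1 x2; rewrite inordK // truncn_lt_nat; last by rewrite mulr_ge0 //; lra.
  rewrite -natr1 natrD (@le_lt_trans _ _ (N%:R * 2)) ?ler_pM2l //; lra.
pose arg (a : nat) i := l i * (a%:R * T).
pose cell (a : 'I_(#|{ffun 'I_n -> 'I_(N + N).+1 * 'I_(N + N).+1}|).+1) :=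
  [ffun i => (box (cos (arg a i)), box (sin (arg a i)))].
have /injectivePn[a [b ab cab]] : ~~ injectiveb cell.
  by apply/negP => /injectiveP/leq_card; rewrite card_ord ltnn.
wlog ltab : a b ab cab / (a < b)%N.
  move=> W; have [ba|//|ba] := ltngtP a b; [exact: W ba| |].
    by apply: (W b a) => //; rewrite eq_sym.
  by move: ab; rewrite (val_inj ba) eqxx.
exists ((b - a)%:R * T); first by rewrite ler_peMl ?(ltW T0) // ler1n subn_gt0.
move=> i; pose z (k : nat) := cexp (ci * rc (l i) * rc (k%:R * T)).
have zE k : z k = Complex (cos (arg k i)) (sin (arg k i)).
  by rewrite /z -mulrA -rcM cexp_ci.
have za1 : cabs (z a) = 1 by rewrite /z -mulrA -rcM cabs_cexp_ci.
rewrite -/(z (b - a)%N) -[leLHS]mul1r -za1 -cabsM mulrBr mulr1.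
have -> : z a * z (b - a)%N = z b.
  rewrite -cexpD -mulrDr -rcD -mulrDl -natrD subnKC //; exact: ltnW.
have /ffunP/(_ i) := cab; rewrite !ffunE => -[cc ss].
move/(congr1 (@nat_of_ord _)): cc; move/(congr1 (@nat_of_ord _)): ss.
rewrite !boxE ?cos_geN1 ?cos_le1 ?sin_geN1 ?sin_le1 //.
move=> /esym/truncn_close s1 /esym/truncn_close c1.
rewrite !zE; apply: le_trans (cabs_le_ReIm _) _; rewrite !ReImE /=.
apply: le_trans Ne; rewrite mulr_natl mulr2n.
by apply: lerD; [apply: c1|apply: s1]; rewrite ?cos_geN1 ?sin_geN1.
Qed.

End Recurrence.

(** * The secular determinant of an orthogonal scattering matrix *)
Section Scattering.
Variables (R : realType) (n : nat) (S : 'M[R]_n) (l : 'I_n -> R).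
Hypotheses (SK : S^T *m S = 1%:M) (l_gt0 : forall i, 0 < l i).
Local Notation C := (R[i]).
Implicit Types (k p z : C).

(** [phase_mx] is the propagation along the bonds and [evolution] adds the
    scattering; the zeros of [secular] are the frequencies of the stationary
    waves. *)
Definition phase k i : C := cexp (ci * rc (l i) * k).
Definition phase_mx k : 'M[C]_n := diag_mx (\row_i phase k i).
Definition evolution k : 'M[C]_n := map_mx (@rc R) S *m phase_mx k.
Definition secular_mx k : 'M[C]_n := 1%:M - evolution k.
Definition secular k : C := \det (secular_mx k).
Definition kernel_dim k : nat := (n - \rank (secular_mx k))%N.
Definition total_length : R := \sum_i l i.

Let SKr : S *m S^T = 1%:M. Proof. exact: mulmx1C. Qed.
Let SCK : (map_mx (@rc R) S)^T *m map_mx (@rc R) S = 1%:M.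
Proof. by rewrite map_trmx -map_mxM SK map_mx1. Qed.
Let SCKr : map_mx (@rc R) S *m (map_mx (@rc R) S)^T = 1%:M.
Proof. by rewrite map_trmx -map_mxM SKr map_mx1. Qed.

Lemma cabs_phase k i : cabs (phase k i) = expR (- (l i * Im k)).
Proof. by rewrite cabs_cexp !ReImE /=; congr expR; ring. Qed.

Lemma phaseD k p i : phase (k + p) i = phase k i * phase p i.
Proof. by rewrite /phase mulrDr cexpD. Qed.

Lemma phase_mxD k p : phase_mx (k + p) = phase_mx k *m phase_mx p.
Proof.
rewrite /phase_mx mulmx_diag; congr diag_mx.
by apply/rowP => i; rewrite !mxE phaseD.
Qed.

Lemma phase_mx0 : phase_mx 0 = 1%:M.
Proof.
rewrite /phase_mx -diag_const_mx; congr diag_mx.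
by apply/rowP => i; rewrite !mxE /phase mulr0 cexp0.
Qed.

Lemma tr_phase_mx k : (phase_mx k)^T = phase_mx k.
Proof. exact: tr_diag_mx. Qed.

Lemma det_phase_mx k : \det (phase_mx k) = cexp (ci * rc total_length * k).
Proof.
rewrite det_diag.
transitivity (\prod_i phase k i); first by apply: eq_bigr => i _; rewrite mxE.
rewrite -(big_morph _ (@cexpD R) (@cexp0 R)) -mulr_suml -mulr_sumr.
by rewrite /total_length rmorph_sum.
Qed.

Lemma evolutionE k i j : evolution k i j = rc (S i j) * phase k j.
Proof.
by rewrite /evolution mul_mx_diag !mxE.
Qed.

Lemma secular_mxE k i j :
  secular_mx k i j = (1%:M : 'M[C]_n) i j - evolution k i j.
Proof. by rewrite /secular_mx [LHS]mxE [X in _ + X]mxE. Qed.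

Lemma orthogonal_entry_le1 i j : `|S i j| <= 1.
Proof.
have /matrixP/(_ j j) := SK; rewrite !mxE eqxx => sj.
rewrite -(ler_pXn2r (ltn0Sn 1)) ?nnegrE // expr1n real_normK ?num_real //.
rewrite -[leRHS]/(true%:R) -sj (bigD1 i) //= !mxE -expr2 lerDl.
by apply: sumr_ge0 => k _; rewrite mxE -expr2 sqr_ge0.
Qed.

Lemma cabs_evolution_le k i j : cabs (evolution k i j) <= expR (- (l j * Im k)).
Proof. by rewrite evolutionE cabsM cabs_rc cabs_phase ler_piMl ?expR_ge0 ?orthogonal_entry_le1. Qed.

Lemma jet_secular_mx p i j : jet (fun k => secular_mx k i j) p.
Proof.
rewrite (_ : (fun k => _) = fun k => (1%:M : 'M[C]_n) i j + - rc (S i j) * phase k j).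
  apply: jetD; first exact: jet_cst.
  by apply: jetM; [exact: jet_cst|exact: jet_cexpM].
by apply: boolp.funext => k; rewrite secular_mxE evolutionE mulNr.
Qed.

Lemma jet_secular p : jet secular p.
Proof. by apply: jet_det => i j; exact: jet_secular_mx. Qed.

(** Reversing time: [1 - SE = - SE (1 - S E^{-1})^T]. *)
Lemma cabs_secularN k :
  cabs (secular k) = expR (- (total_length * Im k)) * cabs (secular (- k)).
Proof.
have E : secular_mx k = - evolution k *m (secular_mx (- k))^T.
  rewrite /secular_mx /evolution linearB /= trmx1 trmx_mul tr_phase_mx.
  rewrite mulmxBr mulmx1 mulNmx opprK [RHS]addrC; congr (_ - _).
  by rewrite mulmxA -(mulmxA _ (phase_mx k)) -phase_mxD subrr phase_mx0 mulmx1.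
have detS : cabs (\det (map_mx (@rc R) S)) = 1.
  apply/eqP; rewrite -(@eqrXn2 _ 2) ?cabs_ge0 // expr1n -cabsX expr2.
  by rewrite -{1}det_tr -det_mulmx SCK det1 cabs1.
rewrite /secular E det_mulmx det_tr cabsM -scaleN1r detZ cabsM cabsX cabsN.
rewrite cabs1 expr1n mul1r det_mulmx cabsM detS mul1r det_phase_mx cabs_cexp.
by rewrite !ReImE /=; congr (expR _ * _); ring.
Qed.

Lemma length_lower_bound : exists2 m : R, 0 < m & forall i, m <= l i.
Proof.
have s0 : 0 <= \sum_i (l i)^-1 by apply: sumr_ge0 => i _; rewrite invr_ge0 ltW.
have s1 : 0 < 1 + \sum_i (l i)^-1 by rewrite ltr_wpDr.
exists (1 + \sum_i (l i)^-1)^-1; first by rewrite invr_gt0.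
move=> i; rewrite -[leRHS]invrK lef_pV2 ?posrE ?invr_gt0 //.
rewrite (bigD1 i) //= addrCA lerDl addr_ge0 //.
by apply: sumr_ge0 => j _; rewrite invr_ge0 ltW.
Qed.

Lemma id_entry_le1 (i j : 'I_n) : cabs ((1%:M : 'M[C]_n) i j) <= 1.
Proof. by rewrite mxE; case: (i == j); rewrite ?cabs1 ?cabs0. Qed.

(** Far up in the upper half-plane the phases are small and [1 - U(k)] is close to
    the identity. *)
Lemma secular_at_infinity (e : R) : 0 < e ->
  exists Y0, forall k, Y0 <= Im k -> cabs (secular k - 1) <= e.
Proof.
move=> e0; have [m m0 ml] := length_lower_bound.
have [L L0 HL] := @det_lipschitz R n 2 (ler1n _ 2).
have L1 : 0 < L + 1 by rewrite ltr_wpDl.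
exists ((L + 1) / e / m) => k Yk.
have mk : (L + 1) / e <= m * Im k by rewrite -ler_pdivrMl // mulrC.
have k0 : 0 <= Im k by rewrite (le_trans _ Yk) // !divr_ge0 // ltW.
have d_le j : expR (- (l j * Im k)) <= e / (L + 1).
  rewrite expRN -[leRHS]invrK invf_div lef_pV2 ?posrE ?expR_gt0 ?divr_gt0 //.
  apply: le_trans mk _; apply: le_trans (ler_wpM2r k0 (ml j)) _.
  by apply: le_trans (expR_ge1Dx _); rewrite lerDr.
have e1 j : expR (- (l j * Im k)) <= 1.
  by rewrite -[leRHS]expR0 ler_expR oppr_le0 mulr_ge0 // ltW.
rewrite /secular -[X in _ - X](@det1 _ n).
apply: le_trans (HL _ _ (e / (L + 1)) _ _ _) _.
- move=> i j; rewrite secular_mxE; apply: ler_cabsD_le; first exact: id_entry_le1.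
  by rewrite cabsN (le_trans (cabs_evolution_le _ _ _)).
- by move=> i j; rewrite (le_trans (id_entry_le1 _ _)) // ler1n.
- move=> i j; rewrite secular_mxE addrAC subrr add0r cabsN.
  by rewrite (le_trans (cabs_evolution_le _ _ _)).
by rewrite mulrCA ler_piMr ?(ltW e0) // ler_pdivrMr // mul1r lerDl.
Qed.

Lemma evolution_strip (Y : R) : exists2 K, 1 <= K &
  forall k i j, `|Im k| <= Y -> cabs (phase k j) <= K /\ cabs (secular_mx k i j) <= K.
Proof.
exists (1 + expR (total_length * Y)); first by rewrite lerDl expR_ge0.
move=> k i j kY.
have Y0 : 0 <= Y by rewrite (le_trans _ kY).
have eK : expR (- (l j * Im k)) <= expR (total_length * Y).
  rewrite ler_expR -mulrN; apply: le_trans (_ : l j * Y <= _).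
    by rewrite ler_wpM2l ?(ltW (l_gt0 _)) // (le_trans _ kY) // -normrN ler_norm.
  rewrite ler_wpM2r // /total_length (bigD1 j) //= lerDl.
  by apply: sumr_ge0 => h _; exact: ltW.
split; first by rewrite cabs_phase (le_trans eK) // lerDr.
rewrite secular_mxE; apply: ler_cabsD_le; first exact: id_entry_le1.
by rewrite cabsN (le_trans (cabs_evolution_le _ _ _)).
Qed.

Lemma secular_bounded (Y : R) : exists K, forall k, `|Im k| <= Y -> cabs (secular k) <= K.
Proof.
have [K K1 HK] := evolution_strip Y.
have [L L0 HL] := @det_lipschitz R n K K1.
exists (L * (K + 1) + 1) => k kY.
rewrite -[secular k](subrK 1); apply: ler_cabsD_le; last by rewrite cabs1.
rewrite -[X in _ - X](@det1 _ n); apply: HL.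
- by move=> i j; case: (HK k i j kY).
- by move=> i j; rewrite (le_trans (id_entry_le1 _ _)).
- by move=> i j; apply: ler_cabsD_le; [case: (HK k i j kY)|rewrite cabsN id_entry_le1].
Qed.

(** Real and imaginary parts are transformed separately by the real matrix. *)
Lemma mul_row_orthogonal (v : 'rV[C]_n) :
  \sum_j cabs ((v *m map_mx (@rc R) S) 0 j) ^+ 2 = \sum_j cabs (v 0 j) ^+ 2.
Proof.
have real (x : 'rV[R]_n) : \sum_j (x *m S) 0 j ^+ 2 = \sum_j x 0 j ^+ 2.
  have : (x *m S *m (x *m S)^T) 0 0 = (x *m x^T) 0 0.
    by rewrite trmx_mul mulmxA -(mulmxA x) SKr mulmx1.
  have sqE (y : 'rV[R]_n) : (y *m y^T) 0 0 = \sum_j y 0 j ^+ 2.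
    by rewrite mxE; apply: eq_bigr => j _; rewrite mxE expr2.
  by rewrite !sqE.
have part (f : C -> R) : (forall z w, f (z + w) = f z + f w) -> f 0 = 0 ->
    (forall z x, f (z * rc x) = f z * x) ->
    \sum_j f ((v *m map_mx (@rc R) S) 0 j) ^+ 2 = \sum_j f (v 0 j) ^+ 2.
  move=> fD f0 fZ; transitivity (\sum_j (map_mx f v *m S) 0 j ^+ 2).
    apply: eq_bigr => j _; rewrite !mxE (big_morph _ fD f0).
    by congr (_ ^+ 2); apply: eq_bigr => i _; rewrite !mxE fZ.
  by rewrite real; apply: eq_bigr => j _; rewrite mxE.
under eq_bigr => j _ do rewrite sqr_cabs.
under [RHS]eq_bigr => j _ do rewrite sqr_cabs.
rewrite !big_split /= (part (@Re R)) ?(part (@Im R)) //.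
- by move=> z w; rewrite !ReImE.
- by move=> z x; rewrite !ReImE /= mulr0 add0r.
- by move=> z w; rewrite !ReImE.
- by move=> z x; rewrite !ReImE /= mulr0 subr0.
Qed.

(** An orthogonal matrix preserves the norm, whereas off the real axis the
    phases strictly contract it or strictly expand it. *)
Lemma secular_neq0 k : Im k != 0 -> secular k != 0.
Proof.
move=> k0; apply/det0P => -[v v0 /eqP]; rewrite mulmxBr mulmx1 subr_eq0 => /eqP vE.
pose u := v *m map_mx (@rc R) S.
have vu j : v 0 j = u 0 j * phase k j.
  by rewrite vE /evolution mulmxA mul_mx_diag !mxE.
have /eqP := mul_row_orthogonal v; rewrite -/u -subr_eq0 -sumrB => /eqP sum0.
pose c j := 1 - expR (- (l j * Im k)) ^+ 2.
have tE j : cabs (u 0 j) ^+ 2 - cabs (v 0 j) ^+ 2 = c j * cabs (u 0 j) ^+ 2.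
  by rewrite vu cabsM cabs_phase /c; ring.
suff u0 : u = 0.
  by case/negP: v0; apply/eqP/rowP => j; rewrite vu u0 !mxE mul0r.
apply/rowP => j; rewrite [RHS]mxE; apply/eqP; rewrite -cabs_eq0 -sqrf_eq0.
have {}sum0 : \sum_j c j * cabs (u 0 j) ^+ 2 = 0.
  by rewrite -[RHS]sum0; apply: eq_bigr => h _; rewrite tE.
case: (ltrgtP (Im k) 0) k0 => // kk _.
- have c_lt0 h : c h < 0.
    rewrite /c subr_lt0 exprn_egt1 // -expR0 ltr_expR oppr_gt0.
    by rewrite pmulr_rlt0.
  have F0 h : true -> 0 <= - (c h * cabs (u 0 h) ^+ 2).
    by move=> _; rewrite oppr_ge0 mulr_le0_ge0 ?sqr_ge0 // ltW.
  have sumN : \sum_h - (c h * cabs (u 0 h) ^+ 2) = 0 by rewrite sumrN sum0 oppr0.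
  have /eqP := @psumr_eq0P _ _ predT _ F0 sumN j isT.
  by rewrite oppr_eq0 mulf_eq0 lt_eqF.
- have c_gt0 h : 0 < c h.
    rewrite /c subr_gt0 exprn_ilt1 ?expR_ge0 // -expR0 ltr_expR oppr_lt0.
    by rewrite pmulr_rgt0.
  have F0 h : true -> 0 <= c h * cabs (u 0 h) ^+ 2.
    by move=> _; rewrite mulr_ge0 ?sqr_ge0 // ltW.
  have /eqP := @psumr_eq0P _ _ predT _ F0 sum0 j isT.
  by rewrite mulf_eq0 gt_eqF.
Qed.

End Scattering.

(** * Local factorization of the secular determinant *)
Section LocalFactorization.
Variables (R : realType) (n : nat) (S : 'M[R]_n) (l : 'I_n -> R).
Hypotheses (SK : S^T *m S = 1%:M) (l_gt0 : forall i, 0 < l i).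
Local Notation C := (R[i]).
Implicit Types (k p z : C).
Local Notation U := (evolution S l).
Local Notation M := (secular_mx S l).

Lemma cexp_conj z : conjc (cexp z) = cexp (conjc z).
Proof. by case: z => a b; apply: complex_eqP; rewrite /= ?cosN ?sinN ?mulrN. Qed.

Lemma conjcM z w : conjc (z * w) = conjc z * conjc w.
Proof. exact: (rmorphM (@conjc R)). Qed.

Lemma conj_rc (x : R) : conjc (rc x) = rc x.
Proof. by apply: complex_eqP; rewrite /= ?oppr0. Qed.

Lemma conj_ci : conjc (@ci R) = - ci.
Proof. by apply: complex_eqP; rewrite /= ?oppr0. Qed.

Lemma evolutionD k z : U (k + z) = U k *m phase_mx l z.
Proof. by rewrite /evolution phase_mxD mulmxA. Qed.

Lemma evolution_unitary (x : R) : (map_mx conjc (U (rc x)))^T *m U (rc x) = 1%:M.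
Proof.
have -> : map_mx conjc (U (rc x)) = map_mx (@rc R) S *m phase_mx l (- rc x).
  apply/matrixP => i j; rewrite mxE evolutionE mul_mx_diag !mxE.
  rewrite conjcM conj_rc /phase cexp_conj !conjcM conj_ci !conj_rc.
  by congr (_ * cexp _); ring.
rewrite trmx_mul tr_phase_mx /evolution mulmxA -(mulmxA (phase_mx l _)).
rewrite map_trmx -map_mxM SK map_mx1 mulmx1 -phase_mxD.
by rewrite addNr phase_mx0.
Qed.

(** This holds because [U] is unitary; it identifies the left and right kernels of
    [1 - U]. *)
Lemma fixed_adjoint (x : R) (v : 'cV[C]_n) :
  U (rc x) *m v = v -> (map_mx conjc v)^T *m U (rc x) = (map_mx conjc v)^T.
Proof.
move=> Uv; rewrite -{1}Uv map_mxM trmx_mul -mulmxA.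
by rewrite evolution_unitary mulmx1.
Qed.

Section AtRealPoint.
Variable x : R.
Let p : C := rc x.
Let r : nat := \rank (M p).
Let X : 'M[C]_n := invmx (col_ebase (M p)).

Let XM (i j : 'I_n) : (r <= i)%N -> (X *m M p) i j = 0.
Proof.
move=> ri; rewrite /X -{2}(mulmx_ebase (M p)) -mulmxA mulKmx ?col_ebase_unit //.
by rewrite mxE big1 // => h _; rewrite mxE ltnNge ri andbF mul0r.
Qed.

(** Row operations put the kernel of [1 - U(p)] into the last rows. At [p + z]
    these rows are divisible by [z], and the quotient is written with the entire
    function [cexp_quot]. *)
Definition reduced_mx z : 'M[C]_n := \matrix_(i, j)
  if (i < r)%N then (X *m M (p + z)) i j
  else - (X *m U p) i j * cexp_quot (ci * rc (l j)) z.

Lemma reduced_mxE z :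
  X *m M (p + z) = diag_mx (\row_(i < n) if (i < r)%N then 1 else z) *m reduced_mx z.
Proof.
apply/matrixP => i j; rewrite mul_diag_mx [RHS]mxE [reduced_mx z i j]mxE.
rewrite [X in X * _]mxE; case: ltnP => ri; first by rewrite mul1r.
have -> : M (p + z) = M p + U p *m (1%:M - phase_mx l z).
  by rewrite /secular_mx evolutionD mulmxBr mulmx1 addrA subrK.
rewrite (mulmxDr X) [LHS]mxE XM // add0r mulmxA mulmxBr mulmx1.
rewrite [LHS]mxE [X in _ + X]mxE mul_mx_diag [X in - X]mxE [X in _ * X]mxE.
by rewrite /phase cexp_quotE; ring.
Qed.

Lemma jet_reduced_mx q : jet (fun z => \det (reduced_mx z)) q.
Proof.
apply: jet_det => i j.
case: (ltnP i r) => ri.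
  rewrite (_ : (fun z => _) = fun z => \sum_h X i h * M (p + z) h j).
    apply: jet_sum => h; apply: jetM; first exact: jet_cst.
    rewrite /jet; under eq_fun do rewrite addrA; exact: jet_secular_mx.
  by apply: boolp.funext => z; rewrite mxE ri mxE.
rewrite (_ : (fun z => _) = fun z => - (X *m U p) i j * cexp_quot (ci * rc (l j)) z).
  by apply: jetM; [exact: jet_cst|exact: jet_cexp_quot].
by apply: boolp.funext => z; rewrite mxE ltnNge ri.
Qed.

(** Let [v] be a null vector. The upper rows say [U(p) v = v], hence
    [v^* U(p) = v^*]; the lower rows say that every left null vector [y] of
    [1 - U(p)] has [y U(p) diag(l) v = 0]. Taking [y = v^*] gives
    [v^* diag(l) v = 0], and the lengths are positive. *)
Lemma det_reduced_mx0 : \det (reduced_mx 0) != 0.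
Proof.
rewrite -det_tr; apply/det0P => -[w w0 wR].
pose v := w^T; have v0 : v != 0 by rewrite -(inj_eq (@trmx_inj _ _ _)) trmxK trmx0.
have Rv : reduced_mx 0 *m v = 0.
  by apply: trmx_inj; rewrite trmx_mul trmxK trmx0.
pose Lv : 'cV[C]_n := \col_j (rc (l j) * v j 0).
have XMv i : (X *m M p *m v) i 0 = 0.
  case: (ltnP i r) => ri; last first.
    by rewrite mxE big1 // => j _; rewrite XM // mul0r.
  have /matrixP/(_ i 0) := Rv; rewrite [RHS]mxE => <-.
  rewrite [LHS]mxE [RHS]mxE; apply: eq_bigr => j _.
  by rewrite [reduced_mx 0 i j]mxE ri addr0.
have Mv : M p *m v = 0.
  have XM0 : X *m (M p *m v) = 0.
    by apply/matrixP => i j; rewrite mulmxA (ord1 j) XMv mxE.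
  have Xu : X \in unitmx by rewrite unitmx_inv col_ebase_unit.
  by rewrite -[LHS](mulKmx Xu) XM0 mulmx0.
have Uv : U p *m v = v.
  by apply/esym/eqP; rewrite -subr_eq0 -{1}[v]mul1mx -mulmxBl; apply/eqP.
have XULv (i : 'I_n) : (r <= i)%N -> (X *m U p *m Lv) i 0 = 0.
  move=> ri; have /matrixP/(_ i 0) := Rv; rewrite [RHS]mxE mxE => sum0.
  apply: (@mulfI _ (- ci)); first by rewrite oppr_eq0 -cabs_gt0 cabs_ci.
  rewrite mulr0 -[RHS]sum0 mxE mulr_sumr; apply: eq_bigr => j _.
  rewrite [reduced_mx 0 i j]mxE ltnNge ri /= cexp_quot0 [Lv j 0]mxE; ring.
have yU := fixed_adjoint Uv; set y := (map_mx conjc v)^T in yU.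
have [y' y'E] : exists y', y' = y *m col_ebase (M p) by eexists.
have y'0 (i : 'I_n) : (i < r)%N -> y' 0 i = 0.
  move=> ri.
  have : y' *m pid_mx r *m row_ebase (M p) = 0.
    by rewrite y'E -!mulmxA (mulmxA (col_ebase _)) mulmx_ebase mulmxBr mulmx1 yU subrr.
  move/(congr1 (fun B => B *m invmx (row_ebase (M p)))).
  rewrite mulmxK ?row_ebase_unit // mul0mx => /matrixP/(_ 0 i).
  rewrite [RHS]mxE [LHS]mxE (bigD1 i) //= [pid_mx r i i]mxE eqxx ri mulr1.
  by rewrite big1 ?addr0 // => j ji; rewrite [pid_mx r j i]mxE val_eqE (negPf ji) mulr0.
have yLv : (y *m Lv) 0 0 = 0.
  have assoc (B : 'M[C]_n) : y' *m X *m B *m Lv = y' *m (X *m B *m Lv).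
    by rewrite !mulmxA.
  have := assoc (U p); rewrite {1}y'E mulmxK ?col_ebase_unit // yU => ->.
  rewrite mxE big1 // => i _; case: (ltnP i r) => ri; first by rewrite y'0 // mul0r.
  by rewrite XULv // mulr0.
have : \sum_j l j * cabs (v j 0) ^+ 2 = 0.
  transitivity (Re ((y *m Lv) 0 0)); last by rewrite yLv.
  rewrite mxE Re_sum; apply: eq_bigr => j _; rewrite [y 0 j]mxE [Lv j 0]mxE.
  by rewrite [map_mx _ v j 0]mxE sqr_cabs !ReImE; case: (v j 0) => a b /=; ring.
move/(@psumr_eq0P _ _ predT) => H; case/negP: v0; apply/eqP/colP => j.
rewrite [RHS]mxE; apply/eqP; rewrite -cabs_eq0 -sqrf_eq0.
have /eqP := H (fun h _ => mulr_ge0 (ltW (l_gt0 h)) (sqr_ge0 _)) j isT.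
by rewrite mulf_eq0 gt_eqF.
Qed.

Lemma secular_factor_real : exists g : C -> C, [/\ forall z, jet g z, g 0 != 0 &
  forall z, secular S l (p + z) = z ^+ kernel_dim S l p * g z].
Proof.
have X0 : \det X != 0 by rewrite -unitfE -unitmxE unitmx_inv col_ebase_unit.
exists (fun z => (\det X)^-1 * \det (reduced_mx z)); split.
- by move=> z; apply: jetM; [exact: jet_cst|exact: jet_reduced_mx].
- by rewrite mulf_neq0 ?invr_eq0 ?det_reduced_mx0.
move=> z; rewrite mulrCA; apply: (mulfI X0); rewrite mulVKf //.
rewrite -det_mulmx reduced_mxE det_mulmx det_diag; congr (_ * _).
under eq_bigr do rewrite mxE.
have rn : (r <= n)%N := rank_leq_row _.
rewrite -(big_mkord xpredT (fun i => if (i < r)%N then 1 else z)).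
rewrite (big_cat_nat (leq0n r) rn) /= big_nat_cond big1 ?mul1r; last first.
  by move=> i /andP[/andP[_ ->]].
rewrite big_nat_cond (eq_bigr (fun=> z)); last first.
  by move=> i /andP[/andP[ri _] _]; rewrite ltnNge ri.
by rewrite -big_nat_cond prodr_const_nat.
Qed.

End AtRealPoint.

(** Off the real axis the kernel is trivial and there is nothing to factor. *)
Lemma secular_factor p : exists g : C -> C, [/\ forall z, jet g z, g 0 != 0 &
  forall z, secular S l (p + z) = z ^+ kernel_dim S l p * g z].
Proof.
have [p0|p0] := eqVneq (Im p) 0.
  have -> : p = rc (Re p) by apply: complex_eqP.
  exact: secular_factor_real.
have Fp := secular_neq0 SK l_gt0 p0.
exists (fun z => secular S l (p + z)); split.
- move=> z; rewrite /jet; under eq_fun do rewrite addrA; exact: jet_secular.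
- by rewrite addr0.
move=> z; rewrite /kernel_dim mxrank_unit ?subnn ?mul1r //.
Qed.

(** On a suitable vertical segment [secular] does not vanish; an almost period
    carries its minimum there arbitrarily far away. *)
Lemma secular_sides (Y : R) : 0 <= Y -> exists2 c : R, 0 < c &
  forall T, exists2 t, T <= t &
    forall k, `|Im k| <= Y -> Re k = t -> c <= cabs (secular S l k).
Proof.
move=> Y0.
have [x0 Fx0] : exists x0 : R, secular S l (rc x0) != 0.
  have [g [jg g0 Fg]] := secular_factor 0.
  have [r r0 gr] : near0 (fun z => cabs (g 0) / 2 <= cabs (g z)).
    have := @germ_neq0 _ 2 (fun z => g (0 + z)) (jg 0); rewrite add0r => /(_ g0).
    by under [X in near0 X]eq_fun do rewrite add0r.
  exists (r / 2); have r2 : 0 < r / 2 by rewrite divr_gt0.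
  rewrite -[rc _]add0r Fg mulf_neq0 //.
    by rewrite expf_neq0 // -cabs_gt0 cabs_rc gtr0_norm.
  rewrite -cabs_gt0 (lt_le_trans _ (gr _ _)) ?divr_gt0 ?cabs_gt0 //.
  by rewrite cabs_rc gtr0_norm // ltr_pdivrMr // ltr_pMr ?ltr1n.
pose f (y : R) := cabs (secular S l (Complex x0 y)).
have cf : continuous f.
  move=> y; apply: (@continuous_comp _ _ _ (fun y : R => (x0, y)) (fun q : R * R => cabs (secular S l (Complex q.1 q.2)))).
    by apply: (@cvg_pair _ _ _ _ (nbhs x0) (nbhs y)); [exact: cvg_cst|exact: cvg_id].
  by apply: jet_cabs_continuous; exact: jet_secular.
have YY : - Y <= Y by rewrite (le_trans _ Y0) // oppr_le0.
have [y0 _ miny] := EVT_min YY (continuous_subspaceT cf).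
have c0 : 0 < f y0.
  rewrite cabs_gt0; have [->|y00] := eqVneq y0 0; first exact: Fx0.
  exact: (secular_neq0 SK l_gt0).
(* Half of the minimum absorbs the error of the almost period. *)
exists (f y0 / 2); first by rewrite divr_gt0.
have [K K1 HK] := evolution_strip SK l_gt0 Y.
have [L L0 HL] := @det_lipschitz R n K K1.
have K0 : 0 < K := lt_le_trans ltr01 K1.
have LK : 0 < (L + 1) * K by rewrite mulr_gt0 // ltr_wpDl.
have e0 : 0 < f y0 / 2 / ((L + 1) * K) by rewrite !divr_gt0.
move=> T.
have T0 : 0 < `|T| + `|x0| + 1 by rewrite ltr_wpDl ?addr_ge0.
have [t Tt Ht] := almost_period l T0 e0.
exists (x0 + t).
  by have := ler_norm T; have := ler_norm (- x0); rewrite normrN; lra.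
move=> k kY kt; pose k0 := Complex x0 (Im k).
have kE : k = k0 + rc t by apply: complex_eqP; rewrite !ReImE /= ?addr0.
have k0Y : `|Im k0| <= Y by [].
have f0 : f y0 <= cabs (secular S l k0) by apply: miny; rewrite in_itv /= -ler_norml.
have close : cabs (secular S l k0 - secular S l k) <= f y0 / 2.
  apply: le_trans (HL _ _ (K * (f y0 / 2 / ((L + 1) * K))) _ _ _) _.
  - by move=> i j; case: (HK k0 i j k0Y).
  - by move=> i j; case: (HK k i j kY).
  - move=> i j; rewrite !secular_mxE opprB addrC addrA subrK -cabsN opprB.
    rewrite !evolutionE -mulrBr {1}kE phaseD cabsM cabs_rc.
    apply: (@le_trans _ _ (cabs (phase l k0 j * phase l (rc t) j - phase l k0 j))).
      by rewrite cabsB ler_piMl ?cabs_ge0 ?(orthogonal_entry_le1 SK).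
    rewrite -{2}[phase l k0 j]mulr1 -mulrBr cabsM; apply: ler_pM; rewrite ?cabs_ge0 //.
      by case: (HK k0 i j k0Y).
    exact: Ht.
  rewrite (_ : L * _ = L / (L + 1) * (f y0 / 2)).
    rewrite ler_piMl ?divr_ge0 ?(ltW c0) // ler_pdivrMr ?mul1r ?lerDl //.
    by rewrite ltr_wpDl.
  by field; rewrite !gt_eqF // ltr_wpDl.
exact: cabs_close f0 close.
Qed.

End LocalFactorization.

(** * Entire functions determined by their zeros *)
Section Quotient.
Variable R : realType.
Local Notation C := (R[i]).
Implicit Types (A B Q g : C -> C) (k p z : C).

(** Dividing out common zeros: the quotient extends by the quotient of the
    leading coefficients. *)
Lemma entire_quotient A B :
  (forall p, exists m gA gB, [/\ forall z, jet gA z, forall z, jet gB z,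
     gB 0 != 0, forall z, A (p + z) = z ^+ m * gA z &
     forall z, B (p + z) = z ^+ m * gB z]) ->
  exists Q, (forall p, jet Q p) /\ forall k, A k = Q k * B k.
Proof.
move=> AB.
pose P p q := exists m gA gB, [/\ forall z, jet gA z, forall z, jet gB z,
     gB 0 != 0, forall z, A (p + z) = z ^+ m * gA z &
     forall z, B (p + z) = z ^+ m * gB z] /\ q = gA 0 / gB 0.
have /boolp.choice[Q HQ] : forall p, exists q, P p q.
  by move=> p; have [m [gA [gB H]]] := AB p; exists (gA 0 / gB 0), m, gA, gB.
have AQB k : A k = Q k * B k.
  have [m [gA [gB [[_ _ B0 EA EB] ->]]]] := HQ k.
  have := EA 0; have := EB 0; rewrite addr0 => -> ->.
  by rewrite [RHS]mulrCA divfK.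
exists Q; split=> // p.
have [m [gA [gB [[jA jB B0 EA EB] Qp]]]] := HQ p.
have gA3 : germ 3 gA by have := jA 0; rewrite /jet; under eq_fun do rewrite add0r.
have gB3 : germ 3 gB by have := jB 0; rewrite /jet; under eq_fun do rewrite add0r.
apply: germ_near (germM gA3 (germV gB3 B0)).
apply: near0_imp (germ_neq0 gB3 B0) _ => z Bz.
have {}Bz : gB z != 0.
  by rewrite -cabs_gt0 (lt_le_trans _ Bz) // divr_gt0 ?cabs_gt0.
have [->|z0] := eqVneq z 0; first by rewrite addr0 Qp.
have zm : z ^+ m != 0 by rewrite expf_neq0.
apply: (mulIf Bz); rewrite mulfVK //; apply: (mulfI zm).
by rewrite mulrCA -EB -AQB EA.
Qed.

End Quotient.

Section Comparison.
Variable R : realType.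
Local Notation C := (R[i]).
Implicit Types (Z Q : C -> C) (m : C -> nat) (k p z : C) (h Y T e : R).

(** Entire functions of exponential type [h] with zeros of order [m p] at [p],
    all of them real, which behave like a secular determinant. *)
Record spectral_function Z h m : Prop := SpectralFunction {
  sf_factor : forall p, exists g, [/\ forall z, jet g z, g 0 != 0 &
    forall z, Z (p + z) = z ^+ m p * g z];
  sf_even : forall k, cabs (Z (- k)) = cabs (Z k);
  sf_asymptotic : forall e, 0 < e -> exists Y0, forall k, Y0 <= `|Im k| ->
    (1 - e) * expR (h * `|Im k|) <= cabs (Z k) <= (1 + e) * expR (h * `|Im k|);
  sf_bounded : forall Y, exists K, forall k, `|Im k| <= Y -> cabs (Z k) <= K;
  sf_sides : forall Y, 0 <= Y -> exists2 c : R, 0 < c & forall T, exists2 t, T <= t &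
    forall k, `|Im k| <= Y -> `|Re k| = t -> c <= cabs (Z k);
  sf_neq0 : forall k, Im k != 0 -> Z k != 0 }.

Section Pair.
Variables (Z1 Z2 : C -> C) (h1 h2 : R) (m1 m2 : C -> nat).
Hypotheses (sf1 : spectral_function Z1 h1 m1) (sf2 : spectral_function Z2 h2 m2).
Hypothesis same_order : forall p, p != 0 -> m1 p = m2 p.
Let w1 := m1 0.
Let w2 := m2 0.

(** The powers of [k] equalize the orders at [0], where nothing relates [m1] and
    [m2]. *)
Lemma spectral_quotient : exists Q, (forall p, jet Q p) /\
  forall k, k ^+ w2 * Z1 k = Q k * (k ^+ w1 * Z2 k).
Proof.
apply: entire_quotient => p.
have [g1 [j1 g10 E1]] := sf_factor sf1 p; have [g2 [j2 g20 E2]] := sf_factor sf2 p.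
have [p0|p0] := eqVneq p 0.
  exists (w1 + w2)%N, g1, g2; split=> //.
  - by move=> z; rewrite E1 p0 add0r exprD -/w1; ring.
  - by move=> z; rewrite E2 p0 add0r exprD -/w2; ring.
have jX q n : jet (fun z => (p + z) ^+ n) q.
  by apply: jetX; apply: jetD; [exact: jet_cst|exact: jet_id].
exists (m1 p), (fun z => (p + z) ^+ w2 * g1 z), (fun z => (p + z) ^+ w1 * g2 z).
split=> [z|z||z|z]; try exact: jetM.
- by rewrite addr0 mulf_neq0 // expf_neq0.
- by rewrite E1; ring.
- by rewrite E2 (same_order p0); ring.
Qed.

Section WithQuotient.
Variable Q : C -> C.
Hypotheses (jQ : forall p, jet Q p)
  (QE : forall k, k ^+ w2 * Z1 k = Q k * (k ^+ w1 * Z2 k)).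

Lemma cabs_quotient k : k != 0 -> Z2 k != 0 ->
  cabs (Q k) = cabs k ^+ w2 / cabs k ^+ w1 * (cabs (Z1 k) / cabs (Z2 k)).
Proof.
move=> k0 Zk; have := congr1 (@cabs R) (QE k); rewrite !cabsM !cabsX => E.
have a0 : cabs k ^+ w1 != 0 by rewrite expf_neq0 // cabs_eq0.
have b0 : cabs (Z2 k) != 0 by rewrite cabs_eq0.
apply: (mulIf (mulf_neq0 a0 b0)); rewrite -E; field.
by rewrite a0 b0.
Qed.

Lemma quotient_asymptotic e : 0 < e -> exists2 Y0, 1 <= Y0 &
  forall k, Y0 <= `|Im k| ->
  cabs (Q k) <= (1 + e) * expR ((h1 - h2) * `|Im k|) * (cabs k ^+ w2 / cabs k ^+ w1).
Proof.
move=> e0; pose d := e / (2 + e).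
have d0 : 0 < d by rewrite divr_gt0 // addr_gt0.
have d1 : 0 < 1 - d by rewrite subr_gt0 ltr_pdivrMr ?addr_gt0 //; lra.
have de : (1 + d) / (1 - d) = 1 + e.
  rewrite /d; field; rewrite gt_eqF ?addr_gt0 //=.
  by apply/eqP; lra.
have [Y1 A1] := sf_asymptotic sf1 d0; have [Y2 A2] := sf_asymptotic sf2 d0.
exists (Num.max 1 (Num.max Y1 Y2)); first by rewrite le_max lexx.
move=> k; rewrite !ge_max => /and3P[k1 kY1 kY2].
have Ik : Im k != 0 by rewrite -normr_gt0 (lt_le_trans _ k1).
have k0 : k != 0 by apply: contra Ik => /eqP ->.
rewrite cabs_quotient ?(sf_neq0 sf2) // mulrC ler_wpM2r //.
  by rewrite divr_ge0 // exprn_ge0 ?cabs_ge0.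
have /andP[_ u1] := A1 _ kY1; have /andP[l2 _] := A2 _ kY2.
have l20 : 0 < (1 - d) * expR (h2 * `|Im k|) by rewrite mulr_gt0 ?expR_gt0.
apply: le_trans (ler_pM (cabs_ge0 _) _ u1 (_ : _ <= ((1 - d) * expR (h2 * `|Im k|))^-1)) _.
- by rewrite invr_ge0 cabs_ge0.
- by rewrite lef_pV2 ?posrE // (lt_le_trans l20).
rewrite invfM mulrACA de -expRN -expRD ler_wpM2l ?addr_ge0 ?ler01 ?(ltW e0) //.
by rewrite ler_expR; lra.
Qed.

Lemma pow_ratio_le (x : R) a b d : 1 <= x -> (a <= b + d)%N ->
  x ^+ a / x ^+ b <= x ^+ d.
Proof.
move=> x1 abd; have x0 : 0 < x := lt_le_trans ltr01 x1.
by rewrite ler_pdivrMr ?exprn_gt0 // -exprD addnC ler_weXn2l.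
Qed.

(** The factor [(k + 2iY)^-d] has its pole outside the strip and compensates a
    growth of order [|k|^d], since [|k| <= |k + 2iY|] in the strip. *)
Lemma quotient_strip Y (M : R) d : 0 < Y -> 0 <= M -> (w2 <= w1 + d)%N ->
  (forall k, `|Im k| = Y -> cabs (Q k) <= M * cabs (k + 2 * ci * rc Y) ^+ d) ->
  forall k, `|Im k| <= Y -> cabs (Q k) <= M * cabs (k + 2 * ci * rc Y) ^+ d.
Proof.
move=> Y0 M0 wd topQ.
pose s k : C := k + 2 * ci * rc Y.
have ReS k : Re (s k) = Re k by rewrite /s mulr2n mulrDl !ReImE /=; ring.
have ImS k : Im (s k) = Im k + 2 * Y by rewrite /s mulr2n mulrDl !ReImE /=; ring.
have s0 k : `|Im k| <= Y -> 0 < cabs (s k).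
  rewrite ler_norml => /andP[kY _].
  by apply: lt_le_trans (normr_Im_le _); rewrite ImS gtr0_norm; lra.
have ks k : `|Im k| <= Y -> cabs k <= cabs (s k).
  rewrite ler_norml => /andP[kY1 kY2]; rewrite -ler_sqr ?nnegrE ?cabs_ge0 //.
  by rewrite !sqr_cabs ReS ImS lerD2l; nra.
pose H k := Q k * (s k)^-1 ^+ d.
have HE k : cabs (H k) = cabs (Q k) / cabs (s k) ^+ d.
  by rewrite cabsM cabsX cabsV exprVn.
suff HM k : `|Im k| <= Y -> cabs (H k) <= M.
  by move=> k kY; have := HM k kY; rewrite HE ler_pdivrMr // exprn_gt0 // s0.
have [K1 Z1K] := sf_bounded sf1 Y.
have [c c0 side] := sf_sides sf2 (ltW Y0).
move: k; apply: (@strip_principle _ H Y M (`|K1| / c)) => //.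
- exact: ltW.
- move=> k kY; apply: jetM => //; apply: jetX; apply: jetV.
    by apply: jetD; [exact: jet_id|exact: jet_cst].
  by rewrite -cabs_gt0 s0.
- move=> k kY; rewrite HE ler_pdivrMr ?exprn_gt0 ?s0 ?kY //; exact: topQ.
move=> T; have [t Tt tside] := side (Num.max 1 T).
move: Tt; rewrite ge_max => /andP[t1 Tt].
suff tbd k : `|Im k| <= Y -> `|Re k| = t -> cabs (H k) <= `|K1| / c.
  exists t, t; split=> // k kY kt; apply: tbd => //.
    by rewrite kt ger0_norm // (le_trans ler01).
  by rewrite kt normrN ger0_norm // (le_trans ler01).
move=> kY kt; have ck := tside k kY kt.
have k1 : 1 <= cabs k by rewrite (le_trans t1) // -kt normr_Re_le.
have k0 : k != 0 by rewrite -cabs_gt0 (lt_le_trans _ k1).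
have Zk0 : 0 < cabs (Z2 k) := lt_le_trans c0 ck.
rewrite HE cabs_quotient //; last by rewrite -cabs_gt0.
rewrite mulrAC -[leRHS]mul1r; apply: ler_pM.
- by rewrite !divr_ge0 ?exprn_ge0 ?cabs_ge0.
- by rewrite divr_ge0 ?cabs_ge0.
- rewrite ler_pdivrMr ?exprn_gt0 ?s0 // mul1r.
  apply: le_trans (pow_ratio_le k1 wd) _.
  by rewrite lerXn2r ?nnegrE ?cabs_ge0 // ks.
- apply: ler_pM; rewrite ?cabs_ge0 ?invr_ge0 ?cabs_ge0 //.
    by rewrite (le_trans (Z1K k kY)) // ler_norm.
  by rewrite lef_pV2 // posrE.
Qed.

Lemma quotient_at_ci : 0 < cabs (Q ci).
Proof.
have ci1 : Im (@ci R) != 0 by rewrite /= oner_eq0.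
have ci0 : ci != 0 :> C by rewrite -cabs_gt0 cabs_ci.
rewrite cabs_gt0; apply: contraNneq (sf_neq0 sf1 ci1) => Q0.
have := QE ci; rewrite Q0 mul0r => /eqP.
by rewrite mulf_eq0 expf_eq0 (negPf ci0) andbF.
Qed.

(** Only the decay in [Y] matters; the constant comes from [e^x >= 1 + x] applied to
    [x = d * Y / n.+1] and raised to the power [n.+1]. *)
Lemma expR_beats_power (d Y : R) n : 0 < d -> 0 <= Y ->
  expR (- (d * Y)) * (1 + Y) ^+ n <= (n.+1%:R / d + 1) ^+ n.+1 / (1 + Y).
Proof.
move=> d0 Y0; have Y1 : 0 < 1 + Y by rewrite ltr_pwDl.
have n0 : 0 < n.+1%:R :> R by rewrite ltr0n.
rewrite ler_pdivlMr // -mulrA -exprSr mulrC expRN ler_pdivrMr ?expR_gt0 //.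
have -> : d * Y = n.+1%:R * (d * Y / n.+1%:R) by rewrite [RHS]mulrC divfK // gt_eqF.
have c0 : 0 <= n.+1%:R / d + 1 by rewrite addr_ge0 // divr_ge0 // ltW.
rewrite expRM_natl -exprMn; apply: lerXn2r; rewrite ?nnegrE ?mulr_ge0 ?expR_ge0 ?(ltW Y1) //.
apply: le_trans (ler_wpM2l c0 (expR_ge1Dx _)).
have -> : (n.+1%:R / d + 1) * (1 + d * Y / n.+1%:R) =
    1 + Y + (n.+1%:R / d + d * Y / n.+1%:R) by field; rewrite !gt_eqF.
by rewrite lerDl addr_ge0 // divr_ge0 // ?mulr_ge0 // ltW.
Qed.

Lemma cabs_le_shift k Y : `|Im k| <= Y -> cabs k <= cabs (k + 2 * ci * rc Y).
Proof.
rewrite ler_norml => /andP[kY1 kY2]; rewrite -ler_sqr ?nnegrE ?cabs_ge0 //.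
rewrite !sqr_cabs mulr2n mulrDl !ReImE /=.
by rewrite (_ : Re k + _ = Re k) ?lerD2l; [nra|ring].
Qed.

Lemma le0_of_le_div (x K Y0 : R) :
  (forall Y, Y0 <= Y -> 0 < Y -> x <= K / Y) -> x <= 0.
Proof.
move=> xK; rewrite leNgt; apply/negP => x0.
pose Y := Num.max Y0 (`|K| / x + 1).
have Yp : 0 < Y by rewrite lt_max [X in _ || X]ltr_wpDl ?orbT ?divr_ge0 // ltW.
have := xK Y; rewrite le_max lexx => /(_ isT Yp); rewrite ler_pdivlMr // => xYK.
have : x * (`|K| / x + 1) <= K.
  by apply: le_trans xYK; rewrite ler_wpM2l ?(ltW x0) // le_max lexx orbT.
rewrite mulrDr mulr1 mulrC divfK ?gt_eqF //.
by have := ler_norm K; lra.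
Qed.

(** If [h1 < h2] the quotient decays exponentially on the boundary of wide strips,
    up to a power of [Y], so it vanishes at [i]. *)
Lemma quotient_type_ge : h2 <= h1.
Proof.
rewrite leNgt; apply/negP => h12; pose d := h2 - h1.
have d0 : 0 < d by rewrite subr_gt0.
have [Y0 Y01 top] := quotient_asymptotic ltr01.
pose K := 2 * 2 ^+ w2 * (w2.+1%:R / d + 1) ^+ w2.+1.
have K0 : 0 <= (w2.+1%:R / d + 1) ^+ w2.+1.
  by rewrite exprn_ge0 // addr_ge0 // divr_ge0 // ltW.
have := quotient_at_ci; rewrite ltNge => /negP; apply.
apply: (@le0_of_le_div _ K Y0) => Y Y0Y Yp; have Y1 := le_trans Y01 Y0Y.
have e0 : 0 <= 2 * expR (- (d * Y)) by rewrite mulr_ge0 ?expR_ge0.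
have := @quotient_strip Y (2 * expR (- (d * Y))) w2 Yp e0 (leq_addl _ _) _ ci.
rewrite /= normr1 => Qci; apply: le_trans (Qci _ Y1) _ => [k kY|].
  apply: le_trans (top k _) _; first by rewrite kY.
  rewrite kY (_ : (h1 - h2) * Y = - (d * Y)); last by rewrite /d; ring.
  rewrite ler_wpM2l //.
  have k1 : 1 <= cabs k by rewrite (le_trans Y1) // -kY normr_Im_le.
  apply: le_trans (pow_ratio_le k1 (leq_addl w1 w2)) _.
  by rewrite lerXn2r ?nnegrE ?cabs_ge0 // cabs_le_shift // kY.
have -> : cabs (ci + 2 * ci * rc Y) = 1 + 2 * Y.
  rewrite (_ : _ + _ = ci * rc (1 + 2 * Y)).
    by rewrite cabsM cabs_ci mul1r cabs_rc ger0_norm // addr_ge0 // mulr_ge0 // ltW.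
  by rewrite mulr2n mulrDl; apply: complex_eqP; rewrite !ReImE /=; ring.
have Y1p : 0 < 1 + Y by rewrite ltr_wpDl.
apply: (@le_trans _ _ (2 * expR (- (d * Y)) * (2 * (1 + Y)) ^+ w2)).
  rewrite ler_wpM2l // lerXn2r ?nnegrE //; last by lra.
  - by lra.
  - by lra.
rewrite exprMn (_ : _ * _ = 2 * 2 ^+ w2 * (expR (- (d * Y)) * (1 + Y) ^+ w2)); last by ring.
rewrite /K -[leRHS]mulrA ler_wpM2l ?mulr_ge0 ?exprn_ge0 //.
apply: le_trans (expR_beats_power w2 d0 (ltW Yp)) _.
by rewrite ler_wpM2l // lef_pV2 ?posrE // lerDr.
Qed.

(** If [w2 < w1] the quotient is [O(1 / Y)] on the boundary of wide strips. *)
Lemma quotient_order_le : h1 = h2 -> (w1 <= w2)%N.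
Proof.
move=> h12; rewrite leqNgt; apply/negP => w21.
have [Y0 Y01 top] := quotient_asymptotic ltr01.
have := quotient_at_ci; rewrite ltNge => /negP; apply.
apply: (@le0_of_le_div _ 2 Y0) => Y Y0Y Yp; have Y1 := le_trans Y01 Y0Y.
have M0 : 0 <= 2 / Y by rewrite divr_ge0 // ltW.
have w2w1 : (w2 <= w1 + 0)%N by rewrite addn0 ltnW.
have := @quotient_strip Y (2 / Y) 0 Yp M0 w2w1 _ ci.
rewrite /= normr1 expr0 mulr1; apply=> // k kY.
apply: le_trans (top k _) _; first by rewrite kY.
rewrite h12 subrr mul0r expR0 mulr1 ler_wpM2l //.
have k1 : 1 <= cabs k by rewrite (le_trans Y1) // -kY normr_Im_le.
have k0 : 0 < cabs k := lt_le_trans ltr01 k1.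
apply: (@le_trans _ _ (cabs k)^-1); last by rewrite lef_pV2 ?posrE // -kY normr_Im_le.
rewrite ler_pdivrMr ?exprn_gt0 // -(ler_pM2l k0) -exprS mulrA divff ?gt_eqF // mul1r.
by rewrite ler_weXn2l.
Qed.

Lemma quotient_le1 : h1 = h2 -> w1 = w2 -> forall k, cabs (Q k) <= 1.
Proof.
move=> h12 w12 k; apply/ler_addgt0Pr => e e0.
have [Y0 Y01 top] := quotient_asymptotic e0.
pose Y := Num.max Y0 `|Im k|.
have Y0Y : Y0 <= Y by rewrite le_max lexx.
have Y1 := le_trans Y01 Y0Y.
have kY : `|Im k| <= Y by rewrite le_max lexx orbT.
have e1 : 0 <= 1 + e by rewrite addr_ge0 // ltW.
have ww : (w2 <= w1 + 0)%N by rewrite addn0 w12.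
have := @quotient_strip Y (1 + e) 0 (lt_le_trans ltr01 Y1) e1 ww _ k kY.
rewrite expr0 mulr1; apply=> z zY.
apply: le_trans (top z _) _; first by rewrite zY.
have z1 : 1 <= cabs z by rewrite (le_trans Y1) // -zY normr_Im_le.
rewrite h12 subrr mul0r expR0 mulr1 w12 divff ?mulr1 //.
by rewrite expf_neq0 // gt_eqF // (lt_le_trans ltr01).
Qed.

End WithQuotient.

Lemma spectral_type_ge : h2 <= h1.
Proof. by have [Q [jQ QE]] := spectral_quotient; exact: quotient_type_ge jQ QE. Qed.

Lemma spectral_order_le : h1 = h2 -> (w1 <= w2)%N.
Proof. by have [Q [jQ QE]] := spectral_quotient; exact: quotient_order_le jQ QE. Qed.

Lemma spectral_cabs_le : h1 = h2 -> w1 = w2 -> forall k, k != 0 -> cabs (Z1 k) <= cabs (Z2 k).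
Proof.
have [Q [jQ QE]] := spectral_quotient => h12 w12 k k0.
have kw : k ^+ w1 != 0 by rewrite expf_neq0.
have -> : Z1 k = Q k * Z2 k.
  by apply: (mulfI kw); rewrite {1}w12 QE; ring.
by rewrite cabsM ler_piMl ?cabs_ge0 // (quotient_le1 jQ QE).
Qed.

End Pair.

(** A spectral function is determined, up to a unimodular factor, by its
    nonzero zeros. *)
Theorem spectral_function_unique (Z1 Z2 : C -> C) h1 h2 m1 m2 :
  spectral_function Z1 h1 m1 -> spectral_function Z2 h2 m2 ->
  (forall p, p != 0 -> m1 p = m2 p) ->
  h1 = h2 /\ forall k, k != 0 -> cabs (Z1 k) = cabs (Z2 k).
Proof.
move=> sf1 sf2 m12; have m21 p : p != 0 -> m2 p = m1 p by move=> /m12.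
have h12 : h1 = h2.
  by apply/eqP; rewrite eq_le (spectral_type_ge sf2 sf1) ?(spectral_type_ge sf1 sf2).
have w12 : m1 0 = m2 0.
  apply/eqP; rewrite eqn_leq (spectral_order_le sf1 sf2) //.
  by rewrite (spectral_order_le sf2 sf1).
split=> // k k0; apply/eqP; rewrite eq_le (spectral_cabs_le sf1 sf2) //.
by rewrite (spectral_cabs_le sf2 sf1).
Qed.

End Comparison.

(** * Secular determinants are determined by their kernels *)
(* Keeps unification from unfolding determinants. *)
Opaque secular.

Section SecularSpectral.
Variables (R : realType) (n : nat) (S : 'M[R]_n) (l : 'I_n -> R).
Hypotheses (SK : S^T *m S = 1%:M) (l_gt0 : forall i, 0 < l i).
Local Notation C := (R[i]).
Implicit Types (k p z : C).

(** The phase makes the secular determinant symmetric under [k -> -k]. *)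
Definition balanced_secular k : C :=
  cexp (- (ci * rc (total_length l / 2)) * k) * secular S l k.

Lemma balanced_secularE k : balanced_secular k =
  cexp (- (ci * rc (total_length l / 2)) * k) * secular S l k.
Proof. by []. Qed.

Lemma cabs_balanced k : cabs (balanced_secular k) =
  expR (total_length l / 2 * Im k) * cabs (secular S l k).
Proof.
by rewrite cabsM cabs_cexp !ReImE /=; congr (expR _ * _); ring.
Qed.

Opaque balanced_secular.

Lemma balanced_secular_even k : cabs (balanced_secular (- k)) = cabs (balanced_secular k).
Proof.
apply: etrans (cabs_balanced _) _; apply: etrans _ (esym (cabs_balanced _)).
apply: etrans _ (esym (congr1 _ (cabs_secularN l SK k))).
rewrite mulrA -expRD ImN; congr (expR _ * _).
by move: (total_length l) (Im k) => a b; field.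
Qed.

Lemma secular_spectral :
  spectral_function balanced_secular (total_length l / 2) (kernel_dim S l).
Proof.
have neq0 k : Im k != 0 -> balanced_secular k != 0.
  by move=> k0; rewrite balanced_secularE mulf_neq0 ?cexp_neq0 ?(secular_neq0 SK l_gt0).
split=> //.
- move=> p; have [g [jg g0 Eg]] := secular_factor SK l_gt0 p.
  exists (fun z => cexp (- (ci * rc (total_length l / 2)) * p) *
    cexp (- (ci * rc (total_length l / 2)) * z) * g z); split.
  + move=> z; apply: jetM => //; apply: jetM; first exact: jet_cst.
    exact: jet_cexpM.
  + by rewrite !mulf_neq0 ?cexp_neq0.
  + by move=> z; rewrite balanced_secularE Eg -cexpD -mulrDr mulrCA.
- exact: balanced_secular_even.
- move=> e e0; have [Y0 HY] := secular_at_infinity SK l_gt0 e0.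
  exists (Num.max Y0 0) => k; rewrite ge_max => /andP[kY _].
  have pos z : Y0 <= Im z -> `|Im z| = Im z ->
      (1 - e) * expR (total_length l / 2 * `|Im z|) <= cabs (balanced_secular z)
        <= (1 + e) * expR (total_length l / 2 * `|Im z|).
    move=> /HY zY ->; rewrite cabs_balanced [X in _ <= X <= _]mulrC !ler_pM2r ?expR_gt0 //.
    have := ler_cabsB (secular S l z) 1; have := ler_cabsB 1 (secular S l z).
    rewrite (cabsB 1) cabs1 => ? ?; apply/andP; split; lra.
  have [k0|k0] := leP 0 (Im k); first by apply: pos; rewrite ?ger0_norm // -(ger0_norm k0).
  rewrite -balanced_secular_even -[Im k]opprK normrN -ImN; apply: pos.
    by rewrite ImN -ltr0_norm.
  by rewrite ImN gtr0_norm // oppr_gt0.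
- move=> Y; have [K HK] := secular_bounded SK l_gt0 Y.
  exists (expR (total_length l / 2 * Y) * K) => k kY.
  rewrite cabs_balanced; apply: ler_pM; rewrite ?expR_ge0 ?cabs_ge0 ?HK //.
  rewrite ler_expR ler_wpM2l //; last by rewrite (le_trans (ler_norm _)).
  by rewrite divr_ge0 // /total_length sumr_ge0 // => i _; exact: ltW.
- move=> Y Y0; have [c c0 side] := secular_sides SK l_gt0 Y0.
  have L0 : 0 <= total_length l / 2.
    by rewrite divr_ge0 // /total_length sumr_ge0 // => i _; exact: ltW.
  exists (expR (total_length l / 2 * - Y) * c) => [|T].
    by rewrite mulr_gt0 ?expR_gt0.
  have [t Tt tside] := side (Num.max T 0); move: Tt; rewrite ge_max => /andP[Tt t0].
  exists t => // k kY kt.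
  have pos z : `|Im z| <= Y -> Re z = t ->
      expR (total_length l / 2 * - Y) * c <= cabs (balanced_secular z).
    move=> zY zt; rewrite cabs_balanced.
    apply: ler_pM; rewrite ?expR_ge0 ?(ltW c0) ?tside //.
    rewrite ler_expR ler_wpM2l //; move: zY; rewrite ler_norml => /andP[]; lra.
  have [k0|k0] := leP 0 (Re k); first by apply: pos; rewrite // -kt ger0_norm.
  by rewrite -balanced_secular_even; apply: pos; rewrite ?ImN ?normrN // ReN -kt ltr0_norm.
Qed.

End SecularSpectral.

(** The secular determinant on the imaginary axis, written over the reals. *)
Definition damped_det (R : realType) n (S : 'M[R]_n) (l : 'I_n -> R) (y : R) : R :=
  \det (1%:M - S *m diag_mx (\row_i expR (- (l i * y)))).

Lemma secular_imaginary (R : realType) n (S : 'M[R]_n) (l : 'I_n -> R) (y : R) :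
  secular S l (ci * rc y) = rc (damped_det S l y).
Proof.
Transparent secular.
rewrite /secular /damped_det -det_map_mx; congr (\det _); apply/matrixP => i j.
have E : (1%:M - S *m diag_mx (\row_i expR (- (l i * y)))) i j =
    (i == j)%:R - S i j * expR (- (l j * y)).
  rewrite mxE [X in X + _]mxE [X in _ + X]mxE mul_mx_diag.
  by rewrite [X in - X]mxE [X in _ * X]mxE.
rewrite secular_mxE evolutionE [RHS]mxE E rmorphB rmorphM [1%:M i j]mxE rmorph_nat.
congr (_ - _ * _); rewrite /phase (_ : _ * _ = rc (- (l j * y))).
  by apply: complex_eqP; rewrite /= ?cos0 ?sin0 ?mulr1 ?mulr0.
by apply: complex_eqP; rewrite !ReImE /=; ring.
Qed.

Theorem damped_det_unique (R : realType) n1 n2 (S1 : 'M[R]_n1) (S2 : 'M[R]_n2)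
    (l1 : 'I_n1 -> R) (l2 : 'I_n2 -> R) :
  S1^T *m S1 = 1%:M -> S2^T *m S2 = 1%:M ->
  (forall i, 0 < l1 i) -> (forall i, 0 < l2 i) ->
  (forall p, p != 0 -> kernel_dim S1 l1 p = kernel_dim S2 l2 p) ->
  forall y, 0 < y -> `|damped_det S1 l1 y| = `|damped_det S2 l2 y|.
Proof.
move=> K1 K2 l1_gt0 l2_gt0 same y y0.
have [hE zE] := spectral_function_unique (secular_spectral K1 l1_gt0)
  (secular_spectral K2 l2_gt0) same.
have ky : ci * rc y != 0 by rewrite -cabs_gt0 cabsM cabs_ci mul1r cabs_rc normr_gt0 gt_eqF.
have := zE _ ky; rewrite (cabs_balanced S1) (cabs_balanced S2) hE.
rewrite (secular_imaginary S1) (secular_imaginary S2) !cabs_rc.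
by apply: mulfI; rewrite gt_eqF ?expR_gt0.
Qed.

(** * Second order expansion of determinants near the identity *)
Section Perturbation.
Variables (R : realType) (n : nat).
Implicit Types (A B M N : 'M[R]_n) (a b : R).

Lemma det_lipschitz_real (K : R) : 1 <= K -> exists2 L : R, 0 <= L &
  forall A B (d : R), (forall i j, `|A i j| <= K) -> (forall i j, `|B i j| <= K) ->
    (forall i j, `|A i j - B i j| <= d) -> `|\det A - \det B| <= L * d.
Proof.
move=> K1; have [L L0 HL] := @det_lipschitz R n K K1; exists L => // A B d AK BK ABd.
rewrite -cabs_rc rmorphB /= -!det_map_mx; apply: HL => i j.
- by rewrite mxE cabs_rc.
- by rewrite mxE cabs_rc.
- by rewrite !mxE -rmorphB cabs_rc.
Qed.

Lemma prod1B_first_order (I : Type) (s : seq I) : exists2 K : R, 0 <= K &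
  forall (x : I -> R) (b : R), 0 <= b <= 1 -> (forall i, `|x i| <= b) ->
    `|\prod_(i <- s) (1 - x i) - (1 - \sum_(i <- s) x i)| <= K * b ^+ 2.
Proof.
elim: s => [|i s [K K0 IH]].
  by exists 0 => // x b _ _; rewrite !big_nil !subr0 subrr normr0 mul0r.
exists (K + (K + (size s)%:R)); first by rewrite !addr_ge0.
move=> x b b01 xb; have := IH x b b01 xb; rewrite !big_cons.
set p := \prod_(j <- s) _; set t := \sum_(j <- s) _ => Kp.
have /andP[b0 b1] := b01.
have tb : `|t| <= (size s)%:R * b.
  rewrite /t; elim: s {IH p t Kp} => [|j s IHs]; first by rewrite big_nil normr0 mul0r.
  rewrite big_cons /= -natr1 mulrDl mul1r [leRHS]addrC.
  by rewrite (le_trans (ler_normD _ _)) // lerD ?xb.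
have -> : (1 - x i) * p - (1 - (x i + t)) =
    (p - (1 - t)) + x i * (t - (p - (1 - t))) by ring.
apply: le_trans (ler_normD _ _) _; rewrite mulrDl lerD // normrM.
have -> : (K + (size s)%:R) * b ^+ 2 = b * ((size s)%:R * b + K * b) by ring.
have p1 : `|p - (1 - t)| <= K * b.
  by apply: le_trans Kp _; rewrite ler_wpM2l // expr2 ler_piMr.
apply: ler_pM; rewrite ?normr_ge0 ?xb //.
by rewrite (le_trans (ler_normB _ _)) // lerD.
Qed.

Let addE M N i j : (M + N) i j = M i j + N i j. Proof. by rewrite mxE. Qed.
Let oppE M i j : (- M) i j = - M i j. Proof. by rewrite mxE. Qed.

Definition strict_lower A : 'M[R]_n := \matrix_(i, j) if (j < i)%N then A i j else 0.
Definition strict_upper A : 'M[R]_n := \matrix_(i, j) if (i < j)%N then A i j else 0.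
Definition diagonal A : 'M[R]_n := \matrix_(i, j) if i == j then A i j else 0.

(** [1 - diagonal A - second_order A] is the product of [1 + strict_lower A],
    [1 - A] and [1 + strict_upper A]; the outer factors have determinant [1]. *)
Definition second_order A : 'M[R]_n :=
  strict_lower A *m A + A *m strict_upper A - strict_lower A *m strict_upper A
  + strict_lower A *m A *m strict_upper A.

Lemma triangular_split A : A = strict_lower A + diagonal A + strict_upper A.
Proof.
apply/matrixP => i j; rewrite !mxE -val_eqE /=.
by case: ltngtP; rewrite ?(addr0, add0r).
Qed.

Lemma det_second_order A : \det (1%:M - A) = \det (1%:M - (diagonal A + second_order A)).
Proof.
have det_low : \det (1%:M + strict_lower A) = 1.
  rewrite det_trig.
    by rewrite big1 // => i _; rewrite !mxE eqxx ltnn addr0.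
  apply/is_trig_mxP => i j ij; rewrite !mxE ltnNge (ltnW ij) /= addr0.
  by rewrite -val_eqE /= ltn_eqF.
have det_up : \det (1%:M + strict_upper A) = 1.
  rewrite -det_tr det_trig.
    by rewrite big1 // => i _; rewrite !mxE eqxx ltnn addr0.
  apply/is_trig_mxP => i j ij; rewrite !mxE ltnNge (ltnW ij) /= addr0.
  by rewrite -val_eqE /= gtn_eqF.
have -> : \det (1%:M - A) =
    \det ((1%:M + strict_lower A) *m (1%:M - A) *m (1%:M + strict_upper A)).
  by rewrite !det_mulmx det_low det_up mul1r mulr1.
congr (\det _); rewrite /second_order.
rewrite mulmxDl mul1mx mulmxBr mulmx1 addrA mulmxDr mulmx1.
rewrite mulmxBl mulmxDl mulmxBl mul1mx.
have -> : diagonal A = A - strict_lower A - strict_upper A.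
  by apply/matrixP => i j; rewrite {2}[A]triangular_split !mxE; ring.
move: (strict_lower A *m A *m strict_upper A) (strict_lower A *m strict_upper A).
move: (strict_lower A *m A) (A *m strict_upper A) (strict_lower A) (strict_upper A).
by move=> a b c d e f; apply/matrixP => i j; rewrite !mxE; ring.
Qed.

Lemma mulmx_bound M N a b : (forall i j, `|M i j| <= a) -> (forall i j, `|N i j| <= b) ->
  forall i j, `|(M *m N) i j| <= n%:R * (a * b).
Proof.
move=> Ma Nb i j; rewrite mxE (le_trans (ler_norm_sum _ _ _)) //.
rewrite -[X in X%:R]card_ord -sum1_card natr_sum mulr_suml.
by apply: ler_sum => k _; rewrite mul1r normrM ler_pM.
Qed.

Lemma strict_lower_bound A a : 0 <= a -> (forall i j, `|A i j| <= a) ->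
  forall i j, `|strict_lower A i j| <= a.
Proof. by move=> a0 Aa i j; rewrite mxE; case: ifP; rewrite ?normr0. Qed.

Lemma strict_upper_bound A a : 0 <= a -> (forall i j, `|A i j| <= a) ->
  forall i j, `|strict_upper A i j| <= a.
Proof. by move=> a0 Aa i j; rewrite mxE; case: ifP; rewrite ?normr0. Qed.

Lemma second_order_bound A a : 0 <= a <= 1 -> (forall i j, `|A i j| <= a) ->
  forall i j, `|second_order A i j| <= (3 * n%:R + n%:R ^+ 2) * a ^+ 2.
Proof.
move=> /andP[a0 a1] Aa i j.
have Lo := strict_lower_bound a0 Aa; have Up := strict_upper_bound a0 Aa.
have t1 := mulmx_bound Lo Aa i j; have t2 := mulmx_bound Aa Up i j.
have t3 := mulmx_bound Lo Up i j; have t4 := mulmx_bound (mulmx_bound Lo Aa) Up i j.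
have t4' : n%:R * (n%:R * (a * a) * a) <= n%:R ^+ 2 * a ^+ 2.
  rewrite (_ : _ * _ = n%:R ^+ 2 * a ^+ 2 * a); last by ring.
  by rewrite ler_piMr // mulr_ge0 ?exprn_ge0.
rewrite /second_order !addE oppE.
apply: le_trans (ler_normD _ _) _; rewrite mulrDl lerD //; last exact: le_trans t4 t4'.
apply: le_trans (ler_normD _ _) _; rewrite normrN.
have := ler_normD ((strict_lower A *m A) i j) ((A *m strict_upper A) i j).
rewrite expr2; lra.
Qed.

(** After the correction by [second_order], [1 - A] is diagonal up to an error of
    size [a^2], and the determinant of a diagonal matrix is a product. *)
Lemma det1B_first_order : exists2 K : R, 0 <= K &
  forall A a, 0 <= a <= 1 -> (forall i j, `|A i j| <= a) ->
    `|\det (1%:M - A) - (1 - \tr A)| <= K * a ^+ 2.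
Proof.
have [K K0 HK] := @prod1B_first_order _ (index_enum 'I_n).
pose c : R := 3 * n%:R + n%:R ^+ 2.
have c0 : 0 <= c by rewrite addr_ge0 ?mulr_ge0 ?exprn_ge0.
have [|L L0 HL] := @det_lipschitz_real (2 + c); first by lra.
exists (K + L * c); first by rewrite addr_ge0 // mulr_ge0.
move=> A a a01 Aa; have /andP[a0 a1] := a01.
have X := second_order_bound a01 Aa; rewrite -/c in X.
have a2 : a ^+ 2 <= 1 by rewrite exprn_ile1.
have id1 (i j : 'I_n) : `|(1%:M : 'M[R]_n) i j| <= 1.
  by rewrite mxE; case: (i == j); rewrite ?normr1 ?normr0.
have dg i j : `|diagonal A i j| <= 1.
  by rewrite mxE; case: ifP; rewrite ?normr0 // (le_trans (Aa _ _)).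
have dE : \det (1%:M - diagonal A) = \prod_i (1 - A i i).
  rewrite det_trig; first by apply: eq_bigr => i _; rewrite !mxE eqxx.
  apply/is_trig_mxP => i j ij; rewrite !mxE.
  by rewrite -val_eqE /= ltn_eqF // subrr.
have step1 : `|\det (1%:M - A) - \det (1%:M - diagonal A)| <= L * (c * a ^+ 2).
  rewrite det_second_order; apply: HL => i j.
  - rewrite addE oppE addE.
    have := ler_normB ((1%:M : 'M[R]_n) i j) (diagonal A i j + second_order A i j).
    have := ler_normD (diagonal A i j) (second_order A i j).
    have := id1 i j; have := dg i j; have := X i j; have := ler_wpM2l c0 a2.
    rewrite mulr1; lra.
  - rewrite addE oppE.
    have := ler_normB ((1%:M : 'M[R]_n) i j) (diagonal A i j).
    have := id1 i j; have := dg i j; lra.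
  - rewrite !addE !oppE addE.
    by rewrite (_ : _ - _ = - second_order A i j) ?normrN //; ring.
have step2 : `|\prod_i (1 - A i i) - (1 - \tr A)| <= K * a ^+ 2 by exact: HK.
rewrite dE in step1; rewrite mulrDl -mulrA.
apply: le_trans (ler_distD (\prod_i (1 - A i i)) _ _) _.
by rewrite [leRHS]addrC lerD.
Qed.

Definition pair_sum A : R :=
  \sum_(i < n) \sum_(j < n | (j < i)%N) A i j * A j i.

Lemma trace_second_order A :
  \tr (diagonal A + second_order A) =
  \tr A + pair_sum A + \tr (strict_lower A *m A *m strict_upper A).
Proof.
have t1 : \tr (strict_lower A *m A) = pair_sum A.
  apply: eq_bigr => i _; rewrite mxE [RHS]big_mkcond; apply: eq_bigr => j _.
  by rewrite mxE; case: ifP; rewrite ?mul0r.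
have t3 : \tr (strict_lower A *m strict_upper A) = pair_sum A.
  apply: eq_bigr => i _; rewrite mxE [RHS]big_mkcond; apply: eq_bigr => j _.
  by rewrite !mxE; case: ifP; rewrite ?mul0r.
have t2 : \tr (A *m strict_upper A) = pair_sum A.
  rewrite mxtrace_mulC; rewrite /mxtrace /pair_sum.
  under eq_bigr => i _ do rewrite mxE; under [RHS]eq_bigr => i _ do rewrite big_mkcond.
  rewrite [RHS]exchange_big; apply: eq_bigr => i _; apply: eq_bigr => j _ /=.
  by rewrite mxE; case: ifP => _; rewrite ?mul0r // mulrC.
have td : \tr (diagonal A) = \tr A.
  by apply: eq_bigr => i _; rewrite mxE eqxx.
rewrite /second_order !raddfD /= raddfN /= t1 t2 t3 td; ring.
Qed.

End Perturbation.

(** * Decay of the secular determinant along the imaginary axis *)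
Section Decay.
Variables (R : realType) (n : nat) (S : 'M[R]_n) (l : 'I_n -> R) (len : R).
Hypotheses (S1 : forall i j, `|S i j| <= 1) (len_gt0 : 0 < len)
  (len_le : forall i, len <= l i) (loop_len : forall i, S i i != 0 -> 2 * len <= l i)
  (S_diag : forall i, 0 <= S i i) (S_pair : forall i j, 0 <= S i j * S j i).

Let A y : 'M[R]_n := S *m diag_mx (\row_i expR (- (l i * y))).
Let e y := expR (- (len * y)).

Let AE y i j : A y i j = S i j * expR (- (l j * y)).
Proof. by rewrite /A mul_mx_diag mxE [X in _ * X]mxE. Qed.

Let e_gt0 y : 0 < e y. Proof. exact: expR_gt0. Qed.

Let e_le1 y : 0 <= y -> e y <= 1.
Proof. by move=> y0; rewrite /e -[leRHS]expR0 ler_expR oppr_le0 mulr_ge0 // ltW. Qed.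

Let e2 y : e y ^+ 2 = expR (- (2 * len * y)).
Proof. by rewrite /e expr2 -expRD; congr expR; ring. Qed.

Let A_bound y i j : 0 <= y -> `|A y i j| <= e y.
Proof.
move=> y0; rewrite AE normrM (gtr0_norm (expR_gt0 _)).
rewrite (@le_trans _ _ (1 * expR (- (l j * y)))) ?ler_wpM2r ?expR_ge0 //.
by rewrite mul1r ler_expR lerN2 ler_wpM2r.
Qed.

Let A_diag_bound y i : 0 <= y -> `|A y i i| <= e y ^+ 2.
Proof.
move=> y0; rewrite AE; have [->|Sii] := eqVneq (S i i) 0.
  by rewrite mul0r normr0 exprn_ge0 // ltW.
rewrite normrM (gtr0_norm (expR_gt0 _)) e2.
rewrite (@le_trans _ _ (1 * expR (- (l i * y)))) ?ler_wpM2r ?expR_ge0 //.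
by rewrite mul1r ler_expR lerN2 ler_wpM2r // loop_len.
Qed.

Let A_pair_ge0 y i j : 0 <= A y i j * A y j i.
Proof. by rewrite !AE mulrACA mulr_ge0 ?S_pair // mulr_ge0 ?expR_ge0. Qed.

(** The trace collects the closed walks of one bond and [pair_sum] those of two
    bonds. As the diagonal entries, which come from loops, are already of size
    [e^2], the matrix to which [det1B_first_order] is applied has size [e^2]
    and its error has size [e^4]. *)
Lemma damped_det_expansion : exists K Y0, [/\ 0 <= K, 0 <= Y0 &
  forall y, Y0 <= y ->
    `|(1 - damped_det S l y) - (\tr (A y) + pair_sum (A y))| <= K * e y ^+ 3].
Proof.
have [K1 K10 HK1] := det1B_first_order R n.
pose c : R := 1 + (3 * n%:R + n%:R ^+ 2).
have c1 : 1 <= c by rewrite lerDl addr_ge0 ?mulr_ge0 ?exprn_ge0.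
have c0 : 0 <= c := le_trans ler01 c1.
exists (K1 * c ^+ 2 + n%:R ^+ 3), (c / len); split.
- by rewrite addr_ge0 ?mulr_ge0 ?exprn_ge0.
- by rewrite divr_ge0 // ltW.
move=> y; rewrite ler_pdivrMr // mulrC => cy.
have y0 : 0 <= y by rewrite -(pmulr_rge0 _ len_gt0) (le_trans c0).
have ce : c * e y <= 1.
  rewrite /e expRN ler_pdivrMr ?expR_gt0 // mul1r (le_trans cy) //.
  by apply: le_trans (expR_ge1Dx _); rewrite lerDr.
have e01 : 0 <= e y <= 1 by rewrite (ltW (e_gt0 _)) e_le1.
have Ab i j : `|A y i j| <= e y := A_bound i j y0.
pose B := diagonal (A y) + second_order (A y).
have e20 : 0 <= e y ^+ 2 by rewrite exprn_ge0 // ltW.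
have Bb i j : `|B i j| <= c * e y ^+ 2.
  rewrite mxE (le_trans (ler_normD _ _)) // mulrDl lerD //; last first.
    exact: second_order_bound.
  rewrite mul1r mxE; case: eqP => [->|_]; last by rewrite normr0.
  exact: A_diag_bound.
have b01 : 0 <= c * e y ^+ 2 <= 1.
  rewrite mulr_ge0 //= expr2 mulrA (le_trans _ (e_le1 y0)) //.
  by rewrite ler_piMl // ltW.
have := HK1 B _ b01 Bb; rewrite -det_second_order trace_second_order.
have : `|\tr (strict_lower (A y) *m A y *m strict_upper (A y))| <= n%:R ^+ 3 * e y ^+ 3.
  rewrite /mxtrace (le_trans (ler_norm_sum _ _ _)) //.
  have -> : n%:R ^+ 3 * e y ^+ 3 = \sum_(i < n) n%:R * (n%:R * (e y * e y) * e y).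
    by rewrite sumr_const card_ord -mulr_natl; ring.
  apply: ler_sum => i _; apply: mulmx_bound.
    by apply: mulmx_bound => //; apply: strict_lower_bound => //; exact: ltW.
  by apply: strict_upper_bound => //; exact: ltW.
set t := \tr (_ *m _); rewrite -/(damped_det S l y) => tb det_b.
have e43 : K1 * (c * e y ^+ 2) ^+ 2 <= K1 * c ^+ 2 * e y ^+ 3.
  rewrite (_ : K1 * _ ^+ 2 = K1 * c ^+ 2 * e y ^+ 3 * e y); last by ring.
  by rewrite ler_piMr ?e_le1 // !mulr_ge0 ?exprn_ge0 // ltW.
have -> : 1 - damped_det S l y - (\tr (A y) + pair_sum (A y)) =
    t - (damped_det S l y - (1 - (\tr (A y) + pair_sum (A y) + t))) by ring.
rewrite (le_trans (ler_normB _ _)) // mulrDl [leRHS]addrC lerD //.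
exact: le_trans det_b e43.
Qed.

Lemma damped_det_upper : exists K Y0, forall y, Y0 <= y ->
  `|1 - damped_det S l y| <= K * expR (- (2 * len * y)).
Proof.
have [K [Y0 [K0 Y00 HK]]] := damped_det_expansion.
exists (K + (n%:R + n%:R ^+ 2)), Y0 => y Yy; have y0 := le_trans Y00 Yy.
have e20 : 0 <= e y ^+ 2 by rewrite exprn_ge0 // ltW.
have t1 : `|\tr (A y)| <= n%:R * e y ^+ 2.
  rewrite (le_trans (ler_norm_sum _ _ _)) //.
  rewrite -[X in X%:R]card_ord -sum1_card natr_sum mulr_suml.
  by apply: ler_sum => i _; rewrite mul1r A_diag_bound.
have t2 : `|pair_sum (A y)| <= n%:R ^+ 2 * e y ^+ 2.
  rewrite (le_trans (ler_norm_sum _ _ _)) //.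
  have -> : n%:R ^+ 2 * e y ^+ 2 = \sum_(i < n) \sum_(j < n) e y ^+ 2.
    by rewrite !sumr_const card_ord -mulrnA -[RHS]mulr_natl natrM expr2.
  apply: ler_sum => i _; rewrite (le_trans (ler_norm_sum _ _ _)) // big_mkcond.
  apply: ler_sum => j _; case: ifP => // _.
  by rewrite normrM expr2; apply: ler_pM; rewrite ?A_bound.
rewrite -e2 -[1 - _](subrK (\tr (A y) + pair_sum (A y))) mulrDl mulrDl.
rewrite (le_trans (ler_normD _ _)) // lerD //; last first.
  by rewrite (le_trans (ler_normD _ _)) // lerD.
by rewrite (le_trans (HK y Yy)) // ler_wpM2l // exprSr ler_piMr ?e_le1.
Qed.

Lemma damped_det_lower :
  (exists i, 0 < S i i /\ l i = 2 * len) \/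
  (exists i j, [/\ i != j, 0 < S i j * S j i, l i = len & l j = len]) ->
  exists c Y0, 0 < c /\ forall y, Y0 <= y ->
    c * expR (- (2 * len * y)) <= 1 - damped_det S l y.
Proof.
move=> attained; have [K [Y0 [K0 Y00 HK]]] := damped_det_expansion.
have [c c0 Hc] : exists2 c, 0 < c & forall y, 0 <= y ->
    c * e y ^+ 2 <= \tr (A y) + pair_sum (A y).
  have tr_ge0 y : 0 <= \tr (A y).
    by apply: sumr_ge0 => i _; rewrite AE mulr_ge0 ?expR_ge0.
  have pair_ge0 y : 0 <= pair_sum (A y).
    by apply: sumr_ge0 => i _; apply: sumr_ge0 => j _; exact: A_pair_ge0.
  case: attained => [[i [Sii li]]|[i [j [ij Sij li lj]]]].
    exists (S i i) => // y y0; rewrite -[leLHS]addr0 lerD //.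
    rewrite /mxtrace (bigD1 i) //= AE li e2 lerDl.
    by apply: sumr_ge0 => j _; rewrite AE mulr_ge0 ?expR_ge0.
  wlog ji : i j ij Sij li lj / (j < i)%N.
    move=> W; have [?|ji|/val_inj] := ltngtP j i; first exact: (W i j).
      by apply: (W j i) => //; [rewrite eq_sym|rewrite mulrC].
    by move=> ji; rewrite ji eqxx in ij.
  exists (S i j * S j i) => // y y0; rewrite -[leLHS]add0r lerD //.
  rewrite /pair_sum (bigD1 i) //= (bigD1 j) //= -addrA.
  have -> : A y i j * A y j i = S i j * S j i * e y ^+ 2.
    by rewrite !AE li lj /e; ring.
  rewrite lerDl addr_ge0 //.
    by apply: sumr_ge0 => k _; exact: A_pair_ge0.
  by apply: sumr_ge0 => h _; apply: sumr_ge0 => k _; exact: A_pair_ge0.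
pose Y1 := 2 * (K + 1) / c / len.
exists (c / 2), (Num.max Y0 Y1); split; first by rewrite divr_gt0.
move=> y; rewrite ge_max => /andP[Y0y Y1y]; have y0 := le_trans Y00 Y0y.
have small : K * e y <= c / 2.
  rewrite /e expRN ler_pdivrMr ?expR_gt0 //.
  apply: le_trans (ler_wpM2l _ (expR_ge1Dx (len * y))); last by rewrite divr_ge0 // ltW.
  move: Y1y; rewrite /Y1 ler_pdivrMr // ler_pdivrMr // => h.
  have : c / 2 * (1 + len * y) = c / 2 + y * len * c / 2 by field.
  lra.
have := HK y Y0y; rewrite ler_distl => /andP[lo _]; have := Hc y y0.
have e20 : 0 <= e y ^+ 2 by rewrite exprn_ge0 // ltW.
have := ler_wpM2r e20 small; rewrite (_ : K * e y * _ = K * e y ^+ 3); last by ring.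
rewrite -e2; lra.
Qed.

End Decay.

Lemma decay_rate_le (R : realType) (D1 D2 : R -> R) (a1 a2 : R) :
  (forall y, 0 < y -> `|D1 y| = `|D2 y|) ->
  (exists c Y0, 0 < c /\ forall y, Y0 <= y -> c * expR (- (a1 * y)) <= 1 - D1 y) ->
  (exists K Y0, forall y, Y0 <= y -> `|1 - D1 y| <= K * expR (- (a1 * y))) ->
  (exists K Y0, forall y, Y0 <= y -> `|1 - D2 y| <= K * expR (- (a2 * y))) ->
  0 < a1 -> a2 <= a1.
Proof.
move=> D12 [c [Y0 [c0 lo]]] [K1 [Y1 up1]] [K2 [Y2 up2]] a10.
rewrite leNgt; apply/negP => a12; move: (c0); rewrite ltNge => /negP; apply.
have small (K a y : R) : 0 < a -> 0 < y -> K * expR (- (a * y)) <= `|K| / a / y.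
  move=> a0 y0; rewrite expRN -mulrA -invfM.
  apply: (@le_trans _ _ (`|K| / expR (a * y))).
    by rewrite ler_wpM2r ?invr_ge0 ?expR_ge0 // ler_norm.
  rewrite ler_wpM2l // lef_pV2 ?posrE ?expR_gt0 ?mulr_gt0 //.
  by apply: le_trans (expR_ge1Dx _); rewrite lerDr.
have pos (K a y : R) : 0 < a -> 0 < y -> 2 * `|K| / a <= y ->
    K * expR (- (a * y)) < 1.
  move=> a0 y0 Ky; apply: le_lt_trans (small K a y a0 y0) _.
  rewrite ltr_pdivrMr // mul1r; move: Ky; rewrite -mulrA.
  have : 0 <= `|K| / a by rewrite divr_ge0 // ltW.
  lra.
pose Y := Num.max (Num.max Y0 Y1) (Num.max Y2 (Num.max (2 * `|K1| / a1) (2 * `|K2| / a2))).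
have a20 := lt_trans a10 a12.
apply: (@le0_of_le_div R c (`|K2| / (a2 - a1)) Y) => y.
rewrite !ge_max => /andP[/andP[y0 y1] /and3P[y2 y3 y4]] yp.
apply: le_trans (small K2 _ y _ yp); last by rewrite subr_gt0.
have d1 : 0 < D1 y.
  have := pos K1 _ _ a10 yp y3; have := up1 y y1.
  by have := ler_norm (1 - D1 y); lra.
have d2 : 0 < D2 y.
  have := pos K2 _ _ a20 yp y4; have := up2 y y2.
  by have := ler_norm (1 - D2 y); lra.
have D1E : D1 y = D2 y by have := D12 y yp; rewrite !gtr0_norm.
rewrite -(ler_pM2r (expR_gt0 (- (a1 * y)))).
apply: le_trans (lo y y0) _; rewrite D1E (le_trans (ler_norm _)) //.
apply: le_trans (up2 y y2) _; rewrite -mulrA -expRD.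
by rewrite (_ : - (a2 * y) = - ((a2 - a1) * y) - a1 * y) //; ring.
Qed.

(** * Bond scattering of a quantum graph *)
Section BondMatrices.
Variables (R : realType) (G : quantum_graph R).

(* A bond is an edge with a direction; [true] means from [gtgt] to [gsrc]. *)
Local Notation bond := (edge G * bool)%type.
Local Notation n := #|{: bond}|.
Implicit Types (a b c : bond) (e : edge G) (v : vert G).

Definition rev_bond b : bond := (b.1, ~~ b.2).
Definition origin b : vert G := if b.2 then gtgt b.1 else gsrc b.1.
Definition bond_length (i : 'I_n) : R := qlen (enum_val i).1.

Lemma rev_bondK b : rev_bond (rev_bond b) = b.
Proof. by case: b => e s; rewrite /rev_bond /= negbK. Qed.

Lemma bond_length_gt0 i : 0 < bond_length i.
Proof. exact: qlen_gt0. Qed.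

Lemma sum_bond (V : nmodType) (F : bond -> V) :
  \sum_b F b = \sum_e (F (e, false) + F (e, true)).
Proof.
transitivity (\sum_(p : bond) F (p.1, p.2)); first by apply: eq_bigr => -[].
rewrite -(pair_bigA _ (fun e s => F (e, s))) /=.
by apply: eq_bigr => e _; rewrite big_bool addrC.
Qed.

Lemma sum_enum_val (V : nmodType) (F : bond -> V) :
  \sum_(i < n) F (enum_val i) = \sum_b F b.
Proof. by rewrite -big_enum_val. Qed.

Lemma degree_gt0 v : (0 < degree v)%N.
Proof. by rewrite lt0n; apply/eqP; exact: qgraph_no_isolated. Qed.

Lemma sum_same_origin (K : fieldType) v : \sum_(b | origin b == v) 1 = (degree v)%:R :> K.
Proof.
have side (g : edge G -> vert G) :
    \sum_e (if g e == v then 1 else 0) = #|[set e | g e == v]%SET|%:R :> K.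
  rewrite -sum1_card natr_sum [RHS]big_mkcond; apply: eq_bigr => e _.
  by rewrite inE.
by rewrite big_mkcond sum_bond big_split /= /degree natrD -!side.
Qed.

Section Matrices.
Variable K : fieldType.

Definition bond_mx (f : bond -> bond -> K) : 'M[K]_n :=
  \matrix_(i, j) f (enum_val i) (enum_val j).

Lemma bond_mxM f g : bond_mx f *m bond_mx g = bond_mx (fun a b => \sum_c f a c * g c b).
Proof.
apply/matrixP => i j; rewrite !mxE -sum_enum_val.
by apply: eq_bigr => k _; rewrite !mxE.
Qed.

Lemma bond_mx1 : 1%:M = bond_mx (fun a b => (a == b)%:R).
Proof. by apply/matrixP => i j; rewrite !mxE (inj_eq enum_val_inj). Qed.

Lemma eq_bond_mx f g : f =2 g -> bond_mx f = bond_mx g.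
Proof. by move=> fg; apply/matrixP => i j; rewrite !mxE fg. Qed.

(** Block diagonal matrices, with one [2 x 2] block for each edge. *)
Definition block (f : edge G -> bool -> bool -> K) : 'M[K]_n :=
  bond_mx (fun a b => if a.1 == b.1 then f a.1 a.2 b.2 else 0).

Lemma eq_block f g : (forall e s t, f e s t = g e s t) -> block f = block g.
Proof. by move=> fg; apply: eq_bond_mx => a b; rewrite fg. Qed.

Lemma blockM f g : block f *m block g =
  block (fun e s t => f e s false * g e false t + f e s true * g e true t).
Proof.
rewrite /block bond_mxM; apply: eq_bond_mx => -[e s] [e' t] /=.
rewrite sum_bond (bigD1 e) //= eqxx [X in _ + X]big1 ?addr0; last first.
  by move=> h he; rewrite eq_sym (negPf he) !mul0r addr0.
by case: eqP => // _; rewrite !mulr0 addr0.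
Qed.

Lemma block1 : 1%:M = block (fun e s t => (s == t)%:R).
Proof.
rewrite bond_mx1; apply: eq_bond_mx => -[e s] [e' t] /=.
by rewrite xpair_eqE; case: eqP.
Qed.

Lemma blockD f g : block f + block g = block (fun e s t => f e s t + g e s t).
Proof. by apply/matrixP => i j; rewrite !mxE; case: ifP; rewrite ?addr0. Qed.

Lemma blockN f : - block f = block (fun e s t => - f e s t).
Proof. by apply/matrixP => i j; rewrite !mxE; case: ifP; rewrite ?oppr0. Qed.

Lemma blockZ x f : x *: block f = block (fun e s t => x * f e s t).
Proof. by apply/matrixP => i j; rewrite !mxE; case: ifP; rewrite ?mulr0. Qed.

Definition reversal : 'M[K]_n := block (fun e s t => (s != t)%:R).

(** The orthogonal projection onto the functions of the origin. *)
Definition averaging : 'M[K]_n :=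
  bond_mx (fun a b => if origin a == origin b then (degree (origin a))%:R^-1 else 0).

(** The Kirchhoff conditions at a vertex make the sum [v + w] of the outgoing and
    the incoming amplitudes constant there and the sum over the bonds of [v - w]
    zero, that is, [v = (2 * averaging - 1) w]; the reversal turns the amplitude
    arriving along a bond into the one incoming on its reverse. *)
Definition bond_scattering : 'M[K]_n := (2 *: averaging - 1%:M) *m reversal.

Lemma reversalK : reversal *m reversal = 1%:M.
Proof.
rewrite blockM block1; apply: eq_block => e [] [] /=;
  by rewrite ?mulr0 ?mul0r ?mulr1 ?addr0 ?add0r.
Qed.

Lemma tr_reversal : reversal^T = reversal.
Proof.
apply/matrixP => i j; rewrite !mxE [(enum_val j).1 == _]eq_sym.
by rewrite [(enum_val j).2 == _]eq_sym.
Qed.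

Lemma tr_averaging : averaging^T = averaging.
Proof. by apply/matrixP => i j; rewrite !mxE eq_sym; case: eqP => // ->. Qed.

Lemma bond_scatteringE i j : bond_scattering i j =
  (if origin (enum_val i) == origin (rev_bond (enum_val j))
   then 2 / (degree (origin (enum_val i)))%:R else 0)
  - (enum_val i == rev_bond (enum_val j))%:R.
Proof.
have E : 2 *: averaging - 1%:M = bond_mx (fun a b =>
    (if origin a == origin b then 2 / (degree (origin a))%:R else 0) - (a == b)%:R).
  rewrite bond_mx1; apply/matrixP => h k; rewrite !mxE; case: ifP => //.
  by rewrite mulr0.
rewrite /bond_scattering E /reversal /block bond_mxM mxE.
set a := enum_val i; set b := enum_val j.
rewrite (bigD1 (rev_bond b)) //= eqxx [X in _ + X]big1 ?addr0.
  by case: b => e [] /=; rewrite mulr1.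
move=> [e s]; rewrite /rev_bond xpair_eqE; case: b => e' t /=.
by case: eqP => [_|_ _]; rewrite ?mulr0 //=; case: s; case: t => //=; rewrite mulr0.
Qed.

End Matrices.

Section Real.
Local Notation S := (bond_scattering R).
Local Notation P := (averaging R).

Lemma averagingK : P *m P = P.
Proof.
rewrite /averaging bond_mxM; apply: eq_bond_mx => a b.
transitivity (\sum_(c | origin c == origin a)
    (degree (origin a))%:R^-1 * (if origin a == origin b then (degree (origin a))%:R^-1 else 0) : R).
  rewrite [RHS]big_mkcond; apply: eq_bigr => c _.
  rewrite [origin a == origin c]eq_sym.
  by case: (origin c =P origin a) => [->|_]; rewrite ?mul0r.
case: eqP => _; last by rewrite big1 // => c _; rewrite mulr0.
have d0 : (degree (origin a))%:R != 0 :> R by rewrite pnatr_eq0 -lt0n degree_gt0.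
rewrite -[X in \sum_(_ | _) X]mulr1 -mulr_sumr sum_same_origin.
by rewrite mulfVK.
Qed.

Lemma reflection_involutive : (2 *: P - 1%:M) *m (2 *: P - 1%:M) = 1%:M.
Proof.
rewrite mulmxBr mulmx1 mulmxBl mul1mx -scalemxAl -scalemxAr averagingK.
by apply/matrixP => i j; rewrite !mxE; ring.
Qed.

(** A reflection times an involution. *)
Lemma bond_scattering_orthogonal : S^T *m S = 1%:M.
Proof.
rewrite /bond_scattering trmx_mul tr_reversal linearB /= linearZ /= tr_averaging trmx1.
by rewrite -mulmxA (mulmxA (_ - _)) reflection_involutive mul1mx reversalK.
Qed.

Lemma degree_ge3 v : leafless G -> (3 <= degree v)%N.
Proof.
move=> /(_ v); have := @qgraph_no_isolated _ G v; have := @qgraph_no_deg2 _ G v.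
by case: (degree v) => [|[|[|]]].
Qed.

(** This is where leaflessness enters: at a leaf the amplitude would be [1]. *)
Lemma backscattering_lt0 v : leafless G -> 2 / (degree v)%:R - 1 < 0 :> R.
Proof.
move=> /(degree_ge3 v) d3.
by rewrite subr_lt0 ltr_pdivrMr ?ltr0n ?degree_gt0 // mul1r ltr_nat.
Qed.

Lemma scattering_diag i :
  S i i = if is_loop (enum_val i).1 then 2 / (degree (origin (enum_val i)))%:R else 0.
Proof.
rewrite bond_scatteringE /is_loop /origin /rev_bond; case: (enum_val i) => e s /=.
rewrite (_ : ((e, s) == (e, ~~ s)) = false) ?subr0; last first.
  by rewrite xpair_eqE eqxx; case: s.
by case: s => //=; rewrite eq_sym.
Qed.

Lemma scattering_diag_ge0 i : 0 <= S i i.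
Proof. by rewrite scattering_diag; case: ifP => // _; rewrite divr_ge0. Qed.

(** For a bond and its reverse this is a product of two backscattering amplitudes,
    both negative; otherwise only transmission occurs. *)
Lemma scattering_pair_ge0 i j : leafless G -> 0 <= S i j * S j i.
Proof.
move=> lG; rewrite !bond_scatteringE.
set a := enum_val i; set b := enum_val j.
have [->|ab] := eqVneq a (rev_bond b).
  rewrite rev_bondK !eqxx mulr_le0 // ltW //; exact: backscattering_lt0.
have ba : b == rev_bond a = false.
  by apply: contraNF ab => /eqP ->; rewrite rev_bondK.
rewrite ba !subr0; apply: mulr_ge0; case: ifP => // _; exact: divr_ge0.
Qed.

Lemma shortest_le i : shortest_edge_length G <= bond_length i.
Proof.
have [_ /(_ (enum_val i).1)] := shortest_edge_lengthP G.
rewrite /edge_length /bond_length => h; apply: le_trans h _; case: ifP => // _.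
by rewrite ler_pdivrMr // ler_pMr ?ler1n // qlen_gt0.
Qed.

Lemma shortest_gt0 : 0 < shortest_edge_length G.
Proof.
have [[e ->] _] := shortest_edge_lengthP G; rewrite /edge_length.
by case: ifP => _; rewrite ?divr_gt0 ?qlen_gt0.
Qed.

Lemma shortest_loop_le i : S i i != 0 -> 2 * shortest_edge_length G <= bond_length i.
Proof.
rewrite scattering_diag; case: ifP => [lo _|]; last by rewrite eqxx.
have [_ /(_ (enum_val i).1)] := shortest_edge_lengthP G.
by rewrite /edge_length lo ler_pdivlMr // mulrC.
Qed.

(** A shortest loop contributes through one bond, of twice the shortest length, and
    any other shortest edge through its two bonds. *)
Lemma shortest_attained : leafless G ->
  (exists i, 0 < S i i /\ bond_length i = 2 * shortest_edge_length G) \/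
  (exists i j, [/\ i != j, 0 < S i j * S j i,
     bond_length i = shortest_edge_length G & bond_length j = shortest_edge_length G]).
Proof.
move=> lG; have [[e ->] _] := shortest_edge_lengthP G.
rewrite /edge_length; case: ifP => lo; [left|right].
  exists (enum_rank (e, false)); rewrite scattering_diag /bond_length enum_rankK lo.
  split; last by rewrite mulrC divfK.
  by rewrite divr_gt0 // ltr0n degree_gt0.
exists (enum_rank (e, false)), (enum_rank (e, true)).
rewrite /bond_length !enum_rankK; split=> //.
  by rewrite (inj_eq enum_rank_inj) xpair_eqE andbF.
rewrite !bond_scatteringE !enum_rankK /rev_bond /= !eqxx.
by rewrite nmulr_lgt0; exact: backscattering_lt0.
Qed.

End Real.
End BondMatrices.

(** * Eigenfunctions on one edge *)
Section EdgeEquation.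
Variable R : realType.
Implicit Types (f g : R -> R) (k l a b x : R).
Local Notation mu := (@lebesgue_measure R).

Definition wave k a b x : R := a * cos (k * x) + b * sin (k * x).
(** The derivative of a wave, divided by [k]. *)
Definition dwave k a b x : R := b * cos (k * x) - a * sin (k * x).

Lemma is_derive_cosM k x : is_derive x 1 (fun t => cos (k * t)) (- k * sin (k * x)).
Proof. by apply: is_derive_eq; rewrite /GRing.scale /=; ring. Qed.

Lemma is_derive_sinM k x : is_derive x 1 (fun t => sin (k * t)) (k * cos (k * x)).
Proof. by apply: is_derive_eq; rewrite /GRing.scale /=; ring. Qed.

Lemma is_derive_wave k a b x : is_derive x 1 (wave k a b) (k * dwave k a b x).
Proof.
have ? := is_derive_cosM k x; have ? := is_derive_sinM k x.
by apply: is_derive_eq; rewrite /dwave /GRing.scale /=; ring.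
Qed.

Lemma is_derive_dwave k a b x :
  is_derive x 1 (dwave k a b) (- (k * wave k a b x)).
Proof.
have ? := is_derive_cosM k x; have ? := is_derive_sinM k x.
by apply: is_derive_eq; rewrite /wave /GRing.scale /=; ring.
Qed.

Lemma is_derive_continuous f df : (forall x, is_derive x 1 f (df x)) -> continuous f.
Proof.
move=> fd x; have [? _] := fd x.
by apply: differentiable_continuous; exact/derivable1_diffP.
Qed.

Lemma continuous_wave k a b : continuous (wave k a b).
Proof. exact: is_derive_continuous (is_derive_wave k a b). Qed.

Lemma continuous_dwave k a b : continuous (dwave k a b).
Proof. exact: is_derive_continuous (is_derive_dwave k a b). Qed.

Lemma within_continuous_interior f l x : {within `[0, l], continuous f} ->
  0 < x < l -> {for x, continuous f}.
Proof.
move=> cf /andP[x0 xl]; have /(continuous_within_itvP _ (lt_trans x0 xl))[+ _ _] := cf.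
by apply; rewrite in_itv /= x0.
Qed.

Lemma constant_of_derive0 f l : {within `[0, l], continuous f} ->
  (forall x, 0 < x < l -> is_derive x 1 f 0) -> forall x, 0 <= x <= l -> f x = f 0.
Proof.
move=> cf df x /andP[x0 xl].
have sub : `[0, x] `<=` `[0, l] by apply: subset_itvl; rewrite bnd_simp.
have dfx : forall t, t \in `]0, x[ -> is_derive t 1 f ((fun=> 0) t : R).
  by move=> t; rewrite in_itv /= => /andP[? ?]; apply: df; apply/andP; split=> //; exact: lt_le_trans xl.
have [c _] := MVT_segment x0 dfx (continuous_subspaceW sub cf).
by rewrite mul0r => /eqP; rewrite subr_eq0 => /eqP.
Qed.

(** Energy conservation in disguise: rotating [(f, f1 / k)] by the angle [k x]
    gives a constant vector. *)
Lemma wave_unique f f1 k l : k != 0 -> {within `[0, l], continuous f} ->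
  {within `[0, l], continuous f1} ->
  (forall x, 0 < x < l -> is_derive x 1 f (f1 x)) ->
  (forall x, 0 < x < l -> is_derive x 1 f1 (- k ^+ 2 * f x)) ->
  forall x, 0 <= x <= l ->
    f x = wave k (f 0) (f1 0 / k) x /\ f1 x = k * dwave k (f 0) (f1 0 / k) x.
Proof.
move=> k0 cf cf1 df df1 x xl.
have cc : {within `[0, l], continuous (fun t => cos (k * t))}.
  exact/continuous_subspaceT/(is_derive_continuous (is_derive_cosM k)).
have cs : {within `[0, l], continuous (fun t => sin (k * t))}.
  exact/continuous_subspaceT/(is_derive_continuous (is_derive_sinM k)).
pose A t := f t * cos (k * t) - k^-1 * (f1 t * sin (k * t)).
pose B t := f t * sin (k * t) + k^-1 * (f1 t * cos (k * t)).
have cA : {within `[0, l], continuous A}.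
  move=> t; apply: cvgB; first by apply: cvgM; [exact: cf|exact: cc].
  by apply: cvgM; [exact: cvg_cst|apply: cvgM; [exact: cf1|exact: cs]].
have cB : {within `[0, l], continuous B}.
  move=> t; apply: cvgD; first by apply: cvgM; [exact: cf|exact: cs].
  by apply: cvgM; [exact: cvg_cst|apply: cvgM; [exact: cf1|exact: cc]].
have AE : A x = f 0.
  rewrite (constant_of_derive0 cA _ xl) => [|t tl].
    by rewrite /A mulr0 cos0 sin0 !mulr0 subr0 mulr1.
  have ? := df t tl; have ? := df1 t tl.
  have ? := is_derive_cosM k t; have ? := is_derive_sinM k t.
  by apply: is_derive_eq; rewrite /GRing.scale /=; field.
have BE : B x = f1 0 / k.
  rewrite (constant_of_derive0 cB _ xl) => [|t tl].
    by rewrite /B mulr0 cos0 sin0 !mulr0 add0r mulr1 mulrC.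
  have ? := df t tl; have ? := df1 t tl.
  have ? := is_derive_cosM k t; have ? := is_derive_sinM k t.
  by apply: is_derive_eq; rewrite /GRing.scale /=; field.
have cs1 := cos2Dsin2 (k * x); rewrite -AE -BE /wave /dwave /A /B; split.
  transitivity (f x * (cos (k * x) ^+ 2 + sin (k * x) ^+ 2)); last by ring.
  by rewrite cs1 mulr1.
transitivity (f1 x * (cos (k * x) ^+ 2 + sin (k * x) ^+ 2)); last by field.
by rewrite cs1 mulr1.
Qed.

Let itv0_sub x l : x <= l -> `[0, x] `<=` `[0, l].
Proof. by move=> xl; apply: subset_itvl; rewrite bnd_simp. Qed.

Let integrable_sub g x l : x <= l ->
  mu.-integrable `[0, l] (EFin \o g) -> mu.-integrable `[0, x] (EFin \o g).
Proof. by move=> xl; apply: integrableS => //; exact: itv0_sub. Qed.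

Lemma primitive_derive g l x : 0 < x < l ->
  mu.-integrable `[0, l] (EFin \o g) -> {for x, continuous g} ->
  is_derive x 1 (fun y => \int[mu]_(t in `[0, y]) g t)%R (g x).
Proof.
move=> /andP[x0 xl] ig cg.
have [d +] := continuous_FTC1_closed xl ig x0 cg.
by rewrite derive1E => dE; exact: DeriveDef d dE.
Qed.

Lemma primitive_continuous g l : 0 <= l -> mu.-integrable `[0, l] (EFin \o g) ->
  {within `[0, l], continuous (fun y => \int[mu]_(t in `[0, y]) g t)%R}.
Proof. exact: parameterized_integral_continuous. Qed.

Lemma continuous_integrable g l : {within `[0, l], continuous g} ->
  mu.-integrable `[0, l] (EFin \o g).
Proof. by move=> cg; apply: continuous_compact_integrable => //; exact: segment_compact. Qed.

(** Replacing [f1] and [f] by iterated primitives of the continuous function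
    [- k^2 f], to which [f2] is equal almost everywhere, gives honest
    derivatives. *)
Lemma eigen_edge f f1 f2 k l : 0 < l -> k != 0 ->
  {within `[0, l], continuous f} -> weak_deriv l f f1 -> weak_deriv l f1 f2 ->
  {ae mu, forall x, x \in `[0, l] -> k ^+ 2 * f x = - f2 x} ->
  forall x, 0 <= x <= l ->
    f x = wave k (f 0) (f1 0 / k) x /\ f1 x = k * dwave k (f 0) (f1 0 / k) x.
Proof.
move=> l0 k0 cf [if1 fE] [if2 f1E] ff2.
have if0 := continuous_integrable cf.
pose F1 x := f1 0 - k ^+ 2 * (\int[mu]_(t in `[0, x]) f t)%R.
pose F x := f 0 + (\int[mu]_(t in `[0, x]) F1 t)%R.
have f1F1 x : 0 <= x <= l -> f1 x = F1 x.
  move=> xl; rewrite f1E ?in_itv //; congr (_ + _).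
  have /andP[x0 x1] := xl.
  rewrite -mulNr -RintegralZl //; last exact: integrable_sub if0.
  congr fine; apply: ae_eq_integral => //.
  - by case/integrableP: (integrable_sub x1 if2).
  - have := integrableZl _ (- k ^+ 2) (integrable_sub x1 if0).
    by move=> /(_ (measurable_itv _))/integrableP[].
  apply: (@filterS _ _ (ae_filter_ringOfSetsType mu) _ _ _ ff2) => t h; rewrite /= in_itv /= => /andP[t0 tx].
  by rewrite -[f2 t]opprK -h ?mulNr // in_itv /= t0 (le_trans tx).
have cF1 : {within `[0, l], continuous F1}.
  move=> t; apply: cvgB; first exact: cvg_cst.
  by apply: cvgM; [exact: cvg_cst|exact: primitive_continuous (ltW l0) if0 t].
have iF1 := continuous_integrable cF1.
have fF x : 0 <= x <= l -> f x = F x.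
  move=> xl; rewrite fE ?in_itv //; congr (_ + _).
  apply: eq_Rintegral => t; rewrite inE /= in_itv /= => /andP[t0 tx].
  by rewrite f1F1 // t0 (le_trans tx) //; case/andP: xl.
have cF : {within `[0, l], continuous F}.
  move=> t; apply: cvgD; first exact: cvg_cst.
  exact: primitive_continuous (ltW l0) iF1 t.
have l00 : (0 : R) <= 0 <= l by rewrite (ltW l0) andbT.
move=> x xl; rewrite !(fF x, fF 0, f1F1 x, f1F1 0) //.
apply: (wave_unique k0 cF cF1 _ _ xl) => t tl.
- have /(primitive_derive tl iF1) ? := within_continuous_interior cF1 tl.
  by rewrite /F; apply: is_derive_eq; rewrite add0r mul1r.
- have /(primitive_derive tl if0) ? := within_continuous_interior cf tl.
  have tl' : 0 <= t <= l by case/andP: tl => ? ?; rewrite !ltW.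
  by rewrite /F1 -fF //; apply: is_derive_eq; rewrite /GRing.scale /=; ring.
Qed.

Lemma continuous_L2 g l : {within `[0, l], continuous g} -> L2 l g.
Proof.
move=> cg; rewrite /L2 inE; apply/andP; split; rewrite inE /=.
  apply/measurable_restrict => //.
  by rewrite setTI; case/integrableP: (continuous_integrable cg) => /measurable_EFinP.
rewrite /finite_norm unlock; apply: poweR_lty.
apply: (@le_lt_trans _ _ (\int[mu]_(x in `[0%R, l]) (g x ^+ 2)%:E)%E).
  rewrite [leRHS]integral_mkcond le_eqVlt; apply/orP; left; apply/eqP.
  apply: eq_integral => x _; rewrite /= /patch; case: ifP => _ /=.
    by rewrite powR_mulrn // real_normK ?num_real.
  by rewrite normr0 powR0.
have : mu.-integrable `[0, l] (EFin \o (fun x => g x ^+ 2)).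
  apply: continuous_integrable.
  have -> : (fun x => g x ^+ 2) = (fun x => g x * g x) by apply: boolp.funext.
  by move=> t; apply: cvgM; exact: cg.
move=> /integrableP[_]; apply: le_lt_trans; rewrite le_eqVlt; apply/orP; left.
by apply/eqP; apply: eq_integral => x _; rewrite /= ger0_norm // sqr_ge0.
Qed.

Lemma derive_weak_deriv F g l : 0 < l -> (forall x, is_derive x 1 F (g x)) ->
  continuous g -> weak_deriv l F g.
Proof.
move=> l0 dF cg; split; first exact/continuous_integrable/continuous_subspaceT.
move=> x; rewrite in_itv /= => /andP[x0 xl].
have [->|xn0] := eqVneq x 0; first by rewrite set_itv1 Rintegral_set1 addr0.
have xp : 0 < x by rewrite lt_neqAle eq_sym xn0.
have cF := is_derive_continuous dF.
rewrite /Rintegral (@continuous_FTC2 _ g F) ?subrKC //=.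
- exact: continuous_subspaceT.
- split; first by move=> t _; have [] := dF t.
  + exact/cvg_at_right_filter/cF.
  + exact/cvg_at_left_filter/cF.
- by move=> t _; rewrite derive1E; have [_ ->] := dF t.
Qed.

Lemma wave_sobolev k a b l : 0 < l ->
  sobolev2 l (wave k a b) (fun x => k * dwave k a b x) (fun x => - (k ^+ 2 * wave k a b x)).
Proof.
move=> l0.
have cw := @continuous_wave k a b; have cd := @continuous_dwave k a b.
have ckd : continuous (fun x => k * dwave k a b x).
  by move=> x; apply: cvgM; [exact: cvg_cst|exact: cd].
have ckw : continuous (fun x => - (k ^+ 2 * wave k a b x)).
  by move=> x; apply: cvgN; apply: cvgM; [exact: cvg_cst|exact: cw].
split; try exact/continuous_L2/continuous_subspaceT.
- exact: derive_weak_deriv (is_derive_wave k a b) ckd.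
- apply: derive_weak_deriv ckw => // x; have ? := is_derive_dwave k a b x.
  by apply: is_derive_eq; rewrite /GRing.scale /=; ring.
Qed.

Lemma wave_eq0 k a b l : k != 0 -> 0 < l ->
  (forall x, x \in `[0, l] -> wave k a b x = 0) -> a = 0 /\ b = 0.
Proof.
move=> k0 l0 w0.
have a0 : a = 0.
  have := w0 0; rewrite in_itv /= lexx ltW // => /(_ isT).
  by rewrite /wave mulr0 cos0 sin0 mulr1 mulr0 addr0.
split=> //.
pose x := Num.min l `|k|^-1.
have x0 : 0 < x by rewrite lt_min l0 invr_gt0 normr_gt0.
have := w0 x; rewrite in_itv /= (ltW x0) ge_min lexx => /(_ isT).
rewrite /wave a0 mul0r add0r => /eqP; rewrite mulf_eq0 => /orP[/eqP //|].
have kx1 : `|k| * x <= 1.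
  by rewrite -ler_pdivlMl ?normr_gt0 // mulr1 ge_min lexx orbT.
have s0 : 0 < sin (`|k| * x).
  apply: sin_gt0_pi; rewrite mulr_gt0 ?normr_gt0 //=.
  by apply: le_lt_trans kx1 _; apply: lt_le_trans (pi_ge2 R); rewrite ltr1n.
case: (ltrgtP k 0) k0 => // kk _ /eqP s; move: s0.
- by rewrite ltr0_norm // mulNr sinN s oppr0 ltxx.
- by rewrite gtr0_norm // s ltxx.
Qed.

End EdgeEquation.

(** * Vertex conditions and the secular matrix *)
Section Matching.
Variables (R : realType) (G : quantum_graph R) (k : R).
Hypothesis k0 : k != 0.
Local Notation C := (R[i]).
Local Notation bond := (edge G * bool)%type.
Local Notation n := #|{: bond}|.
Implicit Types (e : edge G) (v : vert G) (b : bond).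

(** Row [(e, s)] of these blocks gives, in terms of the coefficients of a wave,
    its value and its inward derivative divided by [k] at the end [s] of [e]. *)
Definition end_value e (s t : bool) : R :=
  if s then (if t then sin (k * qlen e) else cos (k * qlen e)) else (~~ t)%:R.
Definition end_slope e (s t : bool) : R :=
  if s then (if t then - cos (k * qlen e) else sin (k * qlen e)) else t%:R.

Local Notation P := (averaging G).
Local Notation V := (block end_value).
Local Notation D := (block end_slope).

(** The vertex conditions: values have no component orthogonal to the
    functions of the origin, slopes have zero average. *)
Definition vertex_conditions : 'M[R]_n := (1%:M - P R) *m V + P R *m D.

Lemma map_block (f : edge G -> bool -> bool -> R) :
  map_mx (@rc R) (block f) = block (fun e s t => rc (f e s t)).
Proof. by apply/matrixP => i j; rewrite !mxE; case: ifP; rewrite ?rmorph0. Qed.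

Lemma map_averaging : map_mx (@rc R) (P R) = P C.
Proof.
apply/matrixP => i j; rewrite !mxE; case: ifP; rewrite ?rmorph0 //.
by rewrite fmorphV rmorph_nat.
Qed.

Lemma map_reversal : map_mx (@rc R) (reversal G R) = reversal G C.
Proof. by rewrite map_block; apply: eq_block => e s t; rewrite rmorph_nat. Qed.

Let ph e : C := rc (cos (k * qlen e)) + ci * rc (sin (k * qlen e)).

Lemma phase_mx_block :
  phase_mx (@bond_length R G) (rc k) = block (fun e s t => if s == t then ph e else 0).
Proof.
apply/matrixP => i j; rewrite !mxE /phase.
have -> : cexp (ci * rc (bond_length i) * rc k) = ph (enum_val i).1.
  rewrite -mulrA -rcM cexp_ci mulrC /ph.
  by apply: complex_eqP; rewrite !ReImE /=; ring.
rewrite -(inj_eq enum_val_inj); case: (enum_val i) => e s; case: (enum_val j) => e' t /=.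
by rewrite xpair_eqE; case: (e == e'); case: (s == t).
Qed.

Let VC := map_mx (@rc R) V.
Let DC := map_mx (@rc R) D.
(* Value minus [i] times slope, halved: the outgoing amplitudes of a wave. *)
Let T : 'M[C]_n := 2^-1 *: (VC - ci *: DC).

Let sin_sqr e : rc (sin (k * qlen e)) ^+ 2 = 1 - rc (cos (k * qlen e)) ^+ 2 :> C.
Proof.
have := congr1 (@rc R) (cos2Dsin2 (k * qlen e)).
by rewrite rcD !rmorphXn rmorph1 => <-; rewrite addrC addKr.
Qed.

Let ci_sqr : ci ^+ 2 = -1 :> C.
Proof. by apply: complex_eqP; rewrite expr2 !ReImE /=; ring. Qed.

Let propagate : reversal G C *m phase_mx (@bond_length R G) (rc k) *m T =
  2^-1 *: (VC + ci *: DC).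
Proof.
rewrite /T /VC /DC phase_mx_block !map_block /reversal !blockZ blockN !blockD !blockZ !blockM.
apply: eq_block => e [] [] /=; rewrite /ph ?rcN ?rc1 ?rc0;
  move: (sin_sqr e); move: (rc (cos _)) (rc (sin _)) => c s cs;
  by field: ci_sqr cs.
Qed.

Let T_unit : T \in unitmx.
Proof.
pose W : 'M[C]_n := block (fun e s t =>
  if s then (if t then - ci * ph e else ci) else (if t then ph e else 1)).
suff WT : W *m T = 1%:M by case/mulmx1_unit: WT.
rewrite /T /VC /DC !map_block blockZ blockN blockD blockZ blockM block1.
apply: eq_block => e [] [] /=; rewrite /ph ?rcN ?rc1 ?rc0;
  move: (sin_sqr e); move: (rc (cos _)) (rc (sin _)) => c s cs;
  by field: ci_sqr cs.
Qed.

Let Q : 'M[C]_n := 1%:M - P C - ci *: P C.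

Let averagingKC : P C *m P C = P C.
Proof. by rewrite -map_averaging -map_mxM averagingK. Qed.

Let cii : ci * ci = -1 :> C.
Proof. by apply: complex_eqP; rewrite !ReImE /=; ring. Qed.

Let Q_unit : Q \in unitmx.
Proof.
suff: Q *m (1%:M - P C + ci *: P C) = 1%:M by case/mulmx1_unit.
rewrite /Q mulmxBl mulmxDr mulmxBr mulmx1 mulmxBl mul1mx averagingKC subrr subr0.
rewrite -!scalemxAl -!scalemxAr mulmxDr mulmxBr mulmx1 averagingKC subrr add0r.
rewrite mulmxBl mul1mx averagingKC subrr scaler0 addr0 -scalemxAr averagingKC.
by rewrite !scalerA cii scaleN1r opprK subrK.
Qed.

(** With [c] the values and [d] the slopes, [v = (c - i d) / 2] is outgoing and
    [w = (c + i d) / 2] incoming, and [v - (2 P - 1) w = (1 - P) c - i P d] is,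
    up to the invertible factor [Q], the real vertex condition. *)
Lemma secular_vertex_conditions :
  secular_mx (bond_scattering G R) (@bond_length R G) (rc k) *m T =
  Q *m map_mx (@rc R) vertex_conditions.
Proof.
have -> : map_mx (@rc R) vertex_conditions = (1%:M - P C) *m VC + P C *m DC.
  by rewrite /vertex_conditions map_mxD !map_mxM map_mxB map_mx1 map_averaging.
rewrite /secular_mx /evolution mulmxBl mul1mx.
have -> : map_mx (@rc R) (bond_scattering G R) = (2 *: P C - 1%:M) *m reversal G C.
  by rewrite /bond_scattering map_mxM map_mxB map_mxZ rmorph_nat map_mx1
    map_averaging map_reversal.
rewrite -!mulmxA (mulmxA (reversal G C)) propagate /T /Q.
rewrite -scalemxAr mulmxBl mul1mx -scalemxAl.
have -> : P C *m (VC + ci *: DC) = P C *m VC + ci *: (P C *m DC).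
  by rewrite mulmxDr scalemxAr.
rewrite mulmxDr !mulmxBl !mul1mx -!scalemxAl.
rewrite !mulmxBr ?mul1mx !mulmxA averagingKC.
move: (P C *m VC) (P C *m DC) VC DC => pv pd v d.
apply/matrixP => i j; rewrite !mxE.
by move: (pv i j) (pd i j) (v i j) (d i j) => x y z t; field.
Qed.

Lemma kernel_dim_vertex_conditions :
  kernel_dim (bond_scattering G R) (@bond_length R G) (rc k) =
  (n - \rank vertex_conditions)%N.
Proof.
rewrite /kernel_dim; congr (_ - _)%N.
rewrite -(mxrankMfree _ (_ : row_free T)); last by rewrite row_free_unit.
rewrite secular_vertex_conditions (eqmxMfull _ (_ : row_full Q)).
  exact: mxrank_map.
by rewrite row_full_unit.
Qed.

End Matching.

(** * Multiplicities of eigenvalues *)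
Section Multiplicity.
Variables (R : realType) (G : quantum_graph R) (k : R).
Hypothesis k0 : k != 0.
Local Notation bond := (edge G * bool)%type.
Local Notation n := #|{: bond}|.
Implicit Types (e : edge G) (w : vert G) (b : bond) (v : 'cV[R]_n) (f : qfun G).
Local Notation P := (averaging G R).
Local Notation V := (block (end_value k)).
Local Notation D := (block (end_slope k)).
Local Notation N := (vertex_conditions G k).
Local Notation mu := (@lebesgue_measure R).

Definition coef v b : R := v (enum_rank b) 0.
Definition graph_wave v : qfun G := fun e => wave k (coef v (e, false)) (coef v (e, true)).
Definition graph_slope v : qfun G :=
  fun e x => k * dwave k (coef v (e, false)) (coef v (e, true)) x.

Lemma coef_block F v e s :
  coef (block F *m v) (e, s) = F e s false * coef v (e, false) + F e s true * coef v (e, true).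
Proof.
pose h (c : bond) := (if e == c.1 then F e s c.2 else 0) * coef v c.
transitivity (\sum_(j < n) h (enum_val j)).
  rewrite /coef /block mxE; apply: eq_bigr => j _.
  by rewrite mxE enum_rankK /h /coef enum_valK.
rewrite (sum_enum_val h) sum_bond /h (bigD1 e) //= eqxx [X in _ + X]big1 ?addr0 //.
by move=> e' he; rewrite eq_sym (negPf he) !mul0r addr0.
Qed.

Lemma coef_averaging v b : coef (P *m v) b =
  (degree (origin b))%:R^-1 * \sum_(c | origin c == origin b) coef v c.
Proof.
pose h (c : bond) :=
  (if origin b == origin c then (degree (origin b))%:R^-1 else 0) * coef v c.
transitivity (\sum_(j < n) h (enum_val j)).
  rewrite /coef /averaging mxE; apply: eq_bigr => j _.
  by rewrite mxE enum_rankK /h /coef enum_valK.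
rewrite (sum_enum_val h) mulr_sumr [RHS]big_mkcond /h; apply: eq_bigr => c _.
by rewrite eq_sym; case: ifP; rewrite ?mul0r.
Qed.

Lemma coef_inj v v' : coef v =1 coef v' -> v = v'.
Proof. by move=> vv; apply/colP => i; have := vv (enum_val i); rewrite /coef enum_valK. Qed.

Lemma exists_bond w : exists b : bond, origin b = w.
Proof.
case: (pickP (fun b : bond => origin b == w)) => [b /eqP <-|none]; first by exists b.
have := sum_same_origin R w; rewrite big_pred0 // => /esym/eqP.
by rewrite pnatr_eq0 -leqn0 leqNgt degree_gt0.
Qed.

Lemma averaging_fixedP v : P *m v = v <-> exists c, forall b, coef v b = c (origin b).
Proof.
split=> [Pv|[c vc]].
  exists (fun w => (degree w)%:R^-1 * \sum_(b | origin b == w) coef v b) => b.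
  by rewrite -coef_averaging Pv.
apply: coef_inj => b; rewrite coef_averaging vc.
rewrite (eq_bigr (fun=> c (origin b) * 1)); last by move=> a /eqP ab; rewrite vc ab mulr1.
by rewrite -mulr_sumr sum_same_origin mulrCA mulVf ?mulr1 // pnatr_eq0 -lt0n degree_gt0.
Qed.

Lemma averaging_eq0P v : P *m v = 0 <-> forall w, \sum_(b | origin b == w) coef v b = 0.
Proof.
split=> [Pv w|v0].
  have [b <-] := exists_bond w; have := coef_averaging v b.
  rewrite Pv /coef mxE => /esym/eqP; rewrite mulf_eq0 invr_eq0 pnatr_eq0.
  by rewrite eqn0Ngt degree_gt0 => /eqP.
by apply: coef_inj => b; rewrite coef_averaging v0 mulr0 /coef mxE.
Qed.

Lemma vertex_conditionsP v : N *m v = 0 <->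
  (exists c, forall b, coef (V *m v) b = c (origin b)) /\
  (forall w, \sum_(b | origin b == w) coef (D *m v) b = 0).
Proof.
rewrite -averaging_fixedP -averaging_eq0P.
have E : N *m v = V *m v - P *m (V *m v) + P *m (D *m v).
  by rewrite /vertex_conditions !mulmxDl !mulNmx !mul1mx !mulmxA.
rewrite E; split=> [Nv|[-> ->]]; last by rewrite subrr addr0.
have PD : P *m (D *m v) = 0.
  have := congr1 (mulmx P) Nv; rewrite mulmx0 mulmxDr mulmxBr.
  by rewrite !(mulmxA P P) averagingK subrr add0r.
by split=> //; move: Nv; rewrite PD addr0 => /subr0_eq.
Qed.

Lemma coef_value v e s :
  coef (V *m v) (e, s) = graph_wave v e (if s then qlen e else 0).
Proof.
rewrite coef_block /graph_wave /wave; case: s => /=; first by ring.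
by rewrite mulr0 cos0 sin0; ring.
Qed.

Lemma coef_slope v e s : k * coef (D *m v) (e, s) =
  if s then - graph_slope v e (qlen e) else graph_slope v e 0.
Proof.
rewrite coef_block /graph_slope /dwave; case: s => /=; first by ring.
by rewrite mulr0 cos0 sin0; ring.
Qed.

Lemma normal_sum_slope v w :
  normal_sum (graph_slope v) w = - (k * \sum_(b | origin b == w) coef (D *m v) b).
Proof.
rewrite mulr_sumr [X in - X]big_mkcond sum_bond big_split opprD -!sumrN /normal_sum.
congr (_ + _); rewrite [LHS]big_mkcond; apply: eq_bigr => e _; rewrite coef_slope /origin /=.
- by case: ifP; rewrite ?oppr0.
- by case: ifP; rewrite ?oppr0 ?opprK.
Qed.

Lemma continuous_on_graph_wave v : continuous_on_graph (graph_wave v) <->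
  exists c, forall b, coef (V *m v) b = c (origin b).
Proof.
split=> [[_ [c cE]]|[c cE]].
  by exists c => -[e []]; rewrite coef_value /origin /=; have [] := cE e.
split=> [e|]; first exact/continuous_subspaceT/continuous_wave.
exists c => e; split.
- by rewrite -(cE (e, false)) coef_value.
- by rewrite -(cE (e, true)) coef_value.
Qed.

Lemma normal_sum_wave v : (forall w, normal_sum (graph_slope v) w = 0) <->
  forall w, \sum_(b | origin b == w) coef (D *m v) b = 0.
Proof.
split=> H w; last by rewrite normal_sum_slope H mulr0 oppr0.
by have /eqP := H w; rewrite normal_sum_slope oppr_eq0 mulf_eq0 (negPf k0) => /eqP.
Qed.

Lemma graph_wave_eigen v : N *m v = 0 -> in_eigenspace (k ^+ 2) (graph_wave v).
Proof.
move=> /vertex_conditionsP[cont kirch].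
exists (graph_slope v), (fun e x => - (k ^+ 2 * graph_wave v e x)); split.
- by move=> e; exact/wave_sobolev/qlen_gt0.
- exact/continuous_on_graph_wave.
- exact/normal_sum_wave.
- by move=> e; apply: aeW => x _; rewrite opprK.
Qed.

(** The coefficients are read off at the source of each edge. *)
Lemma eigen_graph_wave f : in_eigenspace (k ^+ 2) f ->
  exists v, N *m v = 0 /\ eq_on_graph f (graph_wave v).
Proof.
move=> [f1 [f2 [sob cont kirch ae]]].
have edgeE e x : 0 <= x <= qlen e ->
    f e x = wave k (f e 0) (f1 e 0 / k) x /\ f1 e x = k * dwave k (f e 0) (f1 e 0 / k) x.
  move=> xl; have [_ _ _ w1 w2] := sob e; have [cf _] := cont.
  exact: (eigen_edge (qlen_gt0 e) k0 (cf e) w1 w2 (ae e)).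
pose v : 'cV[R]_n := \col_i (if (enum_val i).2 then f1 (enum_val i).1 0 / k
                             else f (enum_val i).1 0).
have vF e : coef v (e, false) = f e 0 by rewrite /coef mxE enum_rankK.
have vT e : coef v (e, true) = f1 e 0 / k by rewrite /coef mxE enum_rankK.
have l0 e : 0 <= qlen e := ltW (qlen_gt0 e).
exists v; split; last first.
  by move=> e x; rewrite in_itv /= => /edgeE[-> _]; rewrite /graph_wave vF vT.
have f0 e : graph_wave v e 0 = f e 0.
  by rewrite /graph_wave vF vT; have [<-] := @edgeE e 0 (introT andP (conj (lexx 0) (l0 e))).
have fl e : graph_wave v e (qlen e) = f e (qlen e).
  rewrite /graph_wave vF vT.
  by have [<-] := @edgeE e _ (introT andP (conj (l0 e) (lexx _))).
have f10 e : graph_slope v e 0 = f1 e 0.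
  rewrite /graph_slope vF vT.
  by have [_ <-] := @edgeE e 0 (introT andP (conj (lexx 0) (l0 e))).
have f1l e : graph_slope v e (qlen e) = f1 e (qlen e).
  rewrite /graph_slope vF vT.
  by have [_ <-] := @edgeE e _ (introT andP (conj (l0 e) (lexx _))).
apply/vertex_conditionsP; split.
  apply/continuous_on_graph_wave; split=> [e|].
    exact/continuous_subspaceT/continuous_wave.
  by have [_ [c cE]] := cont; exists c => e; rewrite f0 fl.
apply/normal_sum_wave => w; rewrite -[RHS](kirch w) /normal_sum.
by congr (_ + _); apply: eq_bigr => e _; rewrite ?f10 ?f1l.
Qed.

Lemma graph_wave_eq0 v : eq_on_graph (graph_wave v) (fun _ _ => 0) -> v = 0.
Proof.
move=> v0; apply: coef_inj => -[e s]; rewrite [RHS]mxE.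
have [] := wave_eq0 k0 (qlen_gt0 e) (v0 e).
by case: s.
Qed.

Lemma lincomb_graph_wave m (a : 'I_m -> R) (u : 'I_m -> 'cV[R]_n) e x :
  lincomb a (fun i => graph_wave (u i)) e x = graph_wave (\sum_i a i *: u i) e x.
Proof.
rewrite /lincomb /graph_wave /wave /coef !summxE !mulr_suml -big_split /=.
by apply: eq_bigr => i _; rewrite !mxE; ring.
Qed.

(** A basis of the kernel of the vertex conditions is carried to a basis of the
    eigenspace. *)
Lemma has_multiplicity_kernel : has_multiplicity G (k ^+ 2) (n - \rank N)%N.
Proof.
pose K := kermx N^T.
have rK : \rank K = (n - \rank N)%N by rewrite mxrank_ker mxrank_tr.
rewrite -rK; pose u i := (row i (row_base K))^T.
have uE a : \sum_i a i *: u i = ((\row_i a i) *m row_base K)^T.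
  apply: trmx_inj; rewrite trmxK linear_sum mulmx_sum_row.
  by apply: eq_bigr => i _; rewrite linearZ /= trmxK mxE.
exists (fun i => graph_wave (u i)); split.
- move=> i; apply: graph_wave_eigen; apply: trmx_inj; rewrite trmx_mul trmx0 trmxK.
  by apply/sub_kermxP; rewrite (submx_trans (row_sub _ _)) // eq_row_base.
- move=> a a0 i.
  have /graph_wave_eq0 : eq_on_graph (graph_wave (\sum_i a i *: u i)) (fun _ _ => 0).
    by move=> e x xe; rewrite -lincomb_graph_wave a0.
  rewrite uE => /(congr1 trmx); rewrite trmxK trmx0 => aK.
  have : \row_i a i = 0.
    by apply: (row_free_inj (row_base_free K)); rewrite aK mul0mx.
  by move/rowP/(_ i); rewrite !mxE.
- move=> g /eigen_graph_wave[v [Nv gv]].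
  have : (v^T <= row_base K)%MS.
    by rewrite eq_row_base; apply/sub_kermxP; rewrite -trmx_mul Nv trmx0.
  case/submxP => a va; exists (fun i => a 0 i) => e x xe.
  rewrite gv // lincomb_graph_wave uE (_ : \row_i a 0 i = a); last first.
    by apply/rowP => i; rewrite mxE.
  by rewrite -va trmxK.
Qed.

End Multiplicity.

Lemma multiplicity_unique (R : realType) (G : quantum_graph R) (lambda : R) m m' :
  has_multiplicity G lambda m -> has_multiplicity G lambda m' -> m = m'.
Proof.
suff le_size p q : has_multiplicity G lambda p -> has_multiplicity G lambda q -> (p <= q)%N.
  by move=> Hm Hm'; apply/eqP; rewrite eqn_leq !le_size.
move=> [f [fE ffree _]] [g [_ _ gspan]].
have /boolp.choice[A HA] : forall i : 'I_p, exists a, eq_on_graph (f i) (lincomb a g).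
  by move=> i; exact: gspan.
pose B : 'M[R]_(p, q) := \matrix_(i, j) A i j.
suff: row_free B by move/eqP <-; exact: rank_leq_col.
rewrite -kermx_eq0; apply/eqP/row_matrixP => h; rewrite row0.
pose a := row h (kermx B).
have aB : a *m B = 0 by rewrite -row_mul mulmx_ker row0.
apply/rowP => i; rewrite [RHS]mxE; apply: (ffree (fun i => a 0 i)) => e x xe.
rewrite /lincomb (eq_bigr (fun i => \sum_j a 0 i * A i j * g j e x)); last first.
  by move=> j _; rewrite HA // /lincomb mulr_sumr; apply: eq_bigr => t _; rewrite mulrA.
rewrite exchange_big big1 // => j _; rewrite -mulr_suml.
have /rowP/(_ j) := aB; rewrite [LHS]mxE [RHS]mxE => aBj.
rewrite (eq_bigr (fun i => a 0 i * B i j)) ?aBj ?mul0r // => t _.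
by rewrite [B t j]mxE.
Qed.

Theorem isospectral_kernel_dim (R : realType) (G H : quantum_graph R) :
  isospectral G H -> forall p : R[i], p != 0 ->
  kernel_dim (bond_scattering G R) (@bond_length R G) p =
  kernel_dim (bond_scattering H R) (@bond_length R H) p.
Proof.
move=> GH p p0.
have nonreal (F : quantum_graph R) : Im p != 0 ->
    kernel_dim (bond_scattering F R) (@bond_length R F) p = 0%N.
  move=> /(secular_neq0 (bond_scattering_orthogonal F) (@bond_length_gt0 _ F)) sp.
  by rewrite /kernel_dim mxrank_unit ?subnn // unitmxE unitfE.
have [ip|ip] := eqVneq (Im p) 0; last by rewrite !nonreal.
have pE : p = rc (Re p) by apply: complex_eqP.
have k0 : Re p != 0 by apply: contra p0 => /eqP k0; rewrite pE k0 rmorph0.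
rewrite pE !kernel_dim_vertex_conditions.
have /GH mH := has_multiplicity_kernel G k0.
exact: multiplicity_unique mH (has_multiplicity_kernel H k0).
Qed.

(** * The shortest edge *)
(** The two secular determinants agree in modulus along the imaginary axis, but
    the longer shortest edge would make one of them decay faster to [1]. *)
Lemma shortest_edge_length_le (R : realType) (G H : quantum_graph R) :
  leafless G -> leafless H -> isospectral G H ->
  shortest_edge_length H <= shortest_edge_length G.
Proof.
move=> lG lH /isospectral_kernel_dim same.
have oG := bond_scattering_orthogonal G; have oH := bond_scattering_orthogonal H.
have sG := shortest_gt0 G; have sH := shortest_gt0 H.
have dE := damped_det_unique oG oH (@bond_length_gt0 _ G) (@bond_length_gt0 _ H) same.
have := decay_rate_le dE
  (damped_det_lower (orthogonal_entry_le1 oG) sG (@shortest_le _ G) (@shortest_loop_le _ G)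
    (@scattering_diag_ge0 _ G) (fun i j => scattering_pair_ge0 i j lG)
    (shortest_attained lG))
  (damped_det_upper (orthogonal_entry_le1 oG) sG (@shortest_le _ G) (@shortest_loop_le _ G))
  (damped_det_upper (orthogonal_entry_le1 oH) sH (@shortest_le _ H) (@shortest_loop_le _ H)).
by rewrite mulr_gt0 // ler_pM2l // => ->.
Qed.

Theorem lemma5p5 (R : realType) (G G1 G2 : quantum_graph R) :
  leafless G1 -> leafless G2 ->
  isospectral G1 G -> isospectral G2 G ->
  shortest_edge_length G1 = shortest_edge_length G2.
Proof.
move=> l1 l2 i1 i2.
have i12 : isospectral G1 G2 by move=> lambda m; rewrite i1 i2.
have i21 : isospectral G2 G1 by move=> lambda m; rewrite i1 i2.
by apply/eqP; rewrite eq_le !shortest_edge_length_le.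
Qed.
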